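(* None of the Brieskorn spheres $W^7_{6n-1,3}$ ($n\ge1$) is $\mathrm{SO}(3)$-equivariantly diffeomorphic to any of the $\Sigma^7_m$ ($m\in\mathbb{Z}$) or to any of the $M^7_{k,l}$ ($k,l\in\mathbb{Z}$, $k+l=1$).
   Context: Let $\mathbb{H}$ be the quaternions, $\mathbb{S}^3$ the unit quaternions, $\mathrm{SO}(3)=\mathbb{S}^3/\{\pm1\}$. Brieskorn spheres: $W^7_{6n-1,3}$ is the intersection of the unit sphere $\mathbb{S}^9\subset\mathbb{C}^5=\mathbb{C}\oplus\mathbb{C}\oplus\mathbb{C}^3\ni(w,z_0,z)$, $z=(z_1,z_2,z_3)$, with the hypersurface $w^{6n-1}+z_0^3+z_1^2+z_2^2+z_3^2=0$, with the $\mathrm{SO}(3)$-action $\bigl(A,(w,z_0,z)\bigr)\mapsto(w,z_0,Az)$. Milnor spheres: for integers $k,l$ with $k+l=1$, $M^7_{k,l}$ is obtained by gluing two copies of $\mathbb{H}\times\mathbb{S}^3$ along $(\mathbb{H}\setminus\{0\})\times\mathbb{S}^3$ by the map $(u,v)\mapsto\bigl(\tfrac{u}{|u|^2},(\tfrac{u}{|u|})^k\,v\,(\tfrac{u}{|u|})^l\bigr)$; $\mathrm{SO}(3)$ acts in both charts by $\pm q\bullet(u,v)=(qu\bar q,qv\bar q)$. Generalized Gromoll-Meyer spheres: let $\mathbb{S}^7\subset\mathbb{H}^2$ be the unit sphere (columns) and $\langle\langle u,v\rangle\rangle=\bar u^{\mathrm t}v$. For $m\in\mathbb{Z}$ define $\rho_m:\mathbb{S}^7\to\mathbb{S}^7$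 by $$\rho_m\begin{pmatrix}\cos t+p\sin t\\ w\sin t\end{pmatrix}=\begin{pmatrix}\cos mt+p\sin mt\\ w\sin mt\end{pmatrix},$$ where $t\in\mathbb{R}$, $p\in\operatorname{Im}\mathbb{H}$, $w\in\mathbb{H}$, $|p|^2+|w|^2=1$. Put $E_m^{10}=\{(u,v)\in\mathbb{S}^7\times\mathbb{S}^7 : \langle\langle\rho_m(u),v\rangle\rangle=0\}$, with the free $\mathbb{S}^3$-action $q\star(u,v)=(qu\bar q,qv)$ (both components of $u$ are conjugated by $q$), and let $\Sigma^7_m=E_m^{10}/\mathbb{S}^3$ be the $\star$-quotient. The action $q\bullet(u,v)=(u,v\bar q)$ of $\mathbb{S}^3$ on $E_m^{10}$ commutes with $\star$ and induces the $\mathrm{SO}(3)$-action on $\Sigma^7_m$. The abstract group $\mathrm{SO}(3)$ acting by matrices $A$ is identified with $\mathbb{S}^3/\{\pm1\}$ by letting $\pm q$ act on $\operatorname{Im}\mathbb{H}=\mathbb{R}^3$ by $x\mapsto qx\bar q$. *)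

(* Defs.v *)
From HB Require Import structures.
From Stdlib Require Import Relation_Operators.
From mathcomp Require Import all_boot all_order all_algebra.
From mathcomp Require Import all_classical all_reals all_analysis.
From mathcomp Require Import complex ring lra.

Set Implicit Arguments.
Unset Strict Implicit.
Unset Printing Implicit Defensive.

Import Order.TTheory GRing.Theory Num.Theory.
Import numFieldNormedType.Exports.

Local Open Scope classical_set_scope.
Local Open Scope quotient_scope.
Local Open Scope ring_scope.

(* Quaternions are rows (a, b, c, d) = a + b i + c j + d k.  The norm inherited
   from the normed module of matrices is the sup norm; it only serves to define
   the topology.  The Euclidean norm squared is [sqnorm].                     *)
Definition quat (R : realType) : Type := 'rV[R]_4.
HB.instance Definition _ (R : realType) :=
  NormedModule.copy (quat R) 'rV[R]_4.

Definition sqnorm (R : realType) (m n : nat) (A : 'M[R]_(m, n)) : R :=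
  \sum_i \sum_j A i j ^+ 2.

Section Quaternions.
Context {R : realType}.
Implicit Types p q r : quat R.

Definition mkq (a b c d : R) : quat R := \row_(i < 4) [:: a; b; c; d]`_i.
Definition q0 q : R := q ord0 (@Ordinal 4 0 isT).
Definition q1 q : R := q ord0 (@Ordinal 4 1 isT).
Definition q2 q : R := q ord0 (@Ordinal 4 2 isT).
Definition q3 q : R := q ord0 (@Ordinal 4 3 isT).

Definition oneq := mkq 1 0 0 0.
Definition mulq p q := mkq
  (q0 p * q0 q - q1 p * q1 q - q2 p * q2 q - q3 p * q3 q)
  (q0 p * q1 q + q1 p * q0 q + q2 p * q3 q - q3 p * q2 q)
  (q0 p * q2 q - q1 p * q3 q + q2 p * q0 q + q3 p * q1 q)
  (q0 p * q3 q + q1 p * q2 q - q2 p * q1 q + q3 p * q0 q).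
Definition conjq q := mkq (q0 q) (- q1 q) (- q2 q) (- q3 q).

Lemma quatP p q :
  q0 p = q0 q -> q1 p = q1 q -> q2 p = q2 q -> q3 p = q3 q -> p = q.
Proof.
move=> h0 h1 h2 h3; apply/rowP => -[[|[|[|[|//]]]] ik].
- by move: h0; rewrite /q0; congr (_ = _); congr (_ _ _); exact: val_inj.
- by move: h1; rewrite /q1; congr (_ = _); congr (_ _ _); exact: val_inj.
- by move: h2; rewrite /q2; congr (_ = _); congr (_ _ _); exact: val_inj.
- by move: h3; rewrite /q3; congr (_ = _); congr (_ _ _); exact: val_inj.
Qed.

Lemma q0E a b c d : q0 (mkq a b c d) = a. Proof. by rewrite /q0 mxE. Qed.
Lemma q1E a b c d : q1 (mkq a b c d) = b. Proof. by rewrite /q1 mxE. Qed.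
Lemma q2E a b c d : q2 (mkq a b c d) = c. Proof. by rewrite /q2 mxE. Qed.
Lemma q3E a b c d : q3 (mkq a b c d) = d. Proof. by rewrite /q3 mxE. Qed.
Lemma q0D p q : q0 (p + q) = q0 p + q0 q. Proof. by rewrite /q0 mxE. Qed.
Lemma q1D p q : q1 (p + q) = q1 p + q1 q. Proof. by rewrite /q1 mxE. Qed.
Lemma q2D p q : q2 (p + q) = q2 p + q2 q. Proof. by rewrite /q2 mxE. Qed.
Lemma q3D p q : q3 (p + q) = q3 p + q3 q. Proof. by rewrite /q3 mxE. Qed.
Lemma q0N p : q0 (- p) = - q0 p. Proof. by rewrite /q0 mxE. Qed.
Lemma q1N p : q1 (- p) = - q1 p. Proof. by rewrite /q1 mxE. Qed.
Lemma q2N p : q2 (- p) = - q2 p. Proof. by rewrite /q2 mxE. Qed.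
Lemma q3N p : q3 (- p) = - q3 p. Proof. by rewrite /q3 mxE. Qed.
Lemma q0Z a p : q0 (a *: p) = a * q0 p. Proof. by rewrite /q0 mxE. Qed.
Lemma q1Z a p : q1 (a *: p) = a * q1 p. Proof. by rewrite /q1 mxE. Qed.
Lemma q2Z a p : q2 (a *: p) = a * q2 p. Proof. by rewrite /q2 mxE. Qed.
Lemma q3Z a p : q3 (a *: p) = a * q3 p. Proof. by rewrite /q3 mxE. Qed.
Lemma q00 : q0 (0 : quat R) = 0. Proof. by rewrite /q0 mxE. Qed.
Lemma q10 : q1 (0 : quat R) = 0. Proof. by rewrite /q1 mxE. Qed.
Lemma q20 : q2 (0 : quat R) = 0. Proof. by rewrite /q2 mxE. Qed.
Lemma q30 : q3 (0 : quat R) = 0. Proof. by rewrite /q3 mxE. Qed.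

Definition qE := (q0E, q1E, q2E, q3E, q0D, q1D, q2D, q3D, q0N, q1N, q2N, q3N,
  q0Z, q1Z, q2Z, q3Z, q00, q10, q20, q30).

Lemma mulqA : associative mulq.
Proof. by move=> p q r; apply: quatP; rewrite !qE; ring. Qed.
Lemma mul1q : left_id oneq mulq.
Proof. by move=> p; apply: quatP; rewrite !qE; ring. Qed.
Lemma mulq1 : right_id oneq mulq.
Proof. by move=> p; apply: quatP; rewrite !qE; ring. Qed.
Lemma mulqDl : left_distributive mulq +%R.
Proof. by move=> p q r; apply: quatP; rewrite !qE; ring. Qed.
Lemma mulqDr : right_distributive mulq +%R.
Proof. by move=> p q r; apply: quatP; rewrite !qE; ring. Qed.
Lemma oneq_neq0 : oneq != 0.
Proof.
by apply/eqP => /(congr1 q0); rewrite !qE => /eqP; rewrite oner_eq0.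
Qed.

HB.instance Definition _ := GRing.Zmodule_isNzRing.Build (quat R)
  mulqA mul1q mulq1 mulqDl mulqDr oneq_neq0.

Lemma mulqE p q : p * q = mulq p q. Proof. by []. Qed.
Lemma oneqE : 1 = oneq. Proof. by []. Qed.

Lemma scaleqAl (a : R) p q : a *: (p * q) = (a *: p) * q.
Proof. by rewrite !mulqE; apply: quatP; rewrite !qE; ring. Qed.
Lemma scaleqAr (a : R) p q : a *: (p * q) = p * (a *: q).
Proof. by rewrite !mulqE; apply: quatP; rewrite !qE; ring. Qed.

HB.instance Definition _ :=
  GRing.Lmodule_isLalgebra.Build R (quat R) scaleqAl.
HB.instance Definition _ :=
  GRing.Lalgebra_isAlgebra.Build R (quat R) scaleqAr.

Lemma sqnormq q : sqnorm q = q0 q ^+ 2 + q1 q ^+ 2 + q2 q ^+ 2 + q3 q ^+ 2.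
Proof.
rewrite /sqnorm big_ord1 !big_ord_recr big_ord0 /= add0r.
by rewrite /q0 /q1 /q2 /q3; do ?congr (_ + _); congr (_ _ _ ^+ 2);
  apply: val_inj.
Qed.

Lemma sqnormq_eq0 q : (sqnorm q == 0) = (q == 0).
Proof.
apply/eqP/eqP => [|->]; last by rewrite sqnormq !qE; ring.
rewrite sqnormq => h; apply: quatP; rewrite !qE; apply/eqP;
  rewrite -sqrf_eq0; apply/eqP; move: (sqr_ge0 (q0 q)) (sqr_ge0 (q1 q))
    (sqr_ge0 (q2 q)) (sqr_ge0 (q3 q)); lra.
Qed.

Definition invq q := if q == 0 then 0 else (sqnorm q)^-1 *: conjq q.

Lemma mulVq : {in [pred q | q != 0], left_inverse 1 invq *%R}.
Proof.
move=> q; rewrite inE => qn0; have := qn0; rewrite -sqnormq_eq0 => nq.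
rewrite /invq (negbTE qn0) mulqE oneqE.
have {}nq : q0 q ^+ 2 + q1 q ^+ 2 + q2 q ^+ 2 + q3 q ^+ 2 != 0.
  by rewrite -sqnormq.
by rewrite sqnormq; apply: quatP; rewrite !qE; field.
Qed.

Lemma mulqV : {in [pred q | q != 0], right_inverse 1 invq *%R}.
Proof.
move=> q; rewrite inE => qn0; have := qn0; rewrite -sqnormq_eq0 => nq.
rewrite /invq (negbTE qn0) mulqE oneqE.
have {}nq : q0 q ^+ 2 + q1 q ^+ 2 + q2 q ^+ 2 + q3 q ^+ 2 != 0.
  by rewrite -sqnormq.
by rewrite sqnormq; apply: quatP; rewrite !qE; field.
Qed.

Lemma quat_unit p q : q * p = 1 /\ p * q = 1 -> p != 0.
Proof.
by case=> _ h; apply/eqP => p0; move: h; rewrite p0 mul0r => /esym/eqP;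
  rewrite oner_eq0.
Qed.

Lemma invq_out : {in [predC [pred q | q != 0]], invq =1 id}.
Proof. by move=> q; rewrite !inE negbK /invq => /eqP ->; rewrite eqxx. Qed.

HB.instance Definition _ := GRing.NzRing_hasMulInverse.Build (quat R)
  mulVq mulqV quat_unit invq_out.

Lemma sqnormqM p q : sqnorm (p * q) = sqnorm p * sqnorm q.
Proof. by rewrite mulqE !sqnormq !qE; ring. Qed.
Lemma sqnorm_conjq q : sqnorm (conjq q) = sqnorm q.
Proof. by rewrite !sqnormq !qE; ring. Qed.
Lemma conjqN q : conjq (- q) = - conjq q.
Proof. by apply: quatP; rewrite !qE. Qed.
Lemma sqnorm1q : sqnorm (1 : quat R) = 1.
Proof. by rewrite oneqE sqnormq !qE; ring. Qed.
Lemma sqnormqZ a q : sqnorm (a *: q) = a ^+ 2 * sqnorm q.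
Proof. by rewrite !sqnormq !qE; ring. Qed.
Lemma conjqM p q : conjq (p * q) = conjq q * conjq p.
Proof. by rewrite !mulqE; apply: quatP; rewrite !qE; ring. Qed.
Lemma conjqK : involutive conjq.
Proof. by move=> q; apply: quatP; rewrite !qE; ring. Qed.
Lemma mulq_conj q : sqnorm q = 1 -> q * conjq q = 1.
Proof. by rewrite sqnormq => h; rewrite mulqE oneqE; apply: quatP; rewrite !qE;
  [rewrite -h|..]; ring. Qed.
Lemma conj_mulq q : sqnorm q = 1 -> conjq q * q = 1.
Proof. by rewrite sqnormq => h; rewrite mulqE oneqE; apply: quatP; rewrite !qE;
  [rewrite -h|..]; ring. Qed.
Lemma invq_conj q : sqnorm q = 1 -> q^-1 = conjq q.
Proof.
move=> h; have u : q \is a GRing.unit.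
  by apply/unitrP; exists (conjq q); rewrite mulq_conj// conj_mulq.
by apply: (mulrI u); rewrite mulrV// mulq_conj.
Qed.
End Quaternions.

Section SmoothManifolds.
Context {R : realType}.

Fixpoint C_k (V W : normedModType R) (k : nat) (U : set V) (f : V -> W)
    : Prop :=
  if k is k'.+1 then
    (forall x, U x -> differentiable f x) /\
    (forall v : V, C_k k' U (fun x => 'D_v f x))
  else forall x, U x -> {for x, continuous f}.

(* C^oo on the open set [U] *)
Definition smooth_on (V W : normedModType R) (U : set V) (f : V -> W) : Prop :=
  forall k, C_k k U f.

(* [param] is the inverse of [coord] on the image of [chart_dom]; both functions are
   irrelevant elsewhere.                                                      *)
Record chart (T : topologicalType) (n : nat) := Chart {
  chart_dom : set T;
  coord : T -> 'rV[R]_n;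
  param : 'rV[R]_n -> T }.

Definition chart_cod (T : topologicalType) n (c : chart T n) : set 'rV[R]_n :=
  coord c @` chart_dom c.

Definition is_chart (T : topologicalType) n (c : chart T n) : Prop :=
  [/\ open (chart_dom c), open (chart_cod c),
      forall x, chart_dom c x -> param c (coord c x) = x,
      forall x, chart_dom c x -> {for x, continuous (coord c)} &
      forall y, chart_cod c y -> {for y, continuous (param c)}].

(* A smooth structure on [T] is given by a set of charts.  No compatibility or
   covering condition is imposed on it: the sets of charts used below are the
   maximal atlases of the manifolds in question.                              *)
Definition smooth_map (S T : topologicalType) (m n : nat)
    (A : set (chart S m)) (B : set (chart T n)) (f : S -> T) : Prop :=
  continuous f /\
  forall a b, A a -> B b ->
    smooth_on (coord a @` (chart_dom a `&` f @^-1` chart_dom b))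
              (coord b \o f \o param a).

Definition diffeomorphism (S T : topologicalType) (m n : nat)
    (A : set (chart S m)) (B : set (chart T n)) (f : S -> T) : Prop :=
  smooth_map A B f /\
  exists g : T -> S, [/\ cancel f g, cancel g f & smooth_map B A g].

(* The charts of an [n]-dimensional submanifold [X] of [V]: the diffeomorphisms,
   in the sense of subsets of normed spaces, from open subsets of [X] onto open
   subsets of R^n.                                                            *)
Definition submanifold_charts (V : normedModType R) (X : set V) (n : nat)
    : set (chart X n) :=
  [set c | [/\ is_chart c,
    smooth_on (chart_cod c) (fun y => set_val (param c y)) &
    forall x, chart_dom c x -> exists (O : set V) (g : V -> 'rV[R]_n),
      [/\ open O, O (set_val x), smooth_on O g &
          forall y, chart_dom c y -> O (set_val y) -> coord c y = g (set_val y)]]].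

Definition submersive_chart (S T : topologicalType) (m n : nat)
    (A : set (chart S m)) (f : S -> T) (c : chart T n) : Prop :=
  forall a, A a ->
    let h := coord c \o f \o param a in
    let U := coord a @` (chart_dom a `&` f @^-1` chart_dom c) in
    smooth_on U h /\ forall x, U x -> forall w, exists v, 'd h x v = w.

End SmoothManifolds.

Section Rotations.
Context {R : realType}.

Definition S3 : set (quat R) := [set q | sqnorm q = 1].
Definition SO3 : set 'M[R]_3 := [set A | A *m A^T = 1%:M /\ \det A = 1].

Definition imq (x : 'cV[R]_3) : quat R :=
  \row_(i < 4) if unlift ord0 i is Some j then x j 0 else 0.
Definition im_part (q : quat R) : 'cV[R]_3 := \col_j q 0 (lift ord0 j).

Definition rotmx (q : quat R) : 'M[R]_3 :=
  \matrix_(i, j) im_part (q * imq (delta_mx j 0) * conjq q) i 0.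

Lemma q0_imq x : q0 (imq x) = 0.
Proof. by rewrite /q0 mxE; case: unliftP => // j /(congr1 val). Qed.
Lemma imqK : cancel imq im_part.
Proof. by move=> x; apply/colP => i; rewrite !mxE liftK. Qed.
Lemma im_partK q : q0 q = 0 -> imq (im_part q) = q.
Proof.
move=> h; apply/rowP => i; rewrite mxE; case: unliftP => [j ->|->].
  by rewrite !mxE.
by rewrite -h /q0; congr (q _ _); exact: val_inj.
Qed.

Lemma im_part1 (q : quat R) : im_part q 0 0 = q1 q.
Proof. by rewrite mxE /q1; congr (q _ _); exact: val_inj. Qed.
Lemma im_part2 (q : quat R) : im_part q 1 0 = q2 q.
Proof. by rewrite mxE /q2; congr (q _ _); exact: val_inj. Qed.
Lemma im_part3 (q : quat R) : im_part q 2 0 = q3 q.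
Proof. by rewrite mxE /q3; congr (q _ _); exact: val_inj. Qed.

Lemma imqE x : imq x = mkq 0 (x 0 0) (x 1 0) (x 2 0).
Proof.
apply: quatP; rewrite !qE ?q0_imq// ?/q1 ?/q2 ?/q3 mxE;
  case: unliftP => [j|] /(congr1 val)// => -[] h; congr (x _ _);
  exact: val_inj.
Qed.

Lemma ord3P (P : 'I_3 -> Prop) : P 0 -> P 1 -> P 2 -> forall i, P i.
Proof.
move=> h0 h1 h2 [[|[|[|//]]] ik].
- by have -> : Ordinal ik = 0 by exact: val_inj.
- by have -> : Ordinal ik = 1 by exact: val_inj.
- by have -> : Ordinal ik = 2 by exact: val_inj.
Qed.

Lemma sum3 (F : 'I_3 -> R) : \sum_i F i = F 0 + F 1 + F 2.
Proof.
rewrite !big_ord_recr big_ord0 /= add0r.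
by do ?congr (_ + _); congr F; exact: val_inj.
Qed.

Lemma rotmxij (q : quat R) :
  ((rotmx q 0 0 = (q0 q ^+ 2 + q1 q ^+ 2 - q2 q ^+ 2 - q3 q ^+ 2)%R) *
   (rotmx q 1 0 = (2 * (q1 q * q2 q + q0 q * q3 q))%R) *
   (rotmx q 2 0 = (2 * (q1 q * q3 q - q0 q * q2 q))%R) *
   (rotmx q 0 1 = (2 * (q1 q * q2 q - q0 q * q3 q))%R) *
   (rotmx q 1 1 = (q0 q ^+ 2 - q1 q ^+ 2 + q2 q ^+ 2 - q3 q ^+ 2)%R) *
   (rotmx q 2 1 = (2 * (q2 q * q3 q + q0 q * q1 q))%R) *
   (rotmx q 0 2 = (2 * (q1 q * q3 q + q0 q * q2 q))%R) *
   (rotmx q 1 2 = (2 * (q2 q * q3 q - q0 q * q1 q))%R) *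
   (rotmx q 2 2 = (q0 q ^+ 2 - q1 q ^+ 2 - q2 q ^+ 2 + q3 q ^+ 2)%R))%type.
Proof.
have E i j : rotmx q i j = im_part (q * imq (delta_mx j 0) * conjq q) i 0.
  by rewrite mxE.
do !split; rewrite E imqE ?im_part1 ?im_part2 ?im_part3 !mulqE !qE !mxE /=;
  ring.
Qed.

Lemma rotmxE (q : quat R) (x : 'cV[R]_3) :
  imq (rotmx q *m x) = q * imq x * conjq q.
Proof.
rewrite !imqE; have E i : (rotmx q *m x) i 0 =
    rotmx q i 0 * x 0 0 + rotmx q i 1 * x 1 0 + rotmx q i 2 * x 2 0.
  by rewrite mxE sum3.
by rewrite !E !rotmxij !mulqE; apply: quatP; rewrite !qE; ring.
Qed.

Lemma det33 (A : 'M[R]_3) :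
  \det A = A 0 0 * (A 1 1 * A 2 2 - A 1 2 * A 2 1)
         - A 0 1 * (A 1 0 * A 2 2 - A 1 2 * A 2 0)
         + A 0 2 * (A 1 0 * A 2 1 - A 1 1 * A 2 0).
Proof.
rewrite (expand_det_row _ 0) sum3 /cofactor.
do 3 rewrite (expand_det_row (row' _ (col' _ A)) 0) !big_ord_recr big_ord0 /=
  /cofactor !det_mx11 !mxE /=.
pose B (i j : nat) := A (inord i) (inord j).
have AE i j : A i j = B i j by rewrite /B !inord_val.
by rewrite !AE /= /bump /=; ring.
Qed.

Lemma rotmx_SO3 (q : quat R) : S3 q -> SO3 (rotmx q).
Proof.
rewrite /S3 /= sqnormq => h; split.
  have E i j : (rotmx q *m (rotmx q)^T) i j = rotmx q i 0 * rotmx q j 0 +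
      rotmx q i 1 * rotmx q j 1 + rotmx q i 2 * rotmx q j 2.
    by rewrite mxE sum3 !mxE.
  have h2 : (q0 q ^+ 2 + q1 q ^+ 2 + q2 q ^+ 2 + q3 q ^+ 2) ^+ 2 = 1.
    by rewrite h expr1n.
  have {}E i j : (rotmx q *m (rotmx q)^T) i j =
      (q0 q ^+ 2 + q1 q ^+ 2 + q2 q ^+ 2 + q3 q ^+ 2) ^+ 2 *+ (i == j).
    by elim/ord3P: i; elim/ord3P: j; rewrite E !rotmxij /= ?mulr1n ?mulr0n;
      ring.
  by apply/matrixP => i j; rewrite E h2 mxE.
have h3 : (q0 q ^+ 2 + q1 q ^+ 2 + q2 q ^+ 2 + q3 q ^+ 2) ^+ 3 = 1.
  by rewrite h expr1n.
by rewrite det33 !rotmxij -[RHS]h3; ring.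
Qed.
End Rotations.

Definition pt (T : Type) (A : set T) (x : T) (Ax : A x) : A :=
  exist _ x (mem_set Ax).

Lemma ptP (T : Type) (A : set T) (x : A) : A (set_val x).
Proof. by rewrite set_valE; exact: set_mem (valP x). Qed.

Lemma set_val_pt (T : Type) (A : set T) (x : T) (Ax : A x) :
  set_val (pt Ax) = x.
Proof. by rewrite set_valE. Qed.

Lemma set_val_inj (T : Type) (A : set T) : injective (@set_val T A).
Proof. by rewrite set_valE => x y; exact: val_inj. Qed.

Section S3group.
Context {R : realType}.
Local Notation S3 := (@S3 R).
Implicit Types q : S3.

Definition rot q : @SO3 R := pt (rotmx_SO3 (ptP q)).

Lemma S3P q : sqnorm (set_val q) = 1. Proof. exact: (ptP q). Qed.
Lemma S3M q q' : S3 (set_val q * set_val q').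
Proof. by rewrite /S3 /= sqnormqM !S3P mulr1. Qed.
Lemma S3V q : S3 (conjq (set_val q)).
Proof. by rewrite /S3 /= sqnorm_conjq S3P. Qed.
Lemma S31 : S3 1. Proof. by rewrite /S3 /= sqnorm1q. Qed.

Definition mulS3 q q' : S3 := pt (S3M q q').
Definition invS3 q : S3 := pt (S3V q).
Definition oneS3 : S3 := pt S31.

Lemma S3N q : S3 (- set_val q).
Proof. by rewrite /S3 /= -[- _]mulN1r sqnormqM S3P mulr1 -[RHS]sqnorm1q
  !sqnormq oneqE !qE; ring. Qed.

Definition oppS3 q : S3 := pt (S3N q).

Lemma rotN q : rot (oppS3 q) = rot q.
Proof.
apply: set_val_inj; rewrite !set_val_pt; apply/matrixP => i j.
by rewrite ![rotmx _ _ _]mxE conjqN !mulNr mulrN opprK.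
Qed.
End S3group.
Arguments oneS3 : clear implicits.

Section Brieskorn.
Context {R : realType}.

(* C (+) C (+) C^3 as a real normed space: complex numbers are rows
   (real part, imaginary part), and the rows of the 3 x 2 matrix are the
   z_1, z_2, z_3.                                                             *)
Definition C5 : normedModType R := ('rV[R]_2 * 'rV[R]_2 * 'M[R]_(3, 2))%type.

Definition toC (a : 'rV[R]_2) : R[i] := (a 0 0 +i* a 0 1)%C.

Definition brieskorn (a b : nat) : set C5 :=
  [set x | let: (w, z0, z) := x in
    sqnorm w + sqnorm z0 + sqnorm z = 1 /\
    toC w ^+ a + toC z0 ^+ b + \sum_(j < 3) toC (row j z) ^+ 2 = 0].

Lemma sum_toC2 (z : 'M[R]_(3, 2)) : \sum_(j < 3) toC (row j z) ^+ 2 =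
  (((z^T *m z) 0 0 - (z^T *m z) 1 1) +i* (2 * (z^T *m z) 0 1))%C.
Proof.
rewrite !mxE !big_ord_recr !big_ord0 /= /toC !mxE; apply/eqP.
by rewrite eq_complex /=; apply/andP; split; apply/eqP; ring.
Qed.

Lemma sqnorm_gram (z : 'M[R]_(3, 2)) : sqnorm z = \tr (z^T *m z).
Proof.
rewrite /sqnorm exchange_big; apply: eq_bigr => j _; rewrite mxE.
by apply: eq_bigr => i _; rewrite mxE expr2.
Qed.

Lemma gram_rot (A : 'M[R]_3) (z : 'M[R]_(3, 2)) :
  SO3 A -> (A *m z)^T *m (A *m z) = z^T *m z.
Proof.
by case=> /mulmx1C hA _; rewrite trmx_mul -mulmxA (mulmxA A^T) hA mul1mx.
Qed.

Lemma brieskorn_act_in a b (A : @SO3 R) (x : brieskorn a b) :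
  brieskorn a b ((set_val x).1, set_val A *m (set_val x).2).
Proof.
case: (set_val x) (ptP x) => -[w z0] z /= [h1 h2].
rewrite sqnorm_gram sum_toC2 gram_rot; last exact: (ptP A).
by rewrite -sum_toC2 -h1 sqnorm_gram; split.
Qed.

Definition brieskorn_act a b (A : @SO3 R) (x : brieskorn a b)
    : brieskorn a b :=
  pt (brieskorn_act_in A x).

Definition brieskorn_charts a b := @submanifold_charts R C5 (brieskorn a b) 7.
End Brieskorn.

Section GromollMeyer.
Context {R : realType}.
Local Notation H2 := (quat R * quat R)%type.

Definition S7 : set H2 := [set u | sqnorm u.1 + sqnorm u.2 = 1].

Definition hdot (u v : H2) : quat R := conjq u.1 * v.1 + conjq u.2 * v.2.

Definition rho_param (t : R) (p w : quat R) : H2 :=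
  (cos t *: 1 + sin t *: p, sin t *: w).

Definition rho_dir (p w : quat R) : Prop :=
  q0 p = 0 /\ sqnorm p + sqnorm w = 1.

(* [rhoE] and [rho_paramP] show that this is the well-defined map of S^7; the
   value off S^7 is irrelevant.                                               *)
Definition rho (m : int) (u : H2) : H2 :=
  xget 0 [set u' | exists t p w, [/\ rho_dir p w, u = rho_param t p w &
                                     u' = rho_param (m%:~R * t) p w]].

Definition qdot (p q : quat R) : R :=
  q0 p * q0 q + q1 p * q1 q + q2 p * q2 q + q3 p * q3 q.

Lemma rho_param_cos t p w : q0 p = 0 -> q0 (rho_param t p w).1 = cos t.
Proof. by move=> h; rewrite /rho_param oneqE !qE h; ring. Qed.

Lemma rho_param_uniq (n : nat) t p w t' p' w' :
  rho_dir p w -> rho_dir p' w' -> rho_param t p w = rho_param t' p' w' ->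
  rho_param (n%:R * t) p w = rho_param (n%:R * t') p' w'.
Proof.
move=> [p0 pw] [p0' pw'] [e1 e2].
have ec : cos t = cos t'.
  by rewrite -(rho_param_cos t w p0) -(rho_param_cos t' w' p0') /= e1.
have ep : sin t *: p = sin t' *: p' by move: e1; rewrite ec => /addrI.
suff [H1 H2 H3] : [/\ cos (n%:R * t) = cos (n%:R * t'),
    sin (n%:R * t) *: p = sin (n%:R * t') *: p' &
    sin (n%:R * t) *: w = sin (n%:R * t') *: w'].
  by rewrite /rho_param H1 H2 H3.
elim: n => [|n [H1 H2 H3]]; first by rewrite !mul0r !sin0 !scale0r.
have sE s (x : R) (a b : quat R) : qdot (s *: a) (x *: b) = s * x * qdot a b.
  by rewrite /qdot !qE; ring.
have qdotE a : qdot a a = sqnorm a by rewrite sqnormq /qdot; ring.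
have es : sin t * sin (n%:R * t) = sin t' * sin (n%:R * t').
  have E s x (a b : quat R) : rho_dir a b ->
      s * x = qdot (s *: a) (x *: a) + qdot (s *: b) (x *: b).
    by case=> _ h; rewrite !sE !qdotE -mulrDr h mulr1.
  by rewrite (E _ _ p w)// (E (sin t') _ p' w')// ep H2 e2 H3.
have Z (x y : R) (v : quat R) : (x * y) *: v = y *: (x *: v).
  by rewrite mulrC scalerA.
have nS (x : R) : n.+1%:R * x = x + n%:R * x.
  by rewrite -natr1 mulrDl mul1r addrC.
rewrite !nS !cosD !sinD; split.
- by rewrite H1 ec es.
- by rewrite !scalerDl (Z (sin t)) (Z (sin t')) -!scalerA ep H2 H1 ec.
- by rewrite !scalerDl (Z (sin t)) (Z (sin t')) -!scalerA e2 H3 H1 ec.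
Qed.

Lemma rho_paramN t p w :
  rho_param (- t) p w = ((rho_param t p w).1 - (sin t *: p) *+ 2,
                         - (rho_param t p w).2).
Proof.
rewrite /rho_param cosN sinN !scaleNr /=; congr (_, _).
by rewrite mulr2n opprD addrA addrK.
Qed.

Lemma rhoE (m : int) t p w : rho_dir p w ->
  rho m (rho_param t p w) = rho_param (m%:~R * t) p w.
Proof.
move=> pw; rewrite /rho; apply: xget_unique; first by exists t, p, w.
move=> _ [t' [p' [w' [pw' E ->]]]].
have nat_case n : rho_param (n%:R * t') p' w' = rho_param (n%:R * t) p w.
  by apply: rho_param_uniq.
case: m => n; first exact: nat_case.
rewrite NegzE !mulrNz !mulNr !rho_paramN.
rewrite -!pmulrn; have E' := nat_case n.+1; rewrite E'.
move: E'; rewrite /rho_param => -[E1 _]; congr (_ - _ *+ 2, _).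
suff ec : cos (n.+1%:R * t') = cos (n.+1%:R * t) by move: E1; rewrite ec => /addrI.
by move: E1 => /(congr1 q0); rewrite oneqE !qE pw.1 pw'.1 !mulr1 !mulr0 !addr0.
Qed.

Lemma rho_paramP (u : H2) : S7 u ->
  exists t p w, rho_dir p w /\ u = rho_param t p w.
Proof.
case: u => u v; rewrite /S7 /= sqnormq => h.
have c1 : -1 <= q0 u <= 1.
  have : q0 u ^+ 2 <= 1.
    move: (sqr_ge0 (q1 u)) (sqr_ge0 (q2 u)) (sqr_ge0 (q3 u)) h.
    by rewrite (sqnormq v); move: (sqr_ge0 (q0 v)) (sqr_ge0 (q1 v))
      (sqr_ge0 (q2 v)) (sqr_ge0 (q3 v)); lra.
  by move=> hc; apply/andP; split; nra.
pose t := acos (q0 u).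
have ct : cos t = q0 u by rewrite acosK.
have st : sin t ^+ 2 = q1 u ^+ 2 + q2 u ^+ 2 + q3 u ^+ 2 + sqnorm v.
  by rewrite sin2cos2 ct -h; ring.
pose p' := mkq 0 (q1 u) (q2 u) (q3 u).
have uE : u = cos t *: 1 + p'.
  by rewrite ct oneqE; apply: quatP; rewrite !qE; ring.
have np' : sqnorm p' = q1 u ^+ 2 + q2 u ^+ 2 + q3 u ^+ 2.
  by rewrite sqnormq !qE; ring.
have [s0|s0] := eqVneq (sin t) 0.
  exists t, (mkq 0 1 0 0), 0; split.
    by split; rewrite ?qE// !sqnormq !qE; ring.
  have : sqnorm p' + sqnorm v = 0 by rewrite np' -st s0 expr0n.
  have P (x : quat R) : 0 <= sqnorm x.
    by rewrite sqnormq !addr_ge0// sqr_ge0.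
  move=> /eqP; rewrite paddr_eq0// !sqnormq_eq0 => /andP[/eqP p0 /eqP v0].
  by rewrite /rho_param s0 !scale0r {1}uE p0 v0.
exists t, ((sin t)^-1 *: p'), ((sin t)^-1 *: v); split.
  split; first by rewrite !qE mulr0.
  by rewrite !sqnormqZ np' -mulrDr -st -exprMn mulVf// expr1n.
by rewrite /rho_param !scalerA divff// !scale1r -uE.
Qed.

Definition conjH (q : quat R) (u : H2) : H2 :=
  (q * u.1 * conjq q, q * u.2 * conjq q).

Lemma q0_conj (q p : quat R) :
  sqnorm q = 1 -> q0 (q * p * conjq q) = q0 p.
Proof.
rewrite sqnormq => h; rewrite !mulqE !qE.
by rewrite -[RHS]mul1r -h; ring.
Qed.

Lemma sqnorm_conj (q p : quat R) :
  sqnorm q = 1 -> sqnorm (q * p * conjq q) = sqnorm p.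
Proof. by move=> h; rewrite !sqnormqM sqnorm_conjq h mul1r mulr1. Qed.

Lemma S7_conjH (q : S3) u : S7 u -> S7 (conjH (set_val q) u).
Proof. by rewrite /S7 /= !sqnorm_conj ?S3P. Qed.

Lemma rho_conjH m (q : @S3 R) u : S7 u ->
  rho m (conjH (set_val q) u) = conjH (set_val q) (rho m u).
Proof.
have hq := S3P q; move: (set_val q) hq => {}q hq.
move=> /rho_paramP[t [p [w [pw ->]]]]; rewrite rhoE//.
have E s : conjH q (rho_param s p w) =
    rho_param s (q * p * conjq q) (q * w * conjq q).
  rewrite /conjH /rho_param /= mulrDr mulrDl -!scalerAr -!scalerAl mulr1.
  by rewrite mulq_conj// -!scalerAr -!scalerAl.
by rewrite !E rhoE//; case: pw => ? ?; split; rewrite ?q0_conj// !sqnorm_conj.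
Qed.

Definition gm_total (m : int) : set (H2 * H2) :=
  [set x | [/\ S7 x.1, S7 x.2 & hdot (rho m x.1) x.2 = 0]].

Definition star_fun (q : quat R) (x : H2 * H2) : H2 * H2 :=
  (conjH q x.1, (q * x.2.1, q * x.2.2)).

Definition bullet_fun (q : quat R) (x : H2 * H2) : H2 * H2 :=
  (x.1, (x.2.1 * conjq q, x.2.2 * conjq q)).

Lemma star_in m (q : @S3 R) (x : gm_total m) :
  gm_total m (star_fun (set_val q) (set_val x)).
Proof.
case: (set_val x) (ptP x) => u v [/= hu hv h0]; split => /=.
- exact: S7_conjH.
- by rewrite /S7 /= !sqnormqM S3P !mul1r.
- rewrite rho_conjH//; move: h0; rewrite /hdot /conjH /= => h0.
  have E (a b : quat R) : conjq (set_val q * a * conjq (set_val q)) *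
      (set_val q * b) = set_val q * (conjq a * b).
    rewrite !conjqM conjqK -!mulrA (mulrA (conjq _) (set_val q)) conj_mulq ?S3P//.
    by rewrite mul1r.
  by rewrite !E -mulrDr h0 mulr0.
Qed.

Lemma bullet_in m (q : @S3 R) (x : gm_total m) :
  gm_total m (bullet_fun (set_val q) (set_val x)).
Proof.
case: (set_val x) (ptP x) => u v [/= hu hv h0]; split => //=.
- by rewrite /S7 /= !sqnormqM sqnorm_conjq S3P !mulr1.
- by rewrite /hdot /= !mulrA -mulrDl -/(hdot _ _) h0 mul0r.
Qed.

Definition star m (q : @S3 R) (x : gm_total m) : gm_total m :=
  pt (star_in q x).

Definition gm_bullet m (q : @S3 R) (x : gm_total m) : gm_total m :=
  pt (bullet_in q x).

Lemma star1 m (x : gm_total m) : star (oneS3 R) x = x.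
Proof.
apply: set_val_inj; rewrite !set_val_pt; case: (set_val x) => -[u1 u2] [v1 v2].
have c1 : conjq (1 : quat R) = 1 by rewrite -[LHS]mulr1 conj_mulq// sqnorm1q.
by rewrite /star_fun /conjH /= c1 !mul1r !mulr1.
Qed.

Lemma starM m (q q' : @S3 R) (x : gm_total m) :
  star q (star q' x) = star (mulS3 q q') x.
Proof.
apply: set_val_inj; rewrite !set_val_pt; case: (set_val x) => -[u1 u2] [v1 v2].
by rewrite /star_fun /conjH /= conjqM !mulrA.
Qed.

Lemma starVK m (q : @S3 R) (x : gm_total m) : star (invS3 q) (star q x) = x.
Proof.
have E : mulS3 (invS3 q) q = oneS3 R.
  by apply: set_val_inj; rewrite !set_val_pt conj_mulq ?S3P.
by rewrite starM E star1.
Qed.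

Lemma star_bullet m (q q' : @S3 R) (x : gm_total m) :
  gm_bullet q (star q' x) = star q' (gm_bullet q x).
Proof.
apply: set_val_inj; rewrite !set_val_pt; case: (set_val x) => -[u1 u2] [v1 v2].
by rewrite /star_fun /bullet_fun /= !mulrA.
Qed.

Definition star_orbit m : rel (gm_total m) :=
  fun x y => `[< exists q : @S3 R, y = star q x >].

Lemma star_orbit_refl m : reflexive (@star_orbit m).
Proof. by move=> x; apply/asboolP; exists (oneS3 R); rewrite star1. Qed.

Lemma star_orbit_sym m : symmetric (@star_orbit m).
Proof.
by move=> x y; apply/asboolP/asboolP => -[q ->]; exists (invS3 q);
  rewrite starVK.
Qed.

Lemma star_orbit_trans m : transitive (@star_orbit m).
Proof.
move=> y x z /asboolP[q ->] /asboolP[q' ->]; apply/asboolP.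
by exists (mulS3 q' q); rewrite starM.
Qed.

Canonical star_orbit_equiv m := EquivRel (@star_orbit m)
  (@star_orbit_refl m) (@star_orbit_sym m) (@star_orbit_trans m).

Definition Sigma7 (m : int) : topologicalType :=
  quotient_topology {eq_quot (@star_orbit m)}.

Definition Sigma7_pi m (x : gm_total m) : Sigma7 m :=
  \pi_({eq_quot (@star_orbit m)}) x.

Definition Sigma7_repr m (c : Sigma7 m) : gm_total m :=
  repr (c : {eq_quot (@star_orbit m)}).

Lemma Sigma7_reprK m : cancel (@Sigma7_repr m) (@Sigma7_pi m).
Proof. exact: reprK. Qed.

Lemma Sigma7_piP m (x y : gm_total m) :
  Sigma7_pi x = Sigma7_pi y <-> exists q : @S3 R, y = star q x.
Proof.
split=> [/(eqmodP (star_orbit_equiv m))/asboolP //|h].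
by apply/(eqmodP (star_orbit_equiv m))/asboolP.
Qed.

Definition Sigma7_act m (q : @S3 R) (c : Sigma7 m) : Sigma7 m :=
  Sigma7_pi (gm_bullet q (Sigma7_repr c)).

Lemma Sigma7_actE m (q : @S3 R) (x : gm_total m) :
  Sigma7_act q (Sigma7_pi x) = Sigma7_pi (gm_bullet q x).
Proof.
have /Sigma7_piP[q' E] := Sigma7_reprK (Sigma7_pi x).
by apply/Sigma7_piP; exists q'; rewrite -star_bullet -E.
Qed.

Lemma Sigma7_actN m (q : @S3 R) (c : Sigma7 m) :
  Sigma7_act (oppS3 q) c = Sigma7_act q c.
Proof.
apply/Sigma7_piP; exists (oppS3 (oneS3 R)); apply: set_val_inj.
rewrite !set_val_pt; case: (set_val (Sigma7_repr c)) => -[u1 u2] [v1 v2].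
have c1 : conjq (1 : quat R) = 1 by rewrite -[LHS]mulr1 conj_mulq// sqnorm1q.
rewrite /star_fun /bullet_fun /conjH /= !conjqN c1.
by rewrite !(mulNr, mulrN, mul1r, mulr1, opprK).
Qed.

(* The unique smooth structure making the projection a submersion. *)
Definition Sigma7_charts m : set (@chart R (Sigma7 m) 7) :=
  [set c | is_chart c /\
    submersive_chart (@submanifold_charts R _ (gm_total m) 10)
      (@Sigma7_pi m) c].
End GromollMeyer.

Section Milnor.
Context {R : realType}.
Local Notation H2 := (quat R * quat R)%type.

Definition HxS3 : set H2 := [set x | sqnorm x.2 = 1].

(* [^] is the integer power in the division ring of quaternions. *)
Definition glue (k l : int) (x : H2) : H2 :=
  let: (u, v) := x in
  let r := (Num.sqrt (sqnorm u))^-1 *: u in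
  ((sqnorm u)^-1 *: u, r ^ k * v * r ^ l).

Definition two_HxS3 : topologicalType := {_ : bool & HxS3}.

Definition chart_map (b : bool) (x : HxS3) : two_HxS3 :=
  existT (fun=> set_type HxS3) b x.

Definition glue_step k l (a b : two_HxS3) : Prop :=
  exists x y : HxS3, [/\ a = chart_map false x, b = chart_map true y,
    (set_val x).1 != 0 & set_val y = glue k l (set_val x)].

Definition glue_rel k l : rel two_HxS3 :=
  fun a b => `[< clos_refl_sym_trans two_HxS3 (glue_step k l) a b >].

Lemma glue_rel_refl k l : reflexive (glue_rel k l).
Proof. by move=> x; apply/asboolP; exact: rst_refl. Qed.

Lemma glue_rel_sym k l : symmetric (glue_rel k l).
Proof. by move=> x y; apply/asboolP/asboolP => h; exact: rst_sym. Qed.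

Lemma glue_rel_trans k l : transitive (glue_rel k l).
Proof.
move=> y x z /asboolP xy /asboolP yz; apply/asboolP; exact: rst_trans xy yz.
Qed.

Canonical glue_rel_equiv k l := EquivRel (glue_rel k l)
  (@glue_rel_refl k l) (@glue_rel_sym k l) (@glue_rel_trans k l).

Definition milnor (k l : int) : topologicalType :=
  quotient_topology {eq_quot (glue_rel k l)}.

Definition milnor_pi k l (x : two_HxS3) : milnor k l :=
  \pi_({eq_quot (glue_rel k l)}) x.

Definition milnor_repr k l (c : milnor k l) : two_HxS3 :=
  repr (c : {eq_quot (glue_rel k l)}).

Lemma milnor_reprK k l : cancel (@milnor_repr k l) (@milnor_pi k l).
Proof. exact: reprK. Qed.

Lemma milnor_piP k l (x y : two_HxS3) :
  milnor_pi k l x = milnor_pi k l y <->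
  clos_refl_sym_trans two_HxS3 (glue_step k l) x y.
Proof.
split=> [/(eqmodP (glue_rel_equiv k l))/asboolP //|h].
by apply/(eqmodP (glue_rel_equiv k l))/asboolP.
Qed.

(* Both copies of H x S^3, which also has dimension 7, are embedded by local
   diffeomorphisms.                                                           *)
Definition milnor_charts k l : set (@chart R (milnor k l) 7) :=
  [set c | is_chart c /\ forall b,
    submersive_chart (@submanifold_charts R _ HxS3 7)
      (fun x : HxS3 => milnor_pi k l (chart_map b x)) c].

Lemma HxS3_act_in (q : @S3 R) (x : HxS3) :
  HxS3 (conjH (set_val q) (set_val x)).
Proof. by rewrite /HxS3 /= sqnorm_conj ?S3P//; exact: (ptP x). Qed.

Definition HxS3_act (q : @S3 R) (x : HxS3) : HxS3 := pt (HxS3_act_in q x).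

Definition two_HxS3_act (q : @S3 R) (x : two_HxS3) : two_HxS3 :=
  chart_map (projT1 x) (HxS3_act q (projT2 x)).

Lemma conj_expz (q r : quat R) (k : int) : sqnorm q = 1 -> sqnorm r = 1 ->
  (q * r * conjq q) ^ k = q * r ^ k * conjq q.
Proof.
move=> hq hr; have X n (s : quat R) :
    (q * s * conjq q) ^+ n = q * s ^+ n * conjq q.
  elim: n => [|n IH]; first by rewrite !expr0 mulr1 mulq_conj.
  by rewrite !exprS IH !mulrA -(mulrA _ (conjq q) q) conj_mulq// mulr1.
case: k => n; rewrite -?exprnP; first exact: X.
rewrite NegzE -!exprnN -!exprVn !invq_conj//; last by rewrite sqnorm_conj.
by rewrite !conjqM conjqK mulrA X.
Qed.

Lemma glue_conjH k l (q : quat R) (x : H2) : sqnorm q = 1 -> x.1 != 0 ->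
  glue k l (conjH q x) = conjH q (glue k l x).
Proof.
case: x => u v hq /= un0; rewrite /glue /conjH /= sqnorm_conj//.
have nu : 0 < sqnorm u.
  rewrite lt_def sqnormq_eq0 un0 /= sqnormq.
  by rewrite !addr_ge0// sqr_ge0.
set s := Num.sqrt _; set r := s^-1 *: u.
have hr : sqnorm r = 1.
  by rewrite sqnormqZ exprVn sqr_sqrtr ?ltW// mulVf// gt_eqF.
have E : s^-1 *: (q * u * conjq q) = q * r * conjq q.
  by rewrite scalerAl scalerAr.
congr (_, _); first by rewrite scalerAl scalerAr.
rewrite E !conj_expz// !mulrA.
by rewrite -!(mulrA _ (conjq q) q) conj_mulq// !mulr1.
Qed.

Lemma glue_step_act k l (q : @S3 R) a b : glue_step k l a b ->
  glue_step k l (two_HxS3_act q a) (two_HxS3_act q b).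
Proof.
case=> x [y [-> -> x0 E]]; exists (HxS3_act q x), (HxS3_act q y).
split=> //; rewrite !set_val_pt.
  rewrite /= -sqnormq_eq0 sqnorm_conj ?S3P// sqnormq_eq0//.
by rewrite glue_conjH ?S3P// E.
Qed.

Definition milnor_act k l (q : @S3 R) (c : milnor k l) : milnor k l :=
  milnor_pi k l (two_HxS3_act q (milnor_repr c)).

Lemma milnor_actE k l (q : @S3 R) (x : two_HxS3) :
  milnor_act q (milnor_pi k l x) = milnor_pi k l (two_HxS3_act q x).
Proof.
have /milnor_piP h := milnor_reprK (milnor_pi k l x).
apply/milnor_piP; move: (milnor_repr _) h => r; elim=> [a b ab|a|a b _ IH|a b c _ ab _ bc].
- exact: rst_step (glue_step_act q ab).
- exact: rst_refl.
- exact: rst_sym.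
- exact: rst_trans ab bc.
Qed.

Lemma milnor_actN k l (q : @S3 R) (c : milnor k l) :
  milnor_act (oppS3 q) c = milnor_act q c.
Proof.
congr (milnor_pi k l _); congr (chart_map _ _); apply: set_val_inj.
by rewrite !set_val_pt /conjH !conjqN !(mulNr, mulrN, opprK).
Qed.
End Milnor.

Section Equivariance.
Context {R : realType}.

(* The group SO(3) acts on [X] by matrices, and on [Y] through its double cover
   [rot] by S^3; equivariance is stated over S^3, [rot] being onto SO(3).     *)
Definition SO3_diffeomorphic (X Y : topologicalType) (m n : nat)
    (A : set (@chart R X m)) (actX : @SO3 R -> X -> X)
    (B : set (@chart R Y n)) (actY : @S3 R -> Y -> Y) : Prop :=
  exists f : X -> Y, diffeomorphism A B f /\
    forall q x, f (actX (rot q) x) = actY q (f x).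
End Equivariance.

Arguments brieskorn R a b : clear implicits.
Arguments Sigma7 R m : clear implicits.
Arguments milnor R k l : clear implicits.
Arguments brieskorn_charts R a b : clear implicits.
Arguments Sigma7_charts R m : clear implicits.
Arguments milnor_charts R k l : clear implicits.

(* Main.v *)
Require Import Defs.
From Stdlib Require Import Relation_Operators.
From mathcomp Require Import all_boot all_order all_algebra.
From mathcomp Require Import all_classical all_reals all_analysis.
From mathcomp Require Import complex ring lra zify.

(** The reason is the topology of fixed point sets. An equivariant
    diffeomorphism maps the points fixed by the rotation of the quaternion i onto
    the points fixed by i, and likewise for j
    ([not_diffeomorphic_of_model]). In the Brieskorn manifold of the exponents q
    and p, here 6 n - 1 and 3, the points fixed by i form the 3-manifold
    w^q + z0^p + z1^2 = 0 in the 5-sphere, and those fixed by j as well form its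
    subset z1 = 0, the torus knot w^q + z0^p = 0 in the 3-sphere. In both
    families on the other side the points fixed by i form the unit sphere of C^2
    and those fixed by j as well are the real pairs, a great circle
    ([milnor_model], [gm_model] and the lemmas on them). So it suffices to show
    that no embedding g of the 3-sphere onto the 3-manifold carries a great circle
    onto the knot, for odd p and q greater than 2 ([brieskorn3_not_sphere]). This
    says, essentially, that torus knots are knotted.

    The complement of a great circle in the 3-sphere is the product of a circle
    and an open disc, with universal cover R^3 ([to_sphere]). The function
    f = w^q + z0^p = - z1^2 has no zero on the complement of the knot, so on R^3
    it has a continuous angle lam ([continuous_angle]). Multiplying z0 and w by
    exp (- i lam / p) and exp (- i lam / q) maps R^3 to the curve where
    w^q + z0^p is positive. This curve contains the join of the p-th and the q-th
    roots of unity as the arcs (a eta, b omega) with a and b nonnegative,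
    eta^q = 1 and omega^p = 1. Its part where w, z0, w^q and z0^p have positive
    real parts is a union of strips, one of which contains the interior of the arc
    with eta = omega = 1, while none meets an arc on which eta or omega has
    negative real part. A map to the unit circle which winds once around across
    each of these strips and is 1 elsewhere is continuous, and on R^3 it has a
    continuous real angle tau. Four arcs form a cycle of which exactly one passes
    through a strip; along a lift of this cycle to R^3, tau grows by 2 pi.

    The lift is closed, which is a contradiction. Indeed f is positive along the
    arcs, so lam is the same at both ends of the lift, and these differ by a deck
    transformation. Such a transformation adds a multiple of 2 pi k to lam, with a
    constant k. Here k is not 0: along an orbit of the weighted circle action on
    the 3-manifold, lam grows by 4 p pi, while the lift of that loop joins two
    points which differ by a deck transformation.

    Paths of the 3-manifold off the knot lift to R^3 because g, a continuous
    injection of a compact space, has a continuous inverse on its image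
    ([compact_embedding_factor]). *)

Set Implicit Arguments.
Unset Strict Implicit.
Unset Printing Implicit Defensive.

Import Order.TTheory GRing.Theory Num.Theory.
Import numFieldNormedType.Exports.

Local Open Scope classical_set_scope.
Local Open Scope ring_scope.

(** * The complex plane *)

Section ComplexPlane.
Context {R : realType}.
Implicit Types (a b t : R) (z u v : R[i]).

Definition cis t : R[i] := (cos t +i* sin t)%C.

Definition cmod z : R := Num.sqrt (complex.Re z ^+ 2 + complex.Im z ^+ 2).

Lemma complexP z u : complex.Re z = complex.Re u ->
  complex.Im z = complex.Im u -> z = u.
Proof. by case: z u => [a b] [c d] /= -> ->. Qed.

Lemma Re_mul z u : complex.Re (z * u) =
  complex.Re z * complex.Re u - complex.Im z * complex.Im u.
Proof. by case: z u => [a b] [c d]. Qed.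

Lemma Im_mul z u : complex.Im (z * u) =
  complex.Re z * complex.Im u + complex.Im z * complex.Re u.
Proof. by case: z u => [a b] [c d] /=; ring. Qed.

Lemma Re_add z u : complex.Re (z + u) = complex.Re z + complex.Re u.
Proof. by case: z u => [a b] [c d]. Qed.

Lemma Im_add z u : complex.Im (z + u) = complex.Im z + complex.Im u.
Proof. by case: z u => [a b] [c d]. Qed.

Lemma Re_conjc z : complex.Re z^*%C = complex.Re z. Proof. by case: z. Qed.

Lemma Im_conjc z : complex.Im z^*%C = - complex.Im z. Proof. by case: z. Qed.

Lemma cisD a b : cis (a + b) = cis a * cis b.
Proof. by apply: complexP; rewrite ?Re_mul ?Im_mul /= ?cosD ?sinD; ring. Qed.

Lemma cis0 : cis 0 = 1. Proof. by rewrite /cis cos0 sin0. Qed.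

Lemma cisN_mul t : cis (- t) * cis t = 1.
Proof. by rewrite -cisD addNr cis0. Qed.

Lemma cisMn t n : cis (t *+ n) = cis t ^+ n.
Proof.
by elim: n => [|n IH]; rewrite ?mulr0n ?cis0// mulrS cisD IH exprS.
Qed.

Lemma cis_neq0 t : cis t != 0.
Proof.
by apply/eqP => h; move: (cisN_mul t); rewrite h mulr0 => /esym/eqP;
  rewrite oner_eq0.
Qed.

Lemma cis2pi (k : int) : cis (2 * pi * k%:~R) = 1.
Proof.
have E (n : nat) : cis (2 * pi * n%:R) = 1.
  by rewrite mulr_natr cisMn /cis mulr_natl cos2pi sin2pi expr1n.
case: k => n; first exact: E.
by rewrite NegzE mulrNz mulrN -[RHS](cisN_mul (2 * pi * n.+1%:R)) E mulr1.
Qed.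

(** Reducing t to [0, 2 pi[ leaves the injectivity of cos on [0, pi], used at r
    and at 2 pi - r. *)
Lemma cos_eq1 t : cos t = 1 -> exists k : int, t = 2 * pi * k%:~R.
Proof.
move=> ct; pose k := Num.floor (t / (2 * pi)).
have p2 : 0 < 2 * pi :> R by rewrite mulr_gt0// pi_gt0.
have /andP[k1 k2] := floor_itv (t / (2 * pi)).
pose r := t - 2 * pi * k%:~R.
have r0 : 0 <= r by rewrite subr_ge0 mulrC -ler_pdivlMr.
have r2 : r < 2 * pi.
  by move: k2; rewrite ltr_pdivrMr// -/k intrD mulrDl /r; lra.
have cr : cos r = 1.
  have := cis2pi (- k); rewrite mulrNz mulrN => ck.
  have : cis r = cis t by rewrite /r cisD ck mulr1.
  by move=> /(congr1 (@complex.Re R)) /= ->.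
exists k; suff : r = 0 by rewrite /r; lra.
have pi0 := pi_gt0 R.
have [rp|rp] := leP r pi.
  apply: cos_inj; rewrite ?cos0 ?in_itv //=; first by rewrite r0 rp.
  by rewrite lexx ltW.
have : 2 * pi - r = 0.
  apply: cos_inj; rewrite ?in_itv /=; [lra|lra|].
  by rewrite mulr_natl addrC cosD2pi cosN cr cos0.
lra.
Qed.

Lemma cis_inj a b : cis a = cis b -> exists k : int, a = b + 2 * pi * k%:~R.
Proof.
move=> ab; have : cis (a - b) = 1 by rewrite cisD ab mulrC cisN_mul.
move=> /(congr1 (@complex.Re R)) /= /cos_eq1[k E]; exists k; lra.
Qed.

Lemma cmod_sqr z : cmod z ^+ 2 = complex.Re z ^+ 2 + complex.Im z ^+ 2.
Proof. by rewrite sqr_sqrtr// addr_ge0// sqr_ge0. Qed.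

Lemma cmod_gt0 z : (0 < cmod z) = (z != 0).
Proof.
rewrite sqrtr_gt0; case: z => a b /=; rewrite lt_def addr_ge0 ?sqr_ge0// andbT.
by rewrite paddr_eq0 ?sqr_ge0// !sqrf_eq0 eq_complex.
Qed.

Lemma cmod_cis t : cmod (cis t) = 1.
Proof. by rewrite /cmod /= cos2Dsin2 sqrtr1. Qed.

Lemma cmodM z u : cmod (z * u) = cmod z * cmod u.
Proof.
rewrite /cmod -sqrtrM ?addr_ge0 ?sqr_ge0//; congr Num.sqrt.
by rewrite Re_mul Im_mul; ring.
Qed.

Lemma cmod_real a : 0 <= a -> cmod a%:C%C = a.
Proof. by move=> a0; rewrite /cmod /= expr0n addr0 sqrtr_sqr ger0_norm. Qed.

Lemma cmod_conj z : cmod z^*%C = cmod z.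
Proof. by case: z => a b; rewrite /cmod /= sqrrN. Qed.

Lemma mul_conjC z : z * z^*%C = (cmod z ^+ 2)%:C%C.
Proof.
by rewrite cmod_sqr; case: z => a b; apply: complexP; rewrite ?Re_mul ?Im_mul /=; ring.
Qed.

(** The argument of a complex number of the open right half-plane. *)
Definition small_arg z : R := atan (complex.Im z / complex.Re z).

Lemma small_argE z : 0 < complex.Re z ->
  z = (cmod z)%:C%C * cis (small_arg z).
Proof.
case: z => a b /= a0; rewrite /small_arg /=.
set t := atan _; have tt : tan t = b / a by rewrite atanK.
have ct : 0 < cos t.
  by apply: cos_gt0_pihalf; rewrite atan_gtNpi2 atan_ltpi2.
have st : sin t = b / a * cos t by rewrite -tt /tan mulfVK// gt_eqF.
have cs : cmod (a +i* b)%C = a / cos t.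
  have h : (a ^+ 2 + b ^+ 2) * cos t ^+ 2 = a ^+ 2.
    have := cos2Dsin2 t; rewrite st => h; rewrite -[RHS]mulr1 -h.
    by field; rewrite gt_eqF.
  rewrite /cmod /= -[a ^+ 2 + _](mulfK (x := cos t ^+ 2)) ?expf_neq0 ?gt_eqF//.
  by rewrite h -expr_div_n sqrtr_sqr ger0_norm// ltW// divr_gt0.
rewrite cs; apply: complexP; rewrite ?Re_mul ?Im_mul /= ?st; field;
  by rewrite ?gt_eqF.
Qed.

(** The topology of the plane enters through the two coordinates only, so that
    all limits are taken in R. *)
Definition ccont (T : topologicalType) (F : T -> R[i]) :=
  continuous (fun x => complex.Re (F x)) /\
  continuous (fun x => complex.Im (F x)).

Section Continuity.
Context {T : topologicalType}.
Implicit Types F G : T -> R[i].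

Lemma ccont_cst z : ccont (fun _ : T => z).
Proof. by split => x; exact: cvg_cst. Qed.

Lemma ccontD F G : ccont F -> ccont G -> ccont (fun x => F x + G x).
Proof.
move=> [F1 F2] [G1 G2].
split => x.
  by under eq_fun do rewrite Re_add; apply: cvgD; [exact: F1|exact: G1].
by under eq_fun do rewrite Im_add; apply: cvgD; [exact: F2|exact: G2].
Qed.

Lemma ccontM F G : ccont F -> ccont G -> ccont (fun x => F x * G x).
Proof.
move=> [F1 F2] [G1 G2]; split => x.
  under eq_fun do rewrite Re_mul.
  by apply: cvgB; apply: cvgM; [exact: F1|exact: G1|exact: F2|exact: G2].
under eq_fun do rewrite Im_mul.
by apply: cvgD; apply: cvgM; [exact: F1|exact: G2|exact: F2|exact: G1].
Qed.

Lemma ccontX F n : ccont F -> ccont (fun x => F x ^+ n).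
Proof.
move=> cF; elim: n => [|n IH].
  by under [X in ccont X]eq_fun do rewrite expr0; exact: ccont_cst.
by under [X in ccont X]eq_fun do rewrite exprS; exact: ccontM.
Qed.

Lemma ccont_conj F : ccont F -> ccont (fun x => (F x)^*%C).
Proof.
move=> [F1 F2]; split => x.
  by under eq_fun do rewrite Re_conjc; exact: F1.
by under eq_fun do rewrite Im_conjc; apply: cvgN; exact: F2.
Qed.

Lemma ccont_cis (f : T -> R) : continuous f -> ccont (fun x => cis (f x)).
Proof.
move=> cf; split => x /=; apply: (continuous_comp (cf x)).
  exact: continuous_cos.
exact: continuous_sin.
Qed.

Lemma continuous_cmod F : ccont F -> continuous (fun x => cmod (F x)).
Proof.
move=> [F1 F2] x; rewrite /cmod; apply: continuous_comp; last exact: sqrt_continuous.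
by apply: cvgD; under eq_fun do rewrite expr2; apply: cvgM; [exact: F1|exact: F1|exact: F2|exact: F2].
Qed.

Lemma small_arg_continuous_at F x : ccont F -> 0 < complex.Re (F x) ->
  {for x, continuous (fun y => small_arg (F y))}.
Proof.
move=> [F1 F2] Fx; apply: continuous_comp; last exact: continuous_atan.
by apply: cvgM; [exact: F2|apply: cvgV; [rewrite gt_eqF|exact: F1]].
Qed.

End Continuity.

Lemma ccont_comp (S T : topologicalType) (f : S -> T) (F : T -> R[i]) :
  continuous f -> ccont F -> ccont (F \o f).
Proof.
move=> cf [F1 F2]; split => x.
  exact: (continuous_comp (cf x) (F1 (f x))).
exact: (continuous_comp (cf x) (F2 (f x))).
Qed.

End ComplexPlane.

(** * Continuous choice of an angle *)

Section ContinuousAngle.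
Context {R : realType}.

Lemma polar (z : R[i]) : z != 0 -> exists t, z = (cmod z)%:C%C * cis t.
Proof.
move=> z0; have m0 : 0 < cmod z by rewrite cmod_gt0.
have m2 := cmod_sqr z; case: z => a b /= in z0 m0 m2 *.
set m := cmod _ in m0 m2 *.
have cI : -1 <= a / m <= 1.
  rewrite ler_pdivlMr// ler_pdivrMr//; move: (sqr_ge0 b) => b2.
  by apply/andP; split; nra.
have cE : cos (acos (a / m)) = a / m by rewrite acosK.
have sE : sin (acos (a / m)) = `|b| / m.
  rewrite sin_acos//; have -> : 1 - (a / m) ^+ 2 = (b / m) ^+ 2.
    rewrite !expr_div_n; have -> : b ^+ 2 = m ^+ 2 - a ^+ 2 by lra.
    by field; rewrite gt_eqF.
  by rewrite sqrtr_sqr normrM (ger0_norm (x := m^-1))// invr_ge0 ltW.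
have mK x : m * (x / m) = x by rewrite mulrC mulfVK ?gt_eqF.
have [b0|b0] := leP 0 b.
  exists (acos (a / m)); apply: complexP; rewrite ?Re_mul ?Im_mul /= ?cE ?sE.
    by rewrite mul0r subr0 mK.
  by rewrite mul0r addr0 ger0_norm// mK.
exists (- acos (a / m)); apply: complexP; rewrite ?Re_mul ?Im_mul /= ?cosN ?sinN ?cE ?sE.
  by rewrite mul0r subr0 mK.
by rewrite mul0r addr0 ltr0_norm// mulNr opprK mK.
Qed.

(** By the intermediate value theorem, a continuous function cannot jump from
    one multiple of [c] to another. *)
Lemma multiples_const (c a b : R) (d : R -> R) : 0 < c -> a <= b ->
  {within `[a, b], continuous d} ->
  (forall t, a <= t <= b -> exists k : int, d t = c * k%:~R) -> d a = d b.
Proof.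
move=> c0 ab cd dc; apply/eqP/negPn/negP => ne.
have [ka Ea] : exists k : int, d a = c * k%:~R by apply: dc; rewrite lexx.
have [kb Eb] : exists k : int, d b = c * k%:~R by apply: dc; rewrite lexx ab.
pose v := c * (Num.min ka kb)%:~R + c / 2.
have kab : ka != kb by apply: contra ne => /eqP h; rewrite Ea Eb h.
have [t /[!in_itv]/= tI tv] : exists2 t, t \in `[a, b] & d t = v.
  apply: IVT => //; rewrite Ea Eb /v.
  have H (k l : int) : (k < l)%R -> c * k%:~R + c <= c * l%:~R.
    move=> kl; have -> : c * k%:~R + c = c * (k + 1)%:~R by rewrite intrD; ring.
    by rewrite ler_pM2l// ler_int lezD1.
  case: (ltgtP ka kb) kab => // kl _.
    have h := H _ _ kl; rewrite !minElt !maxElt.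
    have -> : c * ka%:~R < c * kb%:~R by lra.
    by apply/andP; split; lra.
  have h := H _ _ kl; rewrite !minElt !maxElt.
  have -> : (c * ka%:~R < c * kb%:~R) = false by apply/negbTE; rewrite -leNgt; lra.
  by apply/andP; split; lra.
have [k Ek] := dc t tI; move: Ek; rewrite tv /v.
set l := Num.min ka kb => E.
have {}E : (2 * k - 2 * l)%:~R = 1 :> R.
  rewrite intrD mulrNz !intrM; apply: (mulfI (x := c)); first by rewrite gt_eqF.
  lra.
have : 2 * k - 2 * l = 1 by apply/eqP; rewrite -(eqr_int R) E.
lia.
Qed.

Section Lift.
Context {V : normedModType R} (F : V -> R[i]).
Hypotheses (cF : ccont F) (F0 : forall x, F x != 0).

Let turn x y := F x * (F y)^*%C.

(* The values of F on the segment from 0 to y stay within a right angle of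
   each other on pieces of length 1 / N.+1. *)
Let fine_enough N (y : V) := forall s t : R, 0 <= s <= 1 -> 0 <= t <= 1 ->
  `|s - t| * N.+1%:R <= 1 -> 0 < complex.Re (turn (s *: y) (t *: y)).

Let node N m (y : V) := (m%:R / N.+1%:R) *: y.

Variable t0 : R.
Hypothesis F0E : F 0 = (cmod (F 0))%:C%C * cis t0.

Let angN N m y :=
  t0 + \sum_(j < m) small_arg (turn (node N j.+1 y) (node N j y)).

Let turn_step x y t : 0 < complex.Re (turn x y) ->
  F y = (cmod (F y))%:C%C * cis t ->
  F x = (cmod (F x))%:C%C * cis (t + small_arg (turn x y)).
Proof.
move=> p Ey; have := small_argE p; rewrite cmodM cmod_conj.
set u := small_arg _ => E.
have my : 0 < cmod (F y) by rewrite cmod_gt0.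
have h : F x * (cmod (F y) ^+ 2)%:C%C =
    (cmod (F x) * cmod (F y))%:C%C * cis u * F y.
  by rewrite -E /turn -mul_conjC; ring.
have m2 : (cmod (F y) ^+ 2)%:C%C != 0 :> R[i].
  by rewrite fmorph_eq0 expf_neq0// gt_eqF.
apply: (mulIf m2); rewrite h {2}Ey cisD rmorphXn rmorphM /=; ring.
Qed.

Let node01 N m : (m <= N.+1)%N -> 0 <= (m%:R / N.+1%:R : R) <= 1.
Proof.
move=> mN; rewrite divr_ge0//= ler_pdivrMr ?ltr0n// mul1r ler_nat//.
Qed.

Let turn_node N m y : fine_enough N y -> (m < N.+1)%N ->
  0 < complex.Re (turn (node N m.+1 y) (node N m y)).
Proof.
move=> fN mN; apply: fN; rewrite ?node01//; first exact: ltnW.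
rewrite -mulrBl -natrB// subSnn ger0_norm; last by rewrite divr_ge0.
by rewrite mulfVK// pnatr_eq0.
Qed.

Let angN_lift N m y : fine_enough N y -> (m <= N.+1)%N ->
  F (node N m y) = (cmod (F (node N m y)))%:C%C * cis (angN N m y).
Proof.
move=> fN; elim: m => [_|m IH mN].
  by rewrite /node /angN big_ord0 addr0 mul0r scale0r.
rewrite /angN big_ord_recr /= addrA; apply: turn_step; last exact: IH (ltnW mN).
exact: turn_node.
Qed.

Let node_end N y : node N N.+1 y = y.
Proof. by rewrite /node divff ?scale1r// pnatr_eq0. Qed.

Let ang_lift N y : fine_enough N y ->
  F y = (cmod (F y))%:C%C * cis (angN N N.+1 y).
Proof. by move=> fN; rewrite -{1 2}(node_end N y); apply: angN_lift. Qed.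

Let angN_cont N m y : fine_enough N y -> (m <= N.+1)%N ->
  angN N m z @[z --> y] --> angN N m y.
Proof.
move=> fN; elim: m => [_|m IH mN].
  by rewrite /angN big_ord0; under eq_fun do rewrite big_ord0; exact: cvg_cst.
rewrite /angN big_ord_recr /= addrA; under eq_fun do rewrite big_ord_recr /= addrA.
apply: cvgD; first exact: IH (ltnW mN).
have cn k : continuous (fun y0 : V => node N k y0).
  by move=> z; apply: cvgZr; exact: cvg_id.
have cT : ccont (fun y0 => turn (node N m.+1 y0) (node N m y0)).
  by apply: ccontM; [|apply: ccont_conj]; exact: ccont_comp.
exact: (small_arg_continuous_at cT (turn_node fN mN)).
Qed.

Let fine_scale N y t : 0 <= t <= 1 -> fine_enough N y ->
  fine_enough N (t *: y).
Proof.
move=> t01 fN s s' s01 s01' h; rewrite !scalerA; apply: fN; try nra.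
rewrite -mulrBl normrM (ger0_norm (x := t)); last by case/andP: t01.
apply: le_trans h; rewrite mulrAC ler_piMr//; last by case/andP: t01.
Qed.

Let ang0 N m : angN N m 0 = t0.
Proof.
rewrite /angN big1 ?addr0// => j _; rewrite /node !scaler0 /turn mul_conjC.
by rewrite /small_arg /= mul0r atan0.
Qed.

Let ang_uniq N M y : fine_enough N y -> fine_enough M y ->
  angN N N.+1 y = angN M M.+1 y.
Proof.
move=> fN fM; pose d (t : R) := angN N N.+1 (t *: y) - angN M M.+1 (t *: y).
have : d 0 = d 1.
  apply: (@multiples_const (2 * pi)) => //.
  - by rewrite mulr_gt0// pi_gt0.
  - apply: continuous_in_subspaceT => t /set_mem /= /[!in_itv]/= t01.
    have cs : {for t, continuous (fun s : R => s *: y)}.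
      by apply: cvgZl; exact: cvg_id.
    apply: cvgB; apply: (continuous_comp cs); apply: angN_cont => //;
      exact: fine_scale.
  - move=> t t01; have m0 : ((cmod (F (t *: y)))%:C%C : R[i]) != 0.
      by rewrite fmorph_eq0 gt_eqF// cmod_gt0.
    have /(mulfI m0)/cis_inj[k E] :=
      etrans (esym (ang_lift (fine_scale t01 fN))) (ang_lift (fine_scale t01 fM)).
    by exists k; rewrite /d E; ring.
rewrite /d scale0r !ang0 subrr scale1r; lra.
Qed.

Let fine_near (x : V) : exists N, \forall y \near x, fine_enough N y.
Proof.
(* The condition at t is open in the pair of y and of the mesh, so that it
   holds for all t at once near x and for a small mesh. *)
pose P (p : V * R) (t : R) := forall s, `|s - t| <= `|p.2| ->
  0 < complex.Re (turn (s *: p.1) (t *: p.1)).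
have /compact_near_coveringP cov := @segment_compact R 0 1.
have cscale (f : R * (R * V) -> R) : continuous f ->
    continuous (fun q => f q *: q.2.2).
  move=> cf q; apply: cvgZ; first exact: cf.
  by apply: cvg_comp; [exact: cvg_snd|exact: cvg_snd].
have cphi : continuous (fun q : R * (R * V) =>
    complex.Re (turn (q.1 *: q.2.2) (q.2.1 *: q.2.2))).
  have [] // : ccont (fun q : R * (R * V) =>
      turn (q.1 *: q.2.2) (q.2.1 *: q.2.2)).
  apply: ccontM; [|apply: ccont_conj]; apply: ccont_comp => //; apply: cscale => q.
    exact: cvg_fst.
  by apply: cvg_comp; [exact: cvg_snd|exact: cvg_fst].
have [|[U e] /= [Ux [e0 /= e0_gt0 eP]] UP] := cov (V * R)%type (nbhs (x, 0 : R)) P _.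
  move=> t t01; have tt : 0 < complex.Re (turn (t *: x) (t *: x)).
    by rewrite /turn mul_conjC /= exprn_gt0// cmod_gt0.
  have := cvgr_gt _ (cphi (t, (t, x))) _ tt.
  move=> [[A B] /= [[a /= a0 aA] [[C D] /= [[c /= c0 cC] Dx] CD]] AB].
  pose r := Num.min (a / 2) c; have r0 : 0 < r by rewrite lt_min c0 divr_gt0.
  exists (ball t r, D `*` ball (0 : R) (a / 2)); first split => /=.
  - exact: nbhsx_ballx.
  - by exists (D, ball (0 : R) (a / 2)) => //=; split => //; apply: nbhsx_ballx; rewrite divr_gt0.
  - move=> [t' [y eps]] /= [tt' [Dy]]; rewrite /ball /= sub0r normrN => eps_a s hs.
    move: tt'; rewrite /ball /= /r lt_min => /andP[ta tc].
    apply: (AB (s, (t', y))) => /=; split => /=.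
      apply: aA; rewrite /ball /= (le_lt_trans (ler_distD t' _ _))//.
      by rewrite (distrC t'); lra.
    by apply: CD; split => //=; apply: cC.
have [N hN] : exists N : nat, N.+1%:R^-1 < e0.
  exists (Num.truncn e0^-1); rewrite invf_plt ?posrE//.
  exact: truncnS_gt.
exists N; near=> y => s t s01 t01 h.
have Pyt : P (y, N.+1%:R^-1) t.
  apply: (UP (y, N.+1%:R^-1)); last by rewrite /= in_itv.
  split => /=; first by near: y.
  by apply: eP; rewrite /= sub0r normrN ger0_norm.
apply: Pyt => /=; rewrite (ger0_norm (x := _^-1))//.
by rewrite -[leRHS]div1r ler_pdivlMr.
Unshelve. all: by end_near.
Qed.

(** The angle at y is the sum of the small turns of F along a fine partition of
    the segment from 0 to y. By compactness of the segment one partition serves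
    all points near y, which gives continuity; two partitions give sums that
    agree at 0 and differ by multiples of 2 pi along the segment, hence agree. *)
Lemma continuous_angle_from : exists theta : V -> R, continuous theta /\
  forall x, F x = (cmod (F x))%:C%C * cis (theta x).
Proof.
pose N x := projT1 (cid (fine_near x)).
have fineN x : \forall y \near x, fine_enough (N x) y by exact: (projT2 (cid (fine_near x))).
exists (fun x => angN (N x) (N x).+1 x); split => x; last first.
  by apply: ang_lift; exact: nbhs_singleton (fineN x).
apply: (cvg_trans (G := angN (N x) (N x).+1 y @[y --> x])); last first.
  exact: angN_cont (nbhs_singleton (fineN x)) _.
apply: near_eq_cvg; near=> y; apply: ang_uniq.
  by near: y; exact: fineN.
exact: nbhs_singleton (fineN y).
Unshelve. all: by end_near.
Qed.
End Lift.

(** In polar coordinates this lifts F to the universal cover of the punctured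
    plane; it is where the simple connectedness of the line and of R^3 enters. *)
Lemma continuous_angle (V : normedModType R) (F : V -> R[i]) :
  ccont F -> (forall x, F x != 0) -> exists theta : V -> R,
  continuous theta /\ forall x, F x = (cmod (F x))%:C%C * cis (theta x).
Proof. by move=> cF F0; have [t0] := polar (F0 0); apply: (continuous_angle_from cF F0). Qed.

Lemma multiples_constV (c : R) (V : normedModType R) (d : V -> R) :
  0 < c -> continuous d -> (forall x, exists k : int, d x = c * k%:~R) ->
  forall x y, d x = d y.
Proof.
move=> c0 cd dc x y; pose l (t : R) := x + t *: (y - x).
have cl : continuous l.
  by move=> t; apply: cvgD; [exact: cvg_cst|apply: cvgZl; exact: cvg_id].
have : d (l 0) = d (l 1).
  apply: (multiples_const (d := d \o l) c0) => //.
  by apply: continuous_subspaceT => t; apply: continuous_comp; [exact: cl|exact: cd].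
  by move=> t _; exact: dc.
by rewrite /l scale0r addr0 scale1r addrC subrK.
Qed.
End ContinuousAngle.

(** * Subspaces, pasting and embeddings *)

Section SubsetTopology.

Lemma set_val_continuous (T : topologicalType) (A : set T) :
  continuous (@set_val T A).
Proof. exact: initial_continuous. Qed.

Lemma continuous_to_subset (S T : topologicalType) (A : set T) (f : S -> A) :
  continuous (fun x => set_val (f x)) -> continuous f.
Proof. by move=> cf; exact: continuous_comp_initial. Qed.

Lemma compact_subset_type (T : topologicalType) (A : set T) :
  compact A -> compact [set: A].
Proof.
move=> cA F PF _; have [x [Ax xF]] : A `&` cluster (set_val @ F) !=set0.
  by apply: cA; apply: nearW => y; exact: ptP.
exists (pt Ax); split => // B C FB [N [[M oM <-] Nx] NC].
have [||y [[y' By' <-] My]] := xF (set_val @` B) M.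
- by apply: (@filterS _ F _ B) => // y By; exists y.
- by apply: open_nbhs_nbhs; split=> //; move: Nx; rewrite /= set_val_pt.
by exists y'; split => //; apply: NC.
Qed.

Lemma hausdorff_subset_type (T : topologicalType) (A : set T) :
  hausdorff_space T -> hausdorff_space A.
Proof.
move=> hT x y xy; apply: set_val_inj; apply: hT => B C Bx Cy.
have [z [Bz Cz]] := xy _ _ (set_val_continuous Bx) (set_val_continuous Cy).
by exists (set_val z).
Qed.

(** An injective continuous map from a compact space to a Hausdorff space is an
    embedding, so that maps into its image factor continuously. *)
Lemma compact_embedding_factor (S T U : topologicalType) (g : S -> T)
    (c : U -> T) : compact [set: S] -> hausdorff_space T -> continuous g ->
  injective g -> continuous c -> (forall u, exists s, g s = c u) ->
  exists c' : U -> S, continuous c' /\ forall u, g (c' u) = c u.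
Proof.
move=> cS hT cg gi cc cs; exists (fun u => projT1 (cid (cs u))).
split=> [|u]; last exact: (projT2 (cid (cs u))).
apply/continuous_closedP => C clC.
have -> : (fun u => projT1 (cid (cs u))) @^-1` C = c @^-1` (g @` C).
  apply/seteqP; split => u /= => [h|[s Cs]].
    by exists (projT1 (cid (cs u))) => //; exact: (projT2 (cid (cs u))).
  move=> E; suff -> : sval (cid (cs u)) = s by [].
  by apply: gi; rewrite E; exact: (projT2 (cid (cs u))).
move: cc => /continuous_closedP; apply; apply: compact_closed => //.
apply: continuous_compact; first exact: continuous_subspaceT.
exact: subclosed_compact clC cS _.
Qed.

Lemma paste_closed (S T : topologicalType) (A B : set S) (f g h : S -> T) :
  closed A -> closed B -> (forall x, A x \/ B x) ->
  continuous f -> continuous g -> (forall x, A x -> h x = f x) ->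
  (forall x, B x -> h x = g x) -> continuous h.
Proof.
move=> cA cB AB cf cg hf hg; apply/continuous_closedP => C clC.
have -> : h @^-1` C = (A `&` f @^-1` C) `|` (B `&` g @^-1` C).
  apply/seteqP; split => x /=.
    by have [a|b] := AB x; [rewrite hf//; left|rewrite hg//; right].
  by case=> -[]; [move=> /hf ->|move=> /hg ->].
by apply: closedU; apply: closedI => //; [move: cf|move: cg] => /continuous_closedP; exact.
Qed.

Lemma continuous_triple (R : realType) (T : topologicalType)
    (V1 V2 V3 : normedModType R) (f : T -> V1) (g : T -> V2) (h : T -> V3) :
  continuous f -> continuous g -> continuous h ->
  continuous (fun t => (f t, g t, h t)).
Proof.
by move=> cf cg ch t; exact: (cvg_pair (cvg_pair (cf t) (cg t)) (ch t)).
Qed.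
End SubsetTopology.

Section RealHelpers.
Context {R : realType}.

Definition clamp (t : R) : R := Num.max 0 (Num.min t 1).

Lemma clamp01 t : 0 <= clamp t <= 1.
Proof. by rewrite /clamp le_max lexx ge_max ler01 ge_min lexx orbT. Qed.

Lemma clamp_id t : 0 <= t <= 1 -> clamp t = t.
Proof. by move=> /andP[t0 t1]; rewrite /clamp min_l// max_r. Qed.

Lemma clampB t : clamp (1 - t) = 1 - clamp t.
Proof.
have lo s : s <= 0 -> clamp s = 0 by move=> s0; rewrite /clamp max_l// ge_min s0.
have hi s : 1 <= s -> clamp s = 1 by move=> s1; rewrite /clamp min_r// max_r.
have [t0|t0] := leP t 0; first by rewrite (lo t)// hi; lra.
have [t1|t1] := leP t 1; first by rewrite !clamp_id//; lra.
by rewrite (hi t) ?lo; lra.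
Qed.

Lemma continuous_clamp : continuous clamp.
Proof.
move=> t; apply: (@continuous_max R R (fun=> 0) (fun s => Num.min s 1)).
  exact: cvg_cst.
by apply: (@continuous_min R R id (fun=> 1)); [exact: cvg_id|exact: cvg_cst].
Qed.

(** The function r |-> r ^+ n.+1 + r ^+ 2 is a continuous bijection of [0, 1] onto
    [0, 2], and hence has a continuous inverse. *)
Lemma continuous_radius (n : nat) : exists r : R -> R, continuous r /\
  forall t, 0 <= r t /\ r t ^+ n.+1 + r t ^+ 2 = clamp t.
Proof.
pose f (x : R) := x ^+ n.+1 + x ^+ 2.
have cf : continuous f.
  by move=> x; apply: cvgD; exact: exprn_continuous.
pose I := `[0 : R, 1]%classic.
have [||||||c [cc cE]] := @compact_embedding_factor I R R (f \o set_val) clamp.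
- by apply: compact_subset_type; exact: segment_compact.
- exact: norm_hausdorff.
- by move=> x; apply: continuous_comp; [exact: set_val_continuous|exact: cf].
- move=> x y /=; have := ptP x; have := ptP y; rewrite /I /= !in_itv /=.
  move=> /andP[y0 _] /andP[x0 _] fxy; apply: set_val_inj.
  have mono (a b : R) : 0 <= a -> a < b -> f a < f b.
    move=> a0 ab; apply: ltr_leD; last by rewrite ler_sqr ?nnegrE; lra.
    by rewrite ltrXn2r ?nnegrE//; lra.
  by case: (ltgtP (set_val x) (set_val y)) => // /mono h;
    have := h ltac:(assumption); rewrite fxy ltxx.
- exact: continuous_clamp.
- move=> t; have [x xI fx] : exists2 x, x \in `[0, 1] & f x = clamp t.
    apply: IVT => //; first exact: continuous_subspaceT.
    have -> : f 0 = 0 by rewrite /f !expr0n addr0.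
    have -> : f 1 = 2 by rewrite /f !expr1n.
    by have := clamp01 t; rewrite min_l ?max_r//; lra.
  by have Ix : I x by []; exists (pt Ix); rewrite /= set_val_pt.
exists (fun t => set_val (c t)); split => [t|t].
  by apply: continuous_comp; [exact: cc|exact: set_val_continuous].
by split; [have := ptP (c t); rewrite /I /= in_itv => /andP[]|exact: cE].
Qed.
End RealHelpers.

(** * Coordinates of quaternions and of Brieskorn manifolds *)

Section Coordinates.
Context {R : realType}.

Lemma mkq_sum (a b c d : R) : mkq a b c d =
  a *: mkq 1 0 0 0 + b *: mkq 0 1 0 0 + c *: mkq 0 0 1 0 + d *: mkq 0 0 0 1.
Proof. by apply: quatP; rewrite !qE; ring. Qed.

Lemma continuous_mkq (T : topologicalType) (a b c d : T -> R) :
  continuous a -> continuous b -> continuous c -> continuous d ->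
  continuous (fun x => mkq (a x) (b x) (c x) (d x) : quat R).
Proof.
move=> ca cb cc cd x; under eq_fun do rewrite mkq_sum; rewrite mkq_sum.
have H (f : T -> R) (v : quat R) : continuous f ->
    (f y *: v) @[y --> x] --> f x *: v.
  by move=> cf; apply: cvgZl; exact: cf.
by apply: cvgD; [apply: cvgD; [apply: cvgD|]|]; exact: H.
Qed.

Lemma continuous_q0 : continuous (@q0 R). Proof. exact: coord_continuous. Qed.
Lemma continuous_q1 : continuous (@q1 R). Proof. exact: coord_continuous. Qed.
Lemma continuous_q2 : continuous (@q2 R). Proof. exact: coord_continuous. Qed.
Lemma continuous_q3 : continuous (@q3 R). Proof. exact: coord_continuous. Qed.

Lemma continuous_sqnormq : continuous (@sqnorm R 1 4 : quat R -> R).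
Proof.
have -> : (@sqnorm R 1 4 : quat R -> R) =
    (fun q => q0 q ^+ 2 + q1 q ^+ 2 + q2 q ^+ 2 + q3 q ^+ 2).
  by apply/funext => p; exact: sqnormq.
move=> q.
have H (f : quat R -> R) : continuous f -> (f p ^+ 2) @[p --> q] --> f q ^+ 2.
  by move=> cf; apply: (@continuous_comp _ _ _ f (fun x => x ^+ 2) q);
    [exact: cf|exact: exprn_continuous].
exact: (cvgD (cvgD (cvgD (H _ continuous_q0) (H _ continuous_q1))
  (H _ continuous_q2)) (H _ continuous_q3)).
Qed.

Lemma compact_S3 : compact [set: @S3 R].
Proof.
apply: compact_subset_type; apply: bounded_closed_compact.
  exists 1; split; first exact: num_real.
  move=> M M1 q /= qS; apply: le_trans (ltW M1).
  rewrite [leLHS]/Num.norm /= mx_normrE; apply/bigmax_leP; split => // -[i j] _ /=.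
  rewrite -(@ler_pXn2r _ 2)// ?nnegrE// expr1n real_normK ?num_real//.
  rewrite -qS /sqnorm big_ord1 (bigD1 j)//= ord1 lerDl sumr_ge0// => k _.
  exact: sqr_ge0.
have -> : @S3 R = (@sqnorm R 1 4 : quat R -> R) @^-1` [set 1] by [].
by move: continuous_sqnormq => /continuous_closedP; apply; exact: closed_eq.
Qed.

Lemma ccont_toC : ccont (@toC R).
Proof. by split => x /=; exact: coord_continuous. Qed.

Definition planar (z : R[i]) : 'rV[R]_2 :=
  \row_(j < 2) if j == 0 then complex.Re z else complex.Im z.

Lemma toC_planar a z : toC (a *: planar z) = a%:C%C * z.
Proof.
by apply: complexP; rewrite /toC /= ?Re_mul ?Im_mul /= !mxE /=; ring.
Qed.

Lemma sqnorm_planar a z : sqnorm (a *: planar z) = a ^+ 2 * cmod z ^+ 2.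
Proof.
rewrite cmod_sqr /sqnorm big_ord1 !big_ord_recr big_ord0 /= !mxE /=; ring.
Qed.

Definition on_first_axis (z : R[i]) : 'M[R]_(3, 2) :=
  \matrix_(i < 3, j < 2)
    if i == 0 then (if j == 0 then complex.Re z else complex.Im z) else 0.

Lemma sqnorm_on_first_axis a z :
  sqnorm (a *: on_first_axis z) = a ^+ 2 * cmod z ^+ 2.
Proof.
rewrite cmod_sqr /sqnorm !big_ord_recr !big_ord0 /=.
by rewrite !mxE /=; ring.
Qed.

Lemma sum_on_first_axis a z :
  \sum_(j < 3) toC (row j (a *: on_first_axis z)) ^+ 2 = (a ^+ 2)%:C%C * z ^+ 2.
Proof.
rewrite !big_ord_recr big_ord0 /= /toC !mxE /=.
by apply: complexP; rewrite ?expr2 !(Re_add, Im_add, Re_mul, Im_mul) /=; ring.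
Qed.

Lemma continuous_scaleP (T : topologicalType) (V : normedModType R)
  (f : T -> R) (v : V) : continuous f -> continuous (fun t => f t *: v).
Proof. by move=> cf t; apply: cvgZl; exact: cf. Qed.

(** For odd n this is the n-th root of unity closest to -1. The half-plane
    Re > 0 tells it apart from 1. *)
Definition far_root (n : nat) : R[i] := - cis (- (pi / n%:R)).

Lemma far_rootX n : odd n -> far_root n ^+ n = 1.
Proof.
move=> on; rewrite /far_root -mulN1r exprMn -signr_odd on -cisMn mulNrn.
rewrite -[_ *+ n]mulr_natr mulfVK; last by rewrite pnatr_eq0; case: n on.
by rewrite expr1 mulN1r; apply: complexP; rewrite /= ?cosN ?sinN ?cospi ?sinpi; ring.
Qed.

Lemma Re_far_root n : (2 < n)%N -> complex.Re (far_root n) < 0.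
Proof.
move=> n2; rewrite /far_root /= cosN oppr_lt0; apply: cos_gt0_pihalf.
have := pi_gt0 R => p0; have n0 : 2 < n%:R :> R by rewrite ltr_nat.
have : pi / n%:R < pi / 2 :> R by rewrite ltr_pM2l// ltf_pV2// posrE; lra.
have : 0 < pi / n%:R :> R by rewrite divr_gt0//; lra.
lra.
Qed.

Lemma cmod_far_root n : cmod (far_root n) = 1.
Proof. by rewrite /far_root -mulN1r cmodM cmod_cis /cmod /= oppr0 expr0n addr0 sqrrN expr1n sqrtr1 mul1r. Qed.

(** For odd n the sectors of the plane on which z ^+ n has positive real part are
    cut out by rays that include the imaginary axis, so Re > 0 selects a union
    of whole sectors. *)
Lemma Re_odd_exp (z : R[i]) n : odd n -> complex.Re z = 0 ->
  complex.Re (z ^+ n) = 0.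
Proof.
move=> on z0; have -> : z = (complex.Im z)%:C%C * 'i%C.
  by apply: complexP; rewrite ?Re_mul ?Im_mul /= ?z0; ring.
have E m : (('i%C : R[i]) ^+ m.*2) = (-1) ^+ m.
  by rewrite -mul2n exprM sqr_i.
rewrite -(odd_double_half n) on add1n exprS exprMn E.
have -> : (-1 : R[i]) ^+ n./2 = ((-1) ^+ n./2)%:C%C.
  by rewrite rmorphXn rmorphN rmorph1.
by rewrite -rmorphXn !(Re_mul, Im_mul) /=; ring.
Qed.
End Coordinates.

(** * The universal cover of the complement of a great circle *)

Section UniversalCover.
Context {R : realType}.
Local Notation E := (R * R * R)%type.

(** The complement in the 3-sphere of the circle q1 = q3 = 0 is the product of an
    open disc, the coordinates q0 and q2, and a circle, the direction of
    (q1, q3). Unrolling that circle and stretching the disc to a plane makes R^3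
    the universal cover of the complement, with the translations of the angle by
    multiples of 2 pi as deck transformations. *)
Definition unroll (e : E) : quat R := mkq e.1.2 (cos e.1.1) e.2 (sin e.1.1).

Lemma sqnorm_unroll e : sqnorm (unroll e) = 1 + e.1.2 ^+ 2 + e.2 ^+ 2.
Proof. by rewrite sqnormq !qE -(cos2Dsin2 e.1.1); ring. Qed.

Lemma sqnorm_unroll_gt0 e : 0 < sqnorm (unroll e).
Proof.
by rewrite sqnorm_unroll; move: (sqr_ge0 e.1.2) (sqr_ge0 e.2); lra.
Qed.

Lemma normalize_S3 (v : quat R) : 0 < sqnorm v ->
  S3 ((Num.sqrt (sqnorm v))^-1 *: v).
Proof.
move=> v0; rewrite /S3 /= sqnormqZ exprVn sqr_sqrtr ?ltW// mulVf//.
by rewrite gt_eqF.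
Qed.

Definition to_sphere (e : E) : @S3 R := pt (normalize_S3 (sqnorm_unroll_gt0 e)).

Definition deck (j : int) (e : E) : E := (e.1.1 + 2 * pi * j%:~R, e.1.2, e.2).

Lemma deckD i j e : deck (i + j) e = deck i (deck j e).
Proof. by rewrite /deck /= intrD; congr (_, _, _); ring. Qed.

Lemma deck0 e : deck 0 e = e.
Proof. by case: e => [[a b] c]; rewrite /deck /= mulr0 addr0. Qed.

Lemma continuous_e1 : continuous (fun e : E => e.1.1).
Proof. by move=> e; apply: cvg_comp; [exact: cvg_fst|exact: cvg_fst]. Qed.
Lemma continuous_e2 : continuous (fun e : E => e.1.2).
Proof. by move=> e; apply: cvg_comp; [exact: cvg_fst|exact: cvg_snd]. Qed.
Lemma continuous_e3 : continuous (fun e : E => e.2).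
Proof. by move=> e; exact: cvg_snd. Qed.

Lemma continuous_deck j : continuous (deck j).
Proof.
apply: continuous_triple; [|exact: continuous_e2|exact: continuous_e3].
by move=> e; apply: cvgD; [exact: continuous_e1|exact: cvg_cst].
Qed.

Lemma continuous_unroll : continuous unroll.
Proof.
apply: continuous_mkq; [exact: continuous_e2| |exact: continuous_e3|].
- move=> e; apply: (@continuous_comp _ _ _ (fun e : E => e.1.1) cos).
    exact: continuous_e1.
  exact: continuous_cos.
- move=> e; apply: (@continuous_comp _ _ _ (fun e : E => e.1.1) sin).
    exact: continuous_e1.
  exact: continuous_sin.
Qed.

Lemma continuous_to_sphere : continuous to_sphere.
Proof.
apply: continuous_to_subset => e.
have E' : (fun x => set_val (to_sphere x)) =
    fun x => (Num.sqrt (sqnorm (unroll x)))^-1 *: unroll x.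
  by apply/funext => x; rewrite set_val_pt.
rewrite E'; apply: cvgZ; last exact: continuous_unroll.
apply: cvgV; first by rewrite gt_eqF// sqrtr_gt0 sqnorm_unroll_gt0.
apply: (@continuous_comp _ _ _ (fun x => sqnorm (unroll x)) Num.sqrt).
  apply: (@continuous_comp _ _ _ unroll (@sqnorm R 1 4)).
    exact: continuous_unroll.
  exact: continuous_sqnormq.
exact: sqrt_continuous.
Qed.

Lemma to_sphere_deck j e : to_sphere (deck j e) = to_sphere e.
Proof.
apply: set_val_inj; rewrite !set_val_pt.
have -> : unroll (deck j e) = unroll e; last by [].
have : cis (e.1.1 + 2 * pi * j%:~R) = cis e.1.1 by rewrite cisD cis2pi mulr1.
by rewrite /unroll /deck /= => -[-> ->].
Qed.

Lemma to_sphere_inj e e' : to_sphere e = to_sphere e' ->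
  exists j, e = deck j e'.
Proof.
move=> /(congr1 set_val); rewrite !set_val_pt => H.
set n := Num.sqrt _ in H; set n' := Num.sqrt (sqnorm (unroll e')) in H.
have n0 : 0 < n by rewrite sqrtr_gt0 sqnorm_unroll_gt0.
have n0' : 0 < n' by rewrite sqrtr_gt0 sqnorm_unroll_gt0.
have h1 := congr1 q1 H; have h3 := congr1 q3 H.
rewrite /unroll !qE in h1 h3.
have nn : n = n'.
  apply: invr_inj; apply/eqP; rewrite -(@eqrXn2 _ 2)// ?invr_ge0 ?ltW//.
  apply/eqP; rewrite -[LHS]mulr1 -[RHS]mulr1.
  rewrite -{1}(cos2Dsin2 e.1.1) -{1}(cos2Dsin2 e'.1.1) !mulrDr -!exprMn.
  by rewrite h1 h3.
have {H} : unroll e = unroll e'.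
  by apply: (scalerI (a := n^-1)); rewrite ?invr_eq0 ?gt_eqF// {2}nn.
move=> H; have k0 := congr1 q0 H; have k1 := congr1 q1 H.
have k2 := congr1 q2 H; have k3 := congr1 q3 H.
rewrite /unroll !qE in k0 k1 k2 k3.
have /cis_inj[j Ej] : cis e.1.1 = cis e'.1.1 by rewrite /cis k1 k3.
exists j; rewrite /deck -Ej -k0 -k2.
by case: (e) => [[]].
Qed.

(** Polar coordinates in the plane of q1 and q3, with a continuous choice of
    the angle. *)
Lemma to_sphere_lift (V : normedModType R) (s : V -> @S3 R) : continuous s ->
  (forall t, ~ (q1 (set_val (s t)) = 0 /\ q3 (set_val (s t)) = 0)) ->
  exists e : V -> E, continuous e /\ forall t, to_sphere (e t) = s t.
Proof.
move=> cs s13.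
have cq (f : quat R -> R) : continuous f -> continuous (fun t => f (set_val (s t))).
  move=> cf t; apply: (@continuous_comp _ _ _ (fun t => set_val (s t)) f).
    apply: (@continuous_comp _ _ _ s set_val); first exact: cs.
    exact: set_val_continuous.
  exact: cf.
pose F t : R[i] := (q1 (set_val (s t)) +i* q3 (set_val (s t)))%C.
have cF : ccont F.
  by split; apply: cq; [exact: continuous_q1|exact: continuous_q3].
have F0 t : F t != 0.
  rewrite eq_complex /= negb_and; apply/negP => /negP; rewrite negb_or !negbK.
  by move=> /andP[/eqP h1 /eqP h3]; apply: (s13 t).
have [th [cth thE]] := continuous_angle cF F0.
pose m t := cmod (F t).
have m0 t : 0 < m t by rewrite cmod_gt0.
have cm : continuous (fun t => (m t)^-1).
  by move=> t; apply: cvgV; [rewrite gt_eqF|exact: continuous_cmod].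
exists (fun t => (th t, q0 (set_val (s t)) / m t, q2 (set_val (s t)) / m t)).
split.
  apply: continuous_triple => // t; apply: cvgM; try exact: cm; apply: cq.
    exact: continuous_q0.
  exact: continuous_q2.
move=> t; apply: set_val_inj; rewrite set_val_pt.
have U : unroll (th t, q0 (set_val (s t)) / m t, q2 (set_val (s t)) / m t) =
    (m t)^-1 *: set_val (s t).
  have := thE t; rewrite -/(m t) => /[dup].
  move=> /(congr1 (@complex.Re R)); rewrite Re_mul /= mul0r subr0 => h1.
  move=> /(congr1 (@complex.Im R)); rewrite Im_mul /= mul0r addr0 => h3.
  have mK x : (m t)^-1 * (m t * x) = x by rewrite mulKf// gt_eqF.
  by apply: quatP; rewrite /unroll !qE /= ?h1 ?h3 ?mK// mulrC.
rewrite U sqnormqZ S3P mulr1 sqrtr_sqr ger0_norm ?invr_ge0 ?ltW//.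
by rewrite scalerA invrK divff ?scale1r// gt_eqF.
Qed.
End UniversalCover.

(** * Arcs and a loop in the complement of the knot *)

Section KnotComplement.
Context {R : realType} (p q : nat).
Hypotheses (p_odd : odd p) (q_odd : odd q) (p_gt2 : (2 < p)%N) (q_gt2 : (2 < q)%N).
Local Notation E := (R * R * R)%type.
Local Notation W := (brieskorn R q p).

Definition first_axis (z : 'M[R]_(3, 2)) : Prop := row 1 z = 0 /\ row 2 z = 0.

(** The Brieskorn equation for z = (z1, 0, 0) says that this is - z1 ^+ 2; so it
    vanishes on the part z = 0 only. *)
Definition curve_poly (x : @C5 R) : R[i] := toC x.1.1 ^+ q + toC x.1.2 ^+ p.

Lemma ccont_curve_poly : ccont curve_poly.
Proof.
apply: ccontD; apply: ccontX; apply: ccont_comp; try exact: ccont_toC.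
  by move=> x; apply: cvg_comp; [exact: cvg_fst|exact: cvg_fst].
by move=> x; apply: cvg_comp; [exact: cvg_fst|exact: cvg_snd].
Qed.

Lemma brieskornE (x : @C5 R) : W x <->
  sqnorm x.1.1 + sqnorm x.1.2 + sqnorm x.2 = 1 /\
  curve_poly x + \sum_(j < 3) toC (row j x.2) ^+ 2 = 0.
Proof. by case: x => [[]]. Qed.

Lemma curve_poly_neq0 (x : W) : first_axis (set_val x).2 ->
  (set_val x).2 != 0 -> curve_poly (set_val x) != 0.
Proof.
have /brieskornE[_] := ptP x; move: (set_val x) => {}x e [r1 r2] xn0.
apply: contra xn0 => /eqP f0; move: e; rewrite f0 add0r.
rewrite !big_ord_recr big_ord0 /= add0r.
have -> : toC (row (widen_ord (leqnSn 2) ord_max) x.2) = 0.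
  have -> : widen_ord (leqnSn 2) ord_max = 1 :> 'I_3 by exact: val_inj.
  by rewrite r1 /toC !mxE.
have -> : toC (row ord_max x.2) = 0.
  have -> : ord_max = 2 :> 'I_3 by exact: val_inj.
  by rewrite r2 /toC !mxE.
rewrite expr0n !addr0 => /eqP; rewrite sqrf_eq0 => /eqP [h0 h1].
apply/eqP/matrixP => i j; rewrite mxE.
have [ei|[ei|ei]] : i = 0 \/ i = 1 \/ i = 2.
- by elim/ord3P: i; [left|right; left|right; right].
- move: h0 h1; rewrite !mxE ei.
  have -> : widen_ord (leqnSn 2) (widen_ord (leqnSn 1) ord_max) = 0 :> 'I_3.
    exact: val_inj.
  move=> h0 h1; have [->|->] : j = 0 \/ j = 1; last by [].
    by case: j => [[|[|//]] ji]; [left|right]; exact: val_inj.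
  by [].
- by have := congr1 (fun v : 'rV[R]_2 => v 0 j) r1; rewrite !mxE ei.
- by have := congr1 (fun v : 'rV[R]_2 => v 0 j) r2; rewrite !mxE ei.
Qed.

Definition vertex_root (n : nat) (i : bool) : R[i] :=
  if i then far_root n else 1.

Lemma vertex_rootX n i : odd n -> vertex_root n i ^+ n = 1.
Proof. by case: i => /= on; [exact: far_rootX|exact: expr1n]. Qed.

Lemma cmod_vertex_root n i : cmod (vertex_root n i) = 1.
Proof. by case: i => /=; [exact: cmod_far_root|rewrite -cis0 cmod_cis]. Qed.

(** The radii of a path of the join of the q-th and the p-th roots of unity, from
    the p-th ones (t = 0) to the q-th ones (t = 1). The sum of the squares of the
    norms of w, z0 and z1 is 1 when |z1| ^+ 2 = a ^+ q + b ^+ p. *)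
Lemma arcs : exists a b : R -> R, [/\ continuous a, continuous b,
  forall t, 0 <= a t /\ 0 <= b t, a 0 = 0 /\ b 1 = 0 &
  forall t, a t ^+ q + b t ^+ p + a t ^+ 2 + b t ^+ 2 = 1].
Proof.
have [a [ca aE]] := @continuous_radius R q.-1.
have [b [cb bE]] := @continuous_radius R p.-1.
have q1 : q.-1.+1 = q by rewrite prednK//; case: q q_odd.
have p1 : p.-1.+1 = p by rewrite prednK//; case: p p_odd.
have z n (r : R) : 0 <= r -> r ^+ n + r ^+ 2 = 0 -> r = 0.
  move=> r0 /eqP; rewrite paddr_eq0 ?exprn_ge0// => /andP[_].
  by rewrite sqrf_eq0 => /eqP.
exists a, (fun t => b (1 - t)); split => //.
- have c1 : continuous (fun t : R => 1 - t).
    by move=> t; apply: cvgB; [exact: cvg_cst|exact: cvg_id].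
  by move=> t; exact: (continuous_comp (c1 t) (cb (1 - t))).
- by move=> t; split; [exact: (aE t).1|exact: (bE _).1].
- split.
    by apply: (z q.-1.+1 _ (aE 0).1); rewrite (aE 0).2 clamp_id// lexx ler01.
  rewrite subrr.
  by apply: (z p.-1.+1 _ (bE 0).1); rewrite (bE 0).2 clamp_id// lexx ler01.
- move=> t; have := (aE t).2; have := (bE (1 - t)).2; rewrite clampB q1 p1.
  lra.
Qed.

Section Arcs.
Variables (a b : R -> R).
Hypotheses (ca : continuous a) (cb : continuous b).
Hypothesis ab_ge0 : forall t, 0 <= a t /\ 0 <= b t.
Hypothesis ab_end : a 0 = 0 /\ b 1 = 0.
Hypothesis abE : forall t, a t ^+ q + b t ^+ p + a t ^+ 2 + b t ^+ 2 = 1.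

Let height2_ge0 t : 0 <= a t ^+ q + b t ^+ p.
Proof. by have [a0 b0] := ab_ge0 t; rewrite addr_ge0// exprn_ge0. Qed.

Let height2_gt0 t : 0 < a t ^+ q + b t ^+ p.
Proof.
have [a0 b0] := ab_ge0 t; rewrite lt_def height2_ge0 andbT; apply/eqP => h.
have := abE t; rewrite h add0r.
move/eqP: h; rewrite paddr_eq0 ?exprn_ge0// !expf_eq0 => /andP[/andP[_ /eqP ->]].
by move=> /andP[_ /eqP ->]; rewrite expr0n addr0 => /eqP; rewrite eq_sym oner_eq0.
Qed.

(** The arc from the p-th root of index i to the q-th root of index j. On it
    w ^+ q + z0 ^+ p is positive, so that z1 can be taken on the imaginary axis. *)
Definition arc_fun (i j : bool) (t : R) : @C5 R :=
  (a t *: planar (vertex_root q j), b t *: planar (vertex_root p i),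
   Num.sqrt (a t ^+ q + b t ^+ p) *: on_first_axis 'i%C).

Lemma curve_poly_arc i j t :
  curve_poly (arc_fun i j t) = (a t ^+ q + b t ^+ p)%:C%C.
Proof.
rewrite /curve_poly /= !toC_planar !exprMn !vertex_rootX// !mulr1.
by rewrite -!rmorphXn -rmorphD.
Qed.

Lemma arc_in i j t : W (arc_fun i j t).
Proof.
apply/brieskornE; rewrite curve_poly_arc /= !sqnorm_planar sqnorm_on_first_axis.
rewrite sum_on_first_axis !cmod_vertex_root.
have ci : cmod ('i%C : R[i]) = 1.
  by rewrite /cmod /= expr0n add0r expr1n sqrtr1.
rewrite ci !expr1n sqr_sqrtr//; split.
  by have := abE t; lra.
by rewrite sqr_i mulrN1 subrr.
Qed.

Definition join_arc i j t : W := pt (arc_in i j t).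

Lemma continuous_arc i j : continuous (join_arc i j).
Proof.
apply: continuous_to_subset.
have -> : (fun t => set_val (join_arc i j t)) = arc_fun i j.
  by apply/funext => t; rewrite set_val_pt.
have cX (f : R -> R) n : continuous f -> continuous (fun t => f t ^+ n).
  move=> cf t; apply: (@continuous_comp _ _ _ f (fun x => x ^+ n)).
    exact: cf.
  exact: exprn_continuous.
have ch : continuous (fun t => Num.sqrt (a t ^+ q + b t ^+ p)).
  move=> t; apply: (@continuous_comp _ _ _ (fun t => a t ^+ q + b t ^+ p)).
    by apply: cvgD; apply: cX.
  exact: sqrt_continuous.
by apply: continuous_triple; exact: continuous_scaleP.
Qed.

Lemma first_axis_scale (c : R) z : first_axis (c *: on_first_axis z).
Proof. by split; apply/rowP => j; rewrite !mxE /= mulr0. Qed.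

Lemma arc_axis i j t : first_axis (set_val (join_arc i j t)).2.
Proof. by rewrite set_val_pt; exact: first_axis_scale. Qed.

Lemma arc_neq0 i j t : (set_val (join_arc i j t)).2 != 0.
Proof.
rewrite set_val_pt /= scaler_eq0 negb_or sqrtr_eq0 -ltNge height2_gt0 /=.
apply/eqP => /matrixP /(_ 0 1); rewrite !mxE /= => /eqP; rewrite oner_eq0//.
Qed.

Lemma arc_at0 i j j' : join_arc i j 0 = join_arc i j' 0.
Proof.
by apply: set_val_inj; rewrite !set_val_pt /arc_fun ab_end.1 !scale0r.
Qed.

Lemma arc_at1 i i' j : join_arc i j 1 = join_arc i' j 1.
Proof.
by apply: set_val_inj; rewrite !set_val_pt /arc_fun ab_end.2 !scale0r.
Qed.

(** An orbit of the weighted circle action that multiplies w, z0 and z1 by the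
    powers 2 p, 2 q and p q of a unit number; w = 0 on this one, and the angle
    is scaled so that the loop closes at 2 pi. *)
Definition orbit_fun (t : R) : @C5 R :=
  (0, b 0 *: planar (cis (2 * t)),
   Num.sqrt (b 0 ^+ p) *: on_first_axis ('i%C * cis (p%:R * t))).

Lemma curve_poly_orbit t :
  curve_poly (orbit_fun t) = (b 0 ^+ p)%:C%C * cis (2 * (p%:R * t)).
Proof.
rewrite /curve_poly /= toC_planar exprMn.
have -> : toC (0 : 'rV[R]_2) = 0 by rewrite /toC !mxE.
rewrite expr0n; have -> : (q == 0)%N = false by apply/negbTE; case: q q_odd.
rewrite add0r -rmorphXn -cisMn; congr (_ * cis _).
by rewrite -mulr_natr; ring.
Qed.

Lemma orbit_in t : W (orbit_fun t).
Proof.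
have [_ b0] := ab_ge0 0; have b0p : 0 <= b 0 ^+ p by rewrite exprn_ge0.
apply/brieskornE; rewrite curve_poly_orbit /= sqnorm_planar sqnorm_on_first_axis.
have ci : cmod ('i%C : R[i]) = 1.
  by rewrite /cmod /= expr0n add0r expr1n sqrtr1.
rewrite sum_on_first_axis cmodM !cmod_cis ci mulr1 !expr1n sqr_sqrtr//; split.
  have -> : sqnorm (0 : 'rV[R]_2) = 0.
    by rewrite /sqnorm big1// => i _; rewrite big1// => j _; rewrite mxE expr0n.
  have := abE 0; rewrite ab_end.1 !expr0n.
  have -> : (q == 0)%N = false by apply/negbTE; case: q q_odd.
  by rewrite /=; lra.
rewrite exprMn sqr_i -cisMn.
have -> : (p%:R * t) *+ 2 = 2 * (p%:R * t) by rewrite [RHS]mulr_natl.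
by ring.
Qed.

Definition orbit_loop t : W := pt (orbit_in t).

Lemma continuous_orbit_loop : continuous orbit_loop.
Proof.
apply: continuous_to_subset.
have -> : (fun t => set_val (orbit_loop t)) = orbit_fun.
  by apply/funext => t; rewrite set_val_pt.
have E1 (r : R) z : r *: planar z =
    (r * complex.Re z) *: planar 1 + (r * complex.Im z) *: planar 'i%C.
  by apply/rowP => j; rewrite !mxE /=; case: ifP => _; ring.
have E2 (r : R) z : r *: on_first_axis z = (r * complex.Re z) *: on_first_axis 1 +
    (r * complex.Im z) *: on_first_axis 'i%C.
  apply/matrixP => i j; rewrite !mxE /=.
  by case: ifP => _; [case: ifP => _|]; ring.
have H (V : normedModType R) (u v : V) (r : R) (z : R -> R[i]) : ccont z ->
  continuous (fun t => (r * complex.Re (z t)) *: u + (r * complex.Im (z t)) *: v).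
  by move=> [c1 c2] t; apply: cvgD; apply: cvgZl; apply: cvgM;
    [exact: cvg_cst|exact: c1|exact: cvg_cst|exact: c2].
have cl (c : R) : continuous (fun t : R => c * t).
  by move=> t; apply: cvgM; [exact: cvg_cst|exact: cvg_id].
rewrite /orbit_fun; under eq_fun do rewrite E1 E2.
apply: continuous_triple; first by move=> t; exact: cvg_cst.
  by apply: H; apply: ccont_cis; exact: cl.
apply: H; apply: ccontM; first exact: ccont_cst.
by apply: ccont_cis; exact: cl.
Qed.

Let b0p_gt0 : 0 < b 0 ^+ p.
Proof.
have := height2_gt0 0; rewrite ab_end.1 expr0n.
have -> : (q == 0)%N = false by apply/negbTE; case: q q_odd.
by rewrite add0r.
Qed.

Lemma orbit_axis t : first_axis (set_val (orbit_loop t)).2.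
Proof. by rewrite set_val_pt; exact: first_axis_scale. Qed.

Lemma orbit_neq0 t : (set_val (orbit_loop t)).2 != 0.
Proof.
apply: contraNneq (lt0r_neq0 b0p_gt0) => h.
have /brieskornE[_] := ptP (orbit_loop t).
rewrite h big1 ?addr0; last first.
  by move=> j _; rewrite /toC !mxE expr0n.
rewrite set_val_pt curve_poly_orbit => /eqP.
by rewrite mulf_eq0 (negbTE (cis_neq0 _)) orbF fmorph_eq0.
Qed.

Lemma orbit_closed : orbit_loop (2 * pi) = orbit_loop 0.
Proof.
apply: set_val_inj; rewrite !set_val_pt /orbit_fun !mulr0.
have -> : cis (2 * (2 * pi)) = cis 0 :> R[i].
  by rewrite cis0 -[RHS](cis2pi 2); congr cis; rewrite mulrC.
have -> : cis (p%:R * (2 * pi)) = cis 0 :> R[i].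
  by rewrite cis0 -[RHS](cis2pi p%:Z); congr cis; rewrite mulrC.
by [].
Qed.
End Arcs.
End KnotComplement.

(** * The complement of the knot is not that of a great circle *)

Section NoSphere.
Context {R : realType} (p q : nat).
Hypotheses (p_odd : odd p) (q_odd : odd q) (p_gt2 : (2 < p)%N) (q_gt2 : (2 < q)%N).
Local Notation E := (R * R * R)%type.
Local Notation W := (brieskorn R q p).

Variable g : @S3 R -> W.
Hypotheses (g_cont : continuous g) (g_inj : injective g).
Hypothesis g_image : forall x : W,
  first_axis (set_val x).2 <-> exists s, g s = x.
Hypothesis g_knot : forall s : @S3 R,
  (set_val (g s)).2 = 0 <-> q1 (set_val s) = 0 /\ q3 (set_val s) = 0.

Let pr (e : E) : W := g (to_sphere e).

Let continuous_pr : continuous pr.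
Proof.
move=> e; apply: (@continuous_comp _ _ _ to_sphere g); last exact: g_cont.
exact: continuous_to_sphere.
Qed.

Let pr_deck j e : pr (deck j e) = pr e.
Proof. by rewrite /pr to_sphere_deck. Qed.

Let pr_inj e e' : pr e = pr e' -> exists j, e = deck j e'.
Proof. by move=> /g_inj /to_sphere_inj. Qed.

Let pr_axis e : first_axis (set_val (pr e)).2.
Proof. by apply/g_image; exists (to_sphere e). Qed.

Let pr_neq0 e : (set_val (pr e)).2 != 0.
Proof.
apply/eqP => /g_knot; rewrite !set_val_pt /unroll !qE => -[h1 h3].
have n0 : Num.sqrt (sqnorm (unroll e)) != 0.
  by rewrite gt_eqF// sqrtr_gt0 sqnorm_unroll_gt0.
move/eqP: h1; rewrite mulf_eq0 invr_eq0 (negbTE n0) /= => /eqP c0.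
move/eqP: h3; rewrite mulf_eq0 invr_eq0 (negbTE n0) /= => /eqP s0.
by have := cos2Dsin2 e.1.1; rewrite c0 s0 expr0n addr0 => /eqP;
  rewrite eq_sym oner_eq0.
Qed.

Let pr_lift (V : normedModType R) (c : V -> W) : continuous c ->
  (forall t, first_axis (set_val (c t)).2) ->
  (forall t, (set_val (c t)).2 != 0) ->
  exists e : V -> E, continuous e /\ forall t, pr (e t) = c t.
Proof.
move=> cc ax c0.
have [||||||s [cs sE]] := @compact_embedding_factor (@S3 R) W V g c.
- exact: compact_S3.
- by apply: hausdorff_subset_type; exact: norm_hausdorff.
- exact: g_cont.
- exact: g_inj.
- exact: cc.
- by move=> t; exact: (g_image (c t)).1.
have [|e [ce eE]] := to_sphere_lift cs.
  by move=> t /g_knot; rewrite sE => /eqP; rewrite (negbTE (c0 t)).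
by exists e; split => // t; rewrite /pr eE.
Qed.

Let pr_lift_from (c : R -> W) t0 e0 : continuous c ->
  (forall t, first_axis (set_val (c t)).2) ->
  (forall t, (set_val (c t)).2 != 0) -> pr e0 = c t0 ->
  exists e : R -> E, [/\ continuous e, e t0 = e0 & forall t, pr (e t) = c t].
Proof.
move=> cc ax c0 E0; have [e [ce eE]] := pr_lift cc ax c0.
have [j ->] : exists j, e0 = deck j (e t0) by apply: pr_inj; rewrite eE.
exists (fun t => deck j (e t)); split => // [t|t]; last by rewrite pr_deck.
by apply: (@continuous_comp _ _ _ e (deck j)); [exact: ce|exact: continuous_deck].
Qed.

Let f (e : E) := curve_poly p q (set_val (pr e)).

Let ccont_f : ccont f.
Proof.
apply: (@ccont_comp R E C5 (fun e => set_val (pr e)) (curve_poly p q)).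
  move=> e; apply: (@continuous_comp _ _ _ pr set_val).
    exact: continuous_pr.
  exact: set_val_continuous.
exact: ccont_curve_poly.
Qed.

Let f_neq0 e : f e != 0.
Proof. exact: curve_poly_neq0 (pr_axis e) (pr_neq0 e). Qed.

Section Angle.
Variable lam : E -> R.
Hypothesis lam_cont : continuous lam.
Hypothesis lamE : forall e, f e = (cmod (f e))%:C%C * cis (lam e).

Let pi2_gt0 : 0 < 2 * pi :> R. Proof. by rewrite mulr_gt0// pi_gt0. Qed.

Let cis_lam e r t : 0 < r -> f e = r%:C%C * cis t -> cis (lam e) = cis t.
Proof.
move=> r0 h; have m : cmod (f e) = r.
  by rewrite h cmodM cmod_cis mulr1 cmod_real// ltW.
have r0' : (r%:C%C : R[i]) != 0 by rewrite fmorph_eq0 gt_eqF.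
by apply: (mulfI r0'); rewrite -{1}m -lamE.
Qed.

(* The increment of the angle under one deck transformation is a continuous
   function with values in the multiples of 2 pi. *)
Let lam_deck : exists k : int, forall j e,
  lam (deck j e) = lam e + 2 * pi * (k * j)%:~R.
Proof.
pose d e := lam (deck 1 e) - lam e.
have cd : continuous d.
  move=> e; apply: cvgB; last exact: lam_cont.
  apply: (@continuous_comp _ _ _ (deck 1) lam); last exact: lam_cont.
  exact: continuous_deck.
have dE e : exists k : int, d e = 2 * pi * k%:~R.
  have [|k Ek] := @cis_inj R (lam (deck 1 e)) (lam e).
    apply: (@cis_lam _ (cmod (f e))); first by rewrite cmod_gt0.
    by rewrite -lamE /f pr_deck.
  by exists k; rewrite /d Ek; lra.
have [k Ek] := dE (0, 0, 0); exists k.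
have d1 e : lam (deck 1 e) = lam e + 2 * pi * k%:~R.
  by rewrite -Ek (multiples_constV pi2_gt0 cd dE _ e) /d; lra.
have dN n e : lam (deck n%:Z e) = lam e + 2 * pi * (k * n%:Z)%:~R.
  elim: n => [|n IH]; first by rewrite deck0 mulr0 mulr0 addr0.
  by rewrite intS deckD d1 IH !intrM intrD; ring.
case=> n e; first exact: dN.
have := dN n.+1 (deck (- n.+1%:Z) e); rewrite -deckD subrr deck0 NegzE => ->.
by rewrite mulrN mulrNz; ring.
Qed.

Section Contradiction.
Variables (a b : R -> R).
Hypotheses (ca : continuous a) (cb : continuous b).
Hypothesis ab_ge0 : forall t, 0 <= a t /\ 0 <= b t.
Hypothesis ab_end : a 0 = 0 /\ b 1 = 0.
Hypothesis abE : forall t, a t ^+ q + b t ^+ p + a t ^+ 2 + b t ^+ 2 = 1.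

Let edge := join_arc p_odd q_odd ab_ge0 abE.
Let circle := orbit_loop q_odd ab_ge0 ab_end abE.

(* The angle of f turns 2 p times along the circle, which lifts to a path between
   two points of one fibre of the cover. *)
Let lam_deck_neq0 (k : int) : (forall j e,
  lam (deck j e) = lam e + 2 * pi * (k * j)%:~R) -> k != 0.
Proof.
move=> H; have co : continuous circle by exact: continuous_orbit_loop.
have oa t : first_axis (set_val (circle t)).2 by exact: orbit_axis.
have on t : (set_val (circle t)).2 != 0 by exact: orbit_neq0.
have [e [ce eE]] := pr_lift co oa on.
have bp : 0 < b 0 ^+ p.
  have [_ b0] := ab_ge0 0; rewrite lt_def exprn_ge0// andbT; apply/eqP => h.
  have := f_neq0 (e 0); rewrite /f eE set_val_pt curve_poly_orbit// h mul0r.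
  by rewrite eqxx.
pose d t := lam (e t) - 2 * (p%:R * t).
have cd : continuous d.
  move=> t; apply: cvgB.
    apply: (@continuous_comp _ _ _ e lam); first exact: ce.
    exact: lam_cont.
  by do 2 (apply: cvgM; first exact: cvg_cst); exact: cvg_id.
have dE t : exists m : int, d t = 2 * pi * m%:~R.
  have [|m Em] := @cis_inj R (lam (e t)) (2 * (p%:R * t)).
    by apply: (cis_lam bp); rewrite /f eE set_val_pt curve_poly_orbit.
  by exists m; rewrite /d Em; lra.
have := multiples_constV pi2_gt0 cd dE (2 * pi) 0; rewrite /d.
have [j Ej] : exists j, e (2 * pi) = deck j (e 0).
  by apply: pr_inj; rewrite !eE; exact: orbit_closed.
rewrite Ej H; apply: contra_eq_neq => ->; rewrite mul0r mulr0 addr0.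
apply/eqP => h; have : 2 * pi * (2 * p%:R) = 0 :> R by lra.
move/eqP; rewrite mulf_eq0 (gt_eqF pi2_gt0) /= mulf_eq0 !pnatr_eq0 /=.
by case: p p_odd.
Qed.

Let lift_arc i j t0 e0 : pr e0 = edge i j t0 -> lam e0 = 0 ->
  exists e : R -> E, [/\ continuous e, e t0 = e0,
    forall t, pr (e t) = edge i j t & forall t, lam (e t) = 0].
Proof.
move=> E0 l0; have cc : continuous (edge i j) by exact: continuous_arc.
have oa t : first_axis (set_val (edge i j t)).2 by exact: arc_axis.
have on t : (set_val (edge i j t)).2 != 0 by exact: arc_neq0.
have [e [ce ee0 eE]] := pr_lift_from cc oa on E0.
exists e; split => // t; rewrite -l0 -ee0.
apply: (multiples_constV pi2_gt0 (d := fun t => lam (e t))).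
  move=> s; apply: (@continuous_comp _ _ _ e lam); first exact: ce.
  exact: lam_cont.
move=> s; have [|k ->] := @cis_inj R (lam (e s)) 0; last first.
  by exists k; rewrite add0r.
apply: (@cis_lam _ (cmod (f (e s)))); first by rewrite cmod_gt0.
rewrite cis0 mulr1 /f eE set_val_pt curve_poly_arc// cmod_real//.
by have [a0 b0] := ab_ge0 s; rewrite addr_ge0// exprn_ge0.
Qed.

(* Undoing the rotation of f by lam carries every point of the cover to the
   curve on which w ^+ q + z0 ^+ p is positive, see [fibre]; [part] is the share
   of w ^+ q in the real part of this sum. *)
Let fz e := toC (set_val (pr e)).1.2 * cis (- (lam e / p%:R)).
Let fw e := toC (set_val (pr e)).1.1 * cis (- (lam e / q%:R)).
Let part e := complex.Re (fw e ^+ q) / cmod (f e).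

Let ccont_fz : ccont fz.
Proof.
apply: ccontM; last first.
  apply: ccont_cis => e; apply: cvgN; apply: cvgM; last exact: cvg_cst.
  exact: lam_cont.
apply: ccont_comp; last exact: ccont_toC.
move=> e; apply: (@continuous_comp _ _ _ (fun e => set_val (pr e)) (fun x => x.1.2)).
  apply: (@continuous_comp _ _ _ pr set_val); first exact: continuous_pr.
  exact: set_val_continuous.
by apply: cvg_comp; [exact: cvg_fst|exact: cvg_snd].
Qed.

Let ccont_fw : ccont fw.
Proof.
apply: ccontM; last first.
  apply: ccont_cis => e; apply: cvgN; apply: cvgM; last exact: cvg_cst.
  exact: lam_cont.
apply: ccont_comp; last exact: ccont_toC.
move=> e; apply: (@continuous_comp _ _ _ (fun e => set_val (pr e)) (fun x => x.1.1)).
  apply: (@continuous_comp _ _ _ pr set_val); first exact: continuous_pr.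
  exact: set_val_continuous.
by apply: cvg_comp; [exact: cvg_fst|exact: cvg_fst].
Qed.

Let fibre e : fw e ^+ q + fz e ^+ p = (cmod (f e))%:C%C.
Proof.
have rot n : odd n -> cis (- (lam e / n%:R)) ^+ n = cis (- lam e).
  move=> on; rewrite -cisMn mulNrn -[_ *+ n]mulr_natr mulfVK//.
  by rewrite pnatr_eq0; case: n on.
rewrite /fw /fz !exprMn !rot// -mulrDl -/(curve_poly p q _) -/(f e).
by rewrite {1}lamE -mulrA -cisD subrr cis0 mulr1.
Qed.

Let continuous_part : continuous part.
Proof.
move=> e; apply: cvgM; first exact: (ccontX q ccont_fw).1.
by apply: cvgV; [rewrite gt_eqF// cmod_gt0|exact: continuous_cmod].
Qed.

Let part_z e : complex.Re (fz e ^+ p) / cmod (f e) = 1 - part e.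
Proof.
have f0 : cmod (f e) != 0 by rewrite gt_eqF// cmod_gt0.
have := congr1 (@complex.Re R) (fibre e); rewrite Re_add /= => h.
by apply: (mulIf f0); rewrite mulfVK// mulrBl mul1r /part mulfVK//; lra.
Qed.

(* Where 0 < part < 1, both powers have positive real part, so fz and fw each lie
   in one of finitely many sectors. The arc between the real vertices crosses the
   strip where the sectors have Re > 0. The map [wrap] to the unit circle winds
   once around across this strip and is 1 elsewhere; it is continuous because part
   is 0 or 1 on the boundary of the strip. *)
Let closed_strip e := [/\ 0 <= part e <= 1, 0 <= complex.Re (fz e) &
  0 <= complex.Re (fw e)].
Let open_strip e := [/\ 0 < part e < 1, 0 < complex.Re (fz e) &
  0 < complex.Re (fw e)].
Let wrap e : R[i] :=
  if `[< closed_strip e >] then cis (2 * pi * part e) else 1.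

Let wrap_out e : ~ open_strip e -> wrap e = 1.
Proof.
move=> out; rewrite /wrap; case: asboolP => // -[/andP[x0 x1] z0 w0].
have [E0|E1] : part e = 0 \/ part e = 1; last 2 first.
- by rewrite E0 mulr0 cis0.
- by rewrite E1 mulr1 -[RHS](cis2pi 1) mulr1.
have [|x0'] := eqVneq (part e) 0; first by left.
have [|x1'] := eqVneq (part e) 1; first by right.
have xI : 0 < part e < 1 by rewrite !lt_def x0' x0 eq_sym x1' x1.
have [zr|zr] := eqVneq (complex.Re (fz e)) 0.
  have := part_z e; rewrite (Re_odd_exp p_odd zr) mul0r => h.
  by right; lra.
have [wr|wr] := eqVneq (complex.Re (fw e)) 0.
  by left; rewrite /part (Re_odd_exp q_odd wr) mul0r.
by exfalso; apply: out; split => //; rewrite lt_def ?zr ?wr.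
Qed.

Let wrap_in e : closed_strip e -> wrap e = cis (2 * pi * part e).
Proof. by rewrite /wrap; case: asboolP. Qed.

Let closed_ge0 (h : E -> R) : continuous h -> closed [set e | 0 <= h e].
Proof.
move=> /continuous_closedP ch.
have -> : [set e | 0 <= h e] = h @^-1` [set x | 0 <= x] by [].
by apply: ch; exact: closed_ge.
Qed.

Let ccont_wrap : ccont wrap.
Proof.
have [zc1 zc2] := ccont_fz; have [wc1 wc2] := ccont_fw.
have c1x : continuous (fun e => 1 - part e).
  by move=> e; apply: cvgB; [exact: cvg_cst|exact: continuous_part].
have clA : closed closed_strip.
  have -> : closed_strip = [set e | 0 <= part e] `&` [set e | 0 <= 1 - part e] `&`
      ([set e | 0 <= complex.Re (fz e)] `&` [set e | 0 <= complex.Re (fw e)]).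
    apply/seteqP; split => e /=.
      by case=> /andP[? ?] ? ?; rewrite subr_ge0.
    by rewrite subr_ge0 => -[[? ?] [? ?]]; split=> //; apply/andP.
  by apply: closedI; apply: closedI; exact: closed_ge0.
have clB : closed (~` [set e | open_strip e]).
  have -> : ~` [set e | open_strip e] =
      [set e | 0 <= - part e] `|` [set e | 0 <= part e - 1] `|`
      ([set e | 0 <= - complex.Re (fz e)] `|` [set e | 0 <= - complex.Re (fw e)]).
    apply/seteqP; split => e /=; rewrite !oppr_ge0 subr_ge0.
      move=> out.
      have [?|x0] := leP (part e) 0; first by left; left.
      have [?|x1] := leP 1 (part e); first by left; right.
      have [?|z0] := leP (complex.Re (fz e)) 0; first by right; left.
      have [?|w0] := leP (complex.Re (fw e)) 0; first by right; right.
      by exfalso; apply: out; split => //; apply/andP.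
    move=> h [/andP[x0 x1] z0 w0]; move: h.
    by rewrite !leNgt x0 x1 z0 w0 => -[[]|[]].
  have cN (h : E -> R) : continuous h -> continuous (fun e => - h e).
    by move=> ch e; apply: cvgN; exact: ch.
  apply: closedU; apply: closedU; apply: closed_ge0.
  - exact: (cN _ continuous_part).
  - by move=> e; apply: cvgB; [exact: continuous_part|exact: cvg_cst].
  - exact: (cN _ zc1).
  - exact: (cN _ wc1).
have AB e : closed_strip e \/ (~` [set e | open_strip e]) e.
  have [|h] := pselect (open_strip e); last by right.
  case=> /andP[x0 x1] z0 w0; left.
  by split; rewrite ?ltW.
have cx : continuous (fun e => 2 * pi * part e).
  by move=> e; apply: cvgM; [exact: cvg_cst|exact: continuous_part].
have [cc cs] := ccont_cis cx; have [oc os] := @ccont_cst R E 1.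
split.
  by apply: (paste_closed clA clB AB cc oc) => e h;
    [rewrite wrap_in|rewrite wrap_out].
by apply: (paste_closed clA clB AB cs os) => e h;
  [rewrite wrap_in|rewrite wrap_out].
Qed.

Section Wrapped.
Variable tau : E -> R.
Hypothesis tau_cont : continuous tau.
Hypothesis tauE : forall e, wrap e = cis (tau e).

Let arc_coords i j e t : pr e = edge i j t -> lam e = 0 ->
  [/\ fz e = (b t)%:C%C * vertex_root p i, fw e = (a t)%:C%C * vertex_root q j &
      part e = a t ^+ q / (a t ^+ q + b t ^+ p)].
Proof.
move=> E1 l0; have ez : fz e = (b t)%:C%C * vertex_root p i.
  by rewrite /fz l0 mul0r oppr0 cis0 mulr1 E1 set_val_pt /= toC_planar.
have ew : fw e = (a t)%:C%C * vertex_root q j.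
  by rewrite /fw l0 mul0r oppr0 cis0 mulr1 E1 set_val_pt /= toC_planar.
split=> //; rewrite /part ew exprMn vertex_rootX// mulr1 -rmorphXn /=.
rewrite /f E1 set_val_pt curve_poly_arc// cmod_real//.
by have [a0 b0] := ab_ge0 t; rewrite addr_ge0// exprn_ge0.
Qed.

Let tau_path (e : R -> E) : continuous e -> continuous (fun t => tau (e t)).
Proof.
move=> ce t; apply: (@continuous_comp _ _ _ e tau); first exact: ce.
exact: tau_cont.
Qed.

Let cross_other i j (e : R -> E) : i || j -> continuous e ->
  (forall t, pr (e t) = edge i j t) -> (forall t, lam (e t) = 0) ->
  tau (e 0) = tau (e 1).
Proof.
move=> ij ce eE l0.
apply: (multiples_constV pi2_gt0 (tau_path ce)) => t.
have [|k ->] := @cis_inj R (tau (e t)) 0; last by exists k; rewrite add0r.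
have [ez ew _] := arc_coords (eE t) (l0 t).
have [a0 b0] := ab_ge0 t.
rewrite -tauE cis0 wrap_out// => -[_]; rewrite ez ew !Re_mul /= !mul0r !subr0.
have neg (x : R) n : (2 < n)%N -> 0 <= x ->
    0 < x * complex.Re (far_root n) -> False.
  move=> n2 x0; rewrite ltNge mulr_ge0_le0//.
  exact: ltW (Re_far_root n2).
move: ij; case: i {eE ez} => [_ zp _|/= ->].
  exact: (neg _ p p_gt2 b0).
by move=> _; exact: (neg _ q q_gt2 a0).
Qed.

Let cross_strip (e : R -> E) : continuous e ->
  (forall t, pr (e t) = edge false false t) -> (forall t, lam (e t) = 0) ->
  tau (e 1) = tau (e 0) + 2 * pi.
Proof.
move=> ce eE l0; pose d t := tau (e t) - 2 * pi * part (e t).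
have cd : continuous d.
  move=> t; apply: cvgB; first exact: tau_path.
  apply: cvgM; first exact: cvg_cst.
  apply: (@continuous_comp _ _ _ e part); first exact: ce.
  exact: continuous_part.
have dE t : exists k : int, d t = 2 * pi * k%:~R.
  have [|k Ek] := @cis_inj R (tau (e t)) (2 * pi * part (e t)); last first.
    by exists k; rewrite /d Ek; lra.
  have [ez ew xE] := arc_coords (eE t) (l0 t); have [a0 b0] := ab_ge0 t.
  rewrite -tauE wrap_in//; split; rewrite ?ez ?ew /= ?mulr1 ?mulr0 ?subr0//.
  have aq : 0 <= a t ^+ q by rewrite exprn_ge0.
  have bp : 0 <= b t ^+ p by rewrite exprn_ge0.
  rewrite xE divr_ge0 ?addr_ge0//=.
  have [-> |ne] := eqVneq (a t ^+ q + b t ^+ p) 0; first by rewrite invr0 mulr0 ler01.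
  by rewrite ler_pdivrMr ?mul1r ?lerDl// lt_def ne addr_ge0.
have := multiples_constV pi2_gt0 cd dE 0 1; rewrite /d.
have q0 : (q == 0)%N = false by apply/negbTE; case: q q_odd.
have p0 : (p == 0)%N = false by apply/negbTE; case: p p_odd.
have [_ _ ->] := arc_coords (eE 0) (l0 0); have [_ _ ->] := arc_coords (eE 1) (l0 1).
rewrite ab_end.1 ab_end.2 !expr0n q0 p0 mul0r addr0 divff; first by lra.
rewrite expf_neq0//; apply/eqP => a1.
have := abE 1; rewrite a1 ab_end.2 !expr0n q0 p0 /= !addr0 => /eqP.
by rewrite eq_sym oner_eq0.
Qed.

(* The arcs with (i, j) = (0, 0), (1, 0), (1, 1), (0, 1) form a 4-cycle. Its lift
   closes up, since lam is 0 at both ends, and tau grows by 2 pi on the first arc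
   while it is constant on the others. *)
Lemma wrapped_contradiction e0 : pr e0 = edge false false 0 -> lam e0 = 0 -> False.
Proof.
move=> E0 L0.
have [e1 [ce1 s1 P1 L1]] := lift_arc E0 L0.
have E1 : pr (e1 1) = edge true false 1 by rewrite P1; exact: arc_at1.
have [e2 [ce2 s2 P2 L2]] := lift_arc E1 (L1 1).
have E2 : pr (e2 0) = edge true true 0 by rewrite P2; exact: arc_at0.
have [e3 [ce3 s3 P3 L3]] := lift_arc E2 (L2 0).
have E3 : pr (e3 1) = edge false true 1 by rewrite P3; exact: arc_at1.
have [e4 [ce4 s4 P4 L4]] := lift_arc E3 (L3 1).
have [j Ej] : exists j, e4 0 = deck j e0.
  by apply: pr_inj; rewrite P4 E0; exact: arc_at0.
have [k Hk] := lam_deck; have k0 := lam_deck_neq0 Hk.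
have j0 : j = 0.
  have := L4 0; rewrite Ej Hk L0 add0r => /eqP.
  rewrite mulf_eq0 (gt_eqF pi2_gt0) /= intr_eq0 mulf_eq0 (negbTE k0) /=.
  by move=> /eqP.
have t1 := cross_strip ce1 P1 L1.
have t2 := @cross_other true false _ isT ce2 P2 L2.
have t3 := @cross_other true true _ isT ce3 P3 L3.
have t4 := @cross_other false true _ isT ce4 P4 L4.
move: t1 t2 t3 t4; rewrite s1 s2 s3 s4 Ej j0 deck0.
have := pi2_gt0; lra.
Qed.
End Wrapped.

Lemma cycle_contradiction e0 : pr e0 = edge false false 0 -> lam e0 = 0 -> False.
Proof.
have wrap0 e : wrap e != 0.
  by rewrite /wrap; case: ifP => _; [exact: cis_neq0|exact: oner_neq0].
have [tau [ct tauE]] := continuous_angle ccont_wrap wrap0.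
apply: (@wrapped_contradiction tau) => // e; rewrite tauE.
have -> : cmod (wrap e) = 1; last by rewrite mul1r.
by rewrite /wrap; case: ifP => _; rewrite -?cis0 cmod_cis.
Qed.
End Contradiction.
End Angle.

(** The real angle of [wrap] is multivalued on the graph of arcs but not on R^3.
    Shifting the angle lam by a multiple of 2 pi makes it vanish at a lift of the
    first vertex. *)
Lemma brieskorn3_not_sphere : False.
Proof.
have [lam [cl lamE]] := continuous_angle ccont_f f_neq0.
have [a [b [ca cb ab0 abend abE]]] := @arcs R p q p_odd q_odd.
pose c := join_arc p_odd q_odd ab0 abE false false.
have cc : continuous c by exact: continuous_arc.
have oa t : first_axis (set_val (c t)).2 by exact: arc_axis.
have on t : (set_val (c t)).2 != 0 by exact: arc_neq0.
have [e [_ eE]] := pr_lift cc oa on.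
have fE : f (e 0) = (cmod (f (e 0)))%:C%C.
  rewrite /f eE set_val_pt curve_poly_arc// cmod_real//.
  by have [a0 b0] := ab0 0; rewrite addr_ge0// exprn_ge0.
have m0 : ((cmod (f (e 0)))%:C%C : R[i]) != 0.
  by rewrite fmorph_eq0 gt_eqF// cmod_gt0.
have l1 : cis (lam (e 0)) = 1.
  by apply: (mulfI m0); rewrite -lamE mulr1.
apply: (@cycle_contradiction (fun x => lam x - lam (e 0)) _ _ a b ca cb ab0 abend
  abE (e 0)) => //.
- by move=> x; apply: cvgB; [exact: cl|exact: cvg_cst].
- move=> x; rewrite cisD {1}lamE; congr (_ * _).
  by rewrite -[LHS]mulr1 -(cisN_mul (lam (e 0))) l1 mulr1.
- by rewrite subrr.
Qed.
End NoSphere.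

(** * Fixed points of i and j *)

Section Conjugation.
Context {R : realType}.
Implicit Types p q u v : quat R.

Definition conj_by q u : quat R := q * u * conjq q.

(** Conjugations are automorphisms of the quaternions, which is how invariance
    under i and j passes to all derived quantities. *)
Lemma conj_byM q u v : sqnorm q = 1 ->
  conj_by q (u * v) = conj_by q u * conj_by q v.
Proof.
by move=> hq; rewrite /conj_by -[v in LHS]mul1r -(conj_mulq hq) !mulrA.
Qed.

Lemma conj_byZ q (a : R) u : conj_by q (a *: u) = a *: conj_by q u.
Proof. by rewrite /conj_by -scalerAr -scalerAl. Qed.

Lemma conj_by_conjq q u : conj_by q (conjq u) = conjq (conj_by q u).
Proof. by rewrite /conj_by !conjqM conjqK mulrA. Qed.

Lemma conjqZ (a : R) u : conjq (a *: u) = a *: conjq u.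
Proof. by apply: quatP; rewrite !qE; ring. Qed.

Lemma mul_conjq u : u * conjq u = (sqnorm u)%:A.
Proof.
by rewrite sqnormq mulqE oneqE; apply: quatP; rewrite !qE; ring.
Qed.

Lemma conjq_mul u : conjq u * u = (sqnorm u)%:A.
Proof.
by rewrite sqnormq mulqE oneqE; apply: quatP; rewrite !qE; ring.
Qed.

Lemma S3_qi : @S3 R (mkq 0 1 0 0).
Proof. by rewrite /S3 /= sqnormq !qE; ring. Qed.
Lemma S3_qj : @S3 R (mkq 0 0 1 0).
Proof. by rewrite /S3 /= sqnormq !qE; ring. Qed.
Definition qi : @S3 R := pt S3_qi.
Definition qj : @S3 R := pt S3_qj.

Lemma conj_by_qi u : conj_by (set_val qi) u = mkq (q0 u) (q1 u) (- q2 u) (- q3 u).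
Proof.
by rewrite set_val_pt /conj_by !mulqE; apply: quatP; rewrite !qE; ring.
Qed.

Lemma conj_by_qj u : conj_by (set_val qj) u = mkq (q0 u) (- q1 u) (q2 u) (- q3 u).
Proof.
by rewrite set_val_pt /conj_by !mulqE; apply: quatP; rewrite !qE; ring.
Qed.

(** The complex numbers, as the centralizer of i in the quaternions. *)
Definition cplx u : Prop := q2 u = 0 /\ q3 u = 0.

Lemma conj_by_qiP u : conj_by (set_val qi) u = u <-> cplx u.
Proof.
rewrite conj_by_qi; split=> [h|[h2 h3]]; last first.
  by apply: quatP; rewrite !qE ?h2 ?h3 ?oppr0.
have h2 := congr1 q2 h; have h3 := congr1 q3 h; rewrite !qE in h2 h3.
by split; lra.
Qed.

Lemma cplxM u v : cplx u -> cplx v -> cplx (u * v).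
Proof. by rewrite -!conj_by_qiP conj_byM ?S3P// => -> ->. Qed.

Lemma cplxZ (a : R) u : cplx u -> cplx (a *: u).
Proof. by move=> [h2 h3]; split; rewrite !qE ?h2 ?h3 mulr0. Qed.

Lemma cplx_conjq u : cplx u -> cplx (conjq u).
Proof. by move=> [h2 h3]; split; rewrite /conjq !qE ?h2 ?h3 oppr0. Qed.

Lemma cplxN u : cplx u -> cplx (- u).
Proof. by move=> [h2 h3]; split; rewrite !qE ?h2 ?h3 oppr0. Qed.

Lemma cplx_comm u v : cplx u -> cplx v -> u * v = v * u.
Proof.
move=> [u2 u3] [v2 v3]; rewrite !mulqE; apply: quatP;
  rewrite !qE ?u2 ?u3 ?v2 ?v3; ring.
Qed.

(** The 3-sphere of unit quaternions is read as the sphere of the pairs (al, be)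
    in C^2. *)
Definition al u : quat R := mkq (q0 u) (q1 u) 0 0.
Definition be u : quat R := mkq (q2 u) (q3 u) 0 0.

Lemma cplx_al u : cplx (al u). Proof. by split; rewrite !qE. Qed.
Lemma cplx_be u : cplx (be u). Proof. by split; rewrite !qE. Qed.

Lemma al_be_inj u v : al u = al v -> be u = be v -> u = v.
Proof.
move=> ha hb; have a0 := congr1 q0 ha; have a1 := congr1 q1 ha.
have b0 := congr1 q0 hb; have b1 := congr1 q1 hb.
by rewrite !qE in a0 a1 b0 b1; apply: quatP.
Qed.

Lemma sqnorm_al_be u : sqnorm (al u) + sqnorm (be u) = sqnorm u.
Proof. by rewrite !sqnormq !qE; ring. Qed.

Lemma al_pair a b : cplx a -> al (mkq (q0 a) (q1 a) (q0 b) (q1 b)) = a.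
Proof. by move=> [h2 h3]; apply: quatP; rewrite !qE. Qed.

Lemma be_pair a b : cplx b -> be (mkq (q0 a) (q1 a) (q0 b) (q1 b)) = b.
Proof. by move=> [h2 h3]; apply: quatP; rewrite !qE. Qed.

Lemma pair_S3 a b : cplx a -> cplx b -> sqnorm a + sqnorm b = 1 ->
  exists s : @S3 R, al (set_val s) = a /\ be (set_val s) = b.
Proof.
move=> ca cb h.
have hs : @S3 R (mkq (q0 a) (q1 a) (q0 b) (q1 b)).
  by rewrite /S3 /= -sqnorm_al_be al_pair// be_pair.
by exists (pt hs); rewrite set_val_pt al_pair// be_pair.
Qed.

Lemma continuous_al : continuous al.
Proof.
apply: (@continuous_mkq R _ q0 q1 (fun=> 0) (fun=> 0)).
- exact: continuous_q0.
- exact: continuous_q1.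
- exact: cst_continuous.
- exact: cst_continuous.
Qed.

Lemma continuous_be : continuous be.
Proof.
apply: (@continuous_mkq R _ q2 q3 (fun=> 0) (fun=> 0)).
- exact: continuous_q2.
- exact: continuous_q3.
- exact: cst_continuous.
- exact: cst_continuous.
Qed.

Lemma S3_flip (s : @S3 R) : S3 (conj_by (set_val qj) (set_val s)).
Proof. by rewrite /S3 /= /conj_by sqnorm_conj ?S3P. Qed.

(** Complex conjugation of both coordinates; its fixed points form the circle
    of real pairs. *)
Definition flip (s : @S3 R) : @S3 R := pt (S3_flip s).

Lemma al_flip s : al (set_val (flip s)) = conj_by (set_val qj) (al (set_val s)).
Proof.
by rewrite [set_val (flip s)]set_val_pt !conj_by_qj; apply: quatP; rewrite !qE ?oppr0.
Qed.

Lemma be_flip s : be (set_val (flip s)) = conj_by (set_val qj) (be (set_val s)).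
Proof.
by rewrite [set_val (flip s)]set_val_pt !conj_by_qj; apply: quatP; rewrite !qE ?oppr0.
Qed.

Lemma flip_fixed s : flip s = s <-> q1 (set_val s) = 0 /\ q3 (set_val s) = 0.
Proof.
split=> [/(congr1 set_val)|[h1 h3]]; last first.
  apply: set_val_inj; rewrite [set_val (flip s)]set_val_pt conj_by_qj h1 h3.
  by apply: quatP; rewrite !qE ?oppr0.
rewrite [set_val (flip s)]set_val_pt conj_by_qj => h.
have h1 := congr1 q1 h; have h3 := congr1 q3 h; rewrite !qE in h1 h3.
by split; lra.
Qed.
End Conjugation.

Section Model.
Context {R : realType} (p q : nat).
Hypotheses (p_odd : odd p) (q_odd : odd q) (p_gt2 : (2 < p)%N) (q_gt2 : (2 < q)%N).

Lemma rot_qi_fixed (z : 'M[R]_(3, 2)) :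
  set_val (Defs.rot qi) *m z = z <-> first_axis z.
Proof.
have E i j : (set_val (Defs.rot qi) *m z) i j = set_val (Defs.rot qi) i 0 * z 0 j +
    set_val (Defs.rot qi) i 1 * z 1 j + set_val (Defs.rot qi) i 2 * z 2 j.
  by rewrite mxE sum3.
have D := @rotmxij R (set_val qi); rewrite [set_val (Defs.rot qi)]set_val_pt in E.
rewrite [set_val (Defs.rot qi)]set_val_pt; split=> [h|[r1 r2]].
  by split; apply/rowP => j; rewrite !mxE;
    [have := E 1 j|have := E 2 j]; rewrite h !D set_val_pt !qE; lra.
apply/matrixP; elim/ord3P => j; rewrite E !D set_val_pt !qE.
- by ring.
- by have := congr1 (fun v : 'rV[R]_2 => v 0 j) r1; rewrite !mxE => ->; ring.
- by have := congr1 (fun v : 'rV[R]_2 => v 0 j) r2; rewrite !mxE => ->; ring.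
Qed.

Lemma rot_qj_fixed (z : 'M[R]_(3, 2)) : first_axis z ->
  (set_val (Defs.rot qj) *m z = z <-> z = 0).
Proof.
move=> [r1 r2]; split=> [h|->]; last by rewrite mulmx0.
have E i j : (set_val (Defs.rot qj) *m z) i j = set_val (Defs.rot qj) i 0 * z 0 j +
    set_val (Defs.rot qj) i 1 * z 1 j + set_val (Defs.rot qj) i 2 * z 2 j.
  by rewrite mxE sum3.
have D := @rotmxij R (set_val qj); rewrite [set_val (Defs.rot qj)]set_val_pt in E h.
apply/matrixP; elim/ord3P => j; rewrite [RHS]mxE.
- by have := E 0 j; rewrite h !D set_val_pt !qE; lra.
- by have := congr1 (fun v : 'rV[R]_2 => v 0 j) r1; rewrite !mxE.
- by have := congr1 (fun v : 'rV[R]_2 => v 0 j) r2; rewrite !mxE.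
Qed.

Lemma brieskorn_act_fixed a b (A : @SO3 R) (x : brieskorn R a b) :
  brieskorn_act A x = x <-> set_val A *m (set_val x).2 = (set_val x).2.
Proof.
split=> [/(congr1 set_val)|h].
  by rewrite [set_val (brieskorn_act A x)]set_val_pt => /(congr1 snd).
apply: set_val_inj; rewrite [set_val (brieskorn_act A x)]set_val_pt h.
by case: (set_val x).
Qed.

(** An equivariant homeomorphism matches the points fixed by i, which are the
    first coordinate axis of C^3 on one side and the sphere sigma on the other,
    and among these the points fixed by j. *)
Lemma not_diffeomorphic_of_model (T : topologicalType) (d : nat)
    (B : set (@chart R T d)) (act : @S3 R -> T -> T) (sigma : @S3 R -> T) :
  continuous sigma -> injective sigma ->
  (forall c, act qi c = c <-> exists s, sigma s = c) ->
  (forall s, act qj (sigma s) = sigma (flip s)) ->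
  ~ SO3_diffeomorphic (brieskorn_charts R q p) (@brieskorn_act R q p) B act.
Proof.
move=> cs si fixi actj [f [[_ [g [fg gf [cg _]]]] equi]].
have fI : injective f := can_inj fg.
apply: (@brieskorn3_not_sphere R p q p_odd q_odd p_gt2 q_gt2 (g \o sigma)).
- by move=> s; apply: continuous_comp; [exact: cs|exact: cg].
- by move=> s s' /= /(can_inj gf) /si.
- move=> x; rewrite -rot_qi_fixed -brieskorn_act_fixed; split=> [h|[s <-]].
    have /fixi[s sE] : act qi (f x) = f x by rewrite -equi h.
    by exists s; rewrite /= sE fg.
  by apply: fI; rewrite equi /= gf; apply/fixi; exists s.
- move=> s; rewrite -flip_fixed.
  have ax : first_axis (set_val ((g \o sigma) s)).2.
    rewrite -rot_qi_fixed -brieskorn_act_fixed; apply: fI.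
    by rewrite equi /= gf; apply/fixi; exists s.
  rewrite -(rot_qj_fixed ax) -brieskorn_act_fixed /=; split=> [h|h].
    by apply: si; rewrite -actj -{1}(gf (sigma s)) -equi h gf.
  by apply: fI; rewrite equi gf actj h.
Qed.
End Model.

(** * Points of the Milnor manifolds fixed by i *)

Section LocalContinuity.

Lemma continuous_near (S T : topologicalType) (f g : S -> T) x :
  {for x, continuous f} -> (\forall y \near x, f y = g y) ->
  {for x, continuous g}.
Proof.
move=> cf fg; rewrite /prop_for /continuous_at -(nbhs_singleton fg).
apply: cvg_trans cf; apply: near_eq_cvg.
by apply: filterS fg => y.
Qed.

Lemma continuous_to_subset_at (S T : topologicalType) (A : set T)
    (f : S -> A) x :
  {for x, continuous (fun y => set_val (f y))} -> {for x, continuous f}.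
Proof.
move=> cf U [? /= [[W oW <-]]] /= Wfx /filterS; apply; apply: cf.
exact: open_nbhs_nbhs.
Qed.
End LocalContinuity.

Section MilnorModel.
Context {R : realType}.
Local Notation H2 := (quat R * quat R)%type.
Implicit Types (s : @S3 R) (x y : H2) (k l : int).

Lemma sqnormq_gt0 (u : quat R) : (0 < sqnorm u) = (u != 0).
Proof.
rewrite lt_def sqnormq_eq0; case: eqVneq => //= _; rewrite sqnormq.
by rewrite !addr_ge0// sqr_ge0.
Qed.

Lemma sqnormq_ge0 (u : quat R) : 0 <= sqnorm u.
Proof. by rewrite sqnormq !addr_ge0// sqr_ge0. Qed.

Lemma unit_direction (u : quat R) : u != 0 ->
  sqnorm ((Num.sqrt (sqnorm u))^-1 *: u) = 1.
Proof. by rewrite -sqnormq_gt0 => /normalize_S3. Qed.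

Lemma quat_unitE (u : quat R) : (u \is a GRing.unit) = (u != 0).
Proof.
apply/idP/idP => [|u0]; first by apply: contraTneq => ->; rewrite unitr0.
by apply/unitrP; exists (Defs.invq u); split; [exact: Defs.mulVq|exact: Defs.mulqV].
Qed.

Lemma glue_glueN k l x : x.1 != 0 -> Defs.glue (- k) (- l) (Defs.glue k l x) = x.
Proof.
case: x => u v /= u0; rewrite /Defs.glue.
have n0 : 0 < sqnorm u by rewrite sqnormq_gt0.
have n1 : sqnorm ((sqnorm u)^-1 *: u) = (sqnorm u)^-1.
  by rewrite sqnormqZ expr2 -mulrA mulVf ?mulr1// gt_eqF.
rewrite n1 sqrtrV ?ltW// invrK scalerA.
set n := sqnorm u in n0 n1 *; set m := Num.sqrt n.
have m0 : m != 0 by rewrite gt_eqF// sqrtr_gt0.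
have mm : m * n^-1 = m^-1.
  by rewrite -[n](sqr_sqrtr (ltW n0)) -/m; field.
rewrite invrK scalerA mm divff ?scale1r; last by rewrite gt_eqF.
set r := m^-1 *: u.
have ur : r \is a GRing.unit.
  by rewrite quat_unitE scaler_eq0 negb_or invr_eq0 m0.
have -> // : r ^ (- k) * (r ^ k * v * r ^ l) * r ^ (- l) = v.
rewrite -!invr_expz !mulrA mulVr ?unitrXz// mul1r.
by rewrite -mulrA mulrV ?unitrXz// mulr1.
Qed.

(** The gluing map is a bijection between the parts u <> 0 of the two charts, so
    each class has a canonical representative: the one in the first chart if
    there is one. *)
Definition normal_form k l (a : @two_HxS3 R) : bool * H2 :=
  let x := set_val (projT2 a) in
  if projT1 a then
    if x.1 != 0 then (false, Defs.glue (- k) (- l) x) else (true, x)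
  else (false, x).

Lemma glue_neq0 k l x : x.1 != 0 -> (Defs.glue k l x).1 != 0.
Proof.
case: x => u v /= u0; rewrite scaler_eq0 negb_or u0 andbT invr_eq0.
by rewrite sqnormq_eq0.
Qed.

Lemma normal_form_pi k l (a b : @two_HxS3 R) :
  milnor_pi k l a = milnor_pi k l b -> normal_form k l a = normal_form k l b.
Proof.
move=> /milnor_piP; elim => {a b} [a b|a|a b _ -> //|a b c _ -> _ -> //] //.
move=> [x [y [-> -> x0 E]]]; rewrite /normal_form /= E glue_neq0//.
by rewrite glue_glueN.
Qed.

Lemma milnor_pi_inj k l b (x y : @HxS3 R) :
  milnor_pi k l (chart_map b x) = milnor_pi k l (chart_map b y) -> x = y.
Proof.
move=> /normal_form_pi; rewrite /normal_form /=; case: b => /=; last first.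
  by move=> [/set_val_inj].
case: ifP => x0; case: ifP => y0 //; last by move=> [/set_val_inj].
move=> [/(congr1 (Defs.glue k l))].
have H (z : H2) : z.1 != 0 -> Defs.glue k l (Defs.glue (- k) (- l) z) = z.
  by move=> z0; rewrite -{1}[k]opprK -{1}[l]opprK glue_glueN.
by rewrite !H// => /set_val_inj.
Qed.

Lemma HxS3_base : @HxS3 R (0, 1).
Proof. by rewrite /HxS3 /= sqnorm1q. Qed.

(** The chart formulas below give points of H x S^3 only where their denominator
    is not 0; the default value makes them total. *)
Definition to_HxS3 (x : H2) : @HxS3 R :=
  if pselect (HxS3 x) is left h then pt h else pt HxS3_base.

Lemma set_val_to_HxS3 x : HxS3 x -> set_val (to_HxS3 x) = x.
Proof. by rewrite /to_HxS3; case: pselect => // h _; rewrite set_val_pt. Qed.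

Definition cross s : quat R := be (set_val s) * conjq (al (set_val s)).

(** In terms of the complex coordinates a and b of the sphere, [chart1] is
    (b / a, a / |a|) and [chart2] is (conj (a / b), b / |b|). *)
Definition chart1 s : H2 :=
  ((sqnorm (al (set_val s)))^-1 *: cross s,
   (Num.sqrt (sqnorm (al (set_val s))))^-1 *: al (set_val s)).

Definition chart2 s : H2 :=
  ((sqnorm (be (set_val s)))^-1 *: cross s,
   (Num.sqrt (sqnorm (be (set_val s))))^-1 *: be (set_val s)).

Lemma chart1_in s : al (set_val s) != 0 -> HxS3 (chart1 s).
Proof. exact: unit_direction. Qed.

Lemma chart2_in s : be (set_val s) != 0 -> HxS3 (chart2 s).
Proof. exact: unit_direction. Qed.

Lemma cplx_cross s : cplx (cross s).
Proof. by apply: cplxM; [exact: cplx_be|apply: cplx_conjq; exact: cplx_al]. Qed.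

Lemma al_be_neq0 s : al (set_val s) = 0 -> be (set_val s) != 0.
Proof.
move=> a0; apply/eqP => b0; have := sqnorm_al_be (set_val s).
rewrite a0 b0 S3P; have -> : sqnorm (0 : quat R) = 0.
  by apply/eqP; rewrite sqnormq_eq0.
by rewrite addr0 => /eqP; rewrite eq_sym oner_eq0.
Qed.

Lemma sqnorm_cross s :
  sqnorm (cross s) = sqnorm (be (set_val s)) * sqnorm (al (set_val s)).
Proof. by rewrite sqnormqM sqnorm_conjq. Qed.

(** Inside C the gluing map is (u, v) |-> (1 / conj u, (u / |u|) ^ (k + l) v), which
    for k + l = 1 does not depend on k: the points of the Milnor manifold fixed
    by i form the Hopf gluing of two solid tori, the 3-sphere. *)
Lemma glue_chart k l s : k + l = 1 -> al (set_val s) != 0 ->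
  be (set_val s) != 0 -> Defs.glue k l (chart1 s) = chart2 s.
Proof.
move=> kl a0 b0; rewrite /chart1 /chart2 /Defs.glue.
set c := cross s; have cc : cplx c := cplx_cross s.
have nc : sqnorm c = sqnorm (be (set_val s)) * sqnorm (al (set_val s)).
  exact: sqnorm_cross.
have cE : c * al (set_val s) = sqnorm (al (set_val s)) *: be (set_val s).
  by rewrite /c /cross -mulrA conjq_mul -scalerAr mulr1.
have ca := cplx_al (set_val s).
move: a0 b0 nc cE ca; move: (al _) (be _) c cc => a b c cc a0 b0 nc cE ca.
have na : 0 < sqnorm a by rewrite sqnormq_gt0.
have nb : 0 < sqnorm b by rewrite sqnormq_gt0.
set A := sqnorm a in na nc cE *; set B := sqnorm b in nb nc *.
have sE : sqnorm (A^-1 *: c) = B / A.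
  by rewrite sqnormqZ nc; field; rewrite gt_eqF.
rewrite sE scalerA invf_div.
have -> : A / B * A^-1 = B^-1 by field; rewrite !gt_eqF.
set r := (Num.sqrt _)^-1 *: (A^-1 *: c); set v := _ *: a.
have AE : A = Num.sqrt A ^+ 2 by rewrite sqr_sqrtr ?ltW.
have sA : 0 < Num.sqrt A by rewrite sqrtr_gt0.
have sB : 0 < Num.sqrt B by rewrite sqrtr_gt0.
have rE : r = (Num.sqrt A * Num.sqrt B)^-1 *: c.
  rewrite /r scalerA sqrtrM ?ltW// sqrtrV ?ltW//; congr (_ *: _).
  by rewrite {2}AE; field; rewrite !gt_eqF.
have ur : r \is a GRing.unit.
  rewrite quat_unitE rE scaler_eq0 negb_or invr_eq0 mulf_neq0 ?gt_eqF//=.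
  by rewrite -sqnormq_eq0 nc mulf_neq0// gt_eqF.
have rv : r * v = v * r.
  by apply: cplx_comm; rewrite ?rE; apply: cplxZ.
have -> : r ^ k * v * r ^ l = r * v.
  by rewrite -mulrA (commrXz (y := r)) // mulrA -exprzDr// kl expr1z.
rewrite rE /v -scalerAl -scalerAr cE !scalerA.
have -> // : (Num.sqrt A * Num.sqrt B)^-1 * (Num.sqrt A)^-1 * A = (Num.sqrt B)^-1.
by rewrite {3}AE; field; rewrite !gt_eqF.
Qed.

(** The parametrization of the set of points fixed by i. By [glue_chart] the two
    formulas agree where both apply, so the second one is needed at al = 0 only. *)
Definition milnor_model k l s : milnor R k l :=
  if al (set_val s) != 0 then milnor_pi k l (chart_map false (to_HxS3 (chart1 s)))
  else milnor_pi k l (chart_map true (to_HxS3 (chart2 s))).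

Lemma milnor_model1 k l s : al (set_val s) != 0 ->
  milnor_model k l s = milnor_pi k l (chart_map false (to_HxS3 (chart1 s))).
Proof. by rewrite /milnor_model => ->. Qed.

Lemma milnor_model2 k l s : k + l = 1 -> be (set_val s) != 0 ->
  milnor_model k l s = milnor_pi k l (chart_map true (to_HxS3 (chart2 s))).
Proof.
move=> kl b0; rewrite /milnor_model; case: ifPn => // a0.
apply/milnor_piP; apply: rst_step.
exists (to_HxS3 (chart1 s)), (to_HxS3 (chart2 s)); split => //.
  rewrite set_val_to_HxS3; last exact: chart1_in.
  rewrite /= scaler_eq0 negb_or invr_eq0 sqnormq_eq0 a0 /=.
  by rewrite -sqnormq_eq0 sqnorm_cross mulf_neq0// sqnormq_eq0.
rewrite !set_val_to_HxS3 ?glue_chart//; [exact: chart1_in|exact: chart2_in].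
Qed.

End MilnorModel.

Section MilnorModelProperties.
Context {R : realType}.
Local Notation H2 := (quat R * quat R)%type.
Implicit Types (s : @S3 R) (k l : int).

Lemma continuous_coord (T : topologicalType) (f : T -> quat R) (c : quat R -> R) :
  continuous c -> continuous f -> continuous (fun x => c (f x)).
Proof.
by move=> cc cf x; apply: (@continuous_comp _ _ _ f c); [exact: cf|exact: cc].
Qed.

Lemma continuous_mulq (T : topologicalType) (f g : T -> quat R) :
  continuous f -> continuous g -> continuous (fun x => f x * g x : quat R).
Proof.
move=> cf cg.
have H (c d : quat R -> R) : continuous c -> continuous d ->
    continuous (fun x => c (f x) * d (g x)).
  by move=> cc cd x; apply: cvgM; apply: continuous_coord.
have [c0 c1 c2 c3] := And4 (@continuous_q0 R) (@continuous_q1 R)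
  (@continuous_q2 R) (@continuous_q3 R).
have B (a b : T -> R) : continuous a -> continuous b ->
  continuous (fun x => a x - b x) by move=> ca cb x; apply: cvgB; [exact: ca|exact: cb].
have D (a b : T -> R) : continuous a -> continuous b ->
  continuous (fun x => a x + b x) by move=> ca cb x; apply: cvgD; [exact: ca|exact: cb].
apply: continuous_mkq.
- by apply: (B _ _); [apply: (B _ _); [apply: (B _ _)|]|]; exact: (H _ _).
- by apply: (B _ _); [apply: (D _ _); [apply: (D _ _)|]|]; exact: (H _ _).
- by apply: (D _ _); [apply: (D _ _); [apply: (B _ _)|]|]; exact: (H _ _).
- by apply: (D _ _); [apply: (B _ _); [apply: (D _ _)|]|]; exact: (H _ _).
Qed.

Lemma continuous_conjq (T : topologicalType) (f : T -> quat R) :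
  continuous f -> continuous (fun x => conjq (f x)).
Proof.
move=> cf; have N (c : quat R -> R) : continuous c ->
    continuous (fun x => - c (f x)).
  by move=> cc x; apply: cvgN; apply: continuous_coord.
apply: (@continuous_mkq R _ (fun x => q0 (f x)) (fun x => - q1 (f x))
  (fun x => - q2 (f x)) (fun x => - q3 (f x))).
- by apply: continuous_coord => //; exact: continuous_q0.
- exact: (N _ continuous_q1).
- exact: (N _ continuous_q2).
- exact: (N _ continuous_q3).
Qed.

Lemma continuous_al_S3 : continuous (fun s : @S3 R => al (set_val s)).
Proof.
move=> s; apply: (@continuous_comp _ _ _ set_val al).
  exact: set_val_continuous.
exact: continuous_al.
Qed.

Lemma continuous_be_S3 : continuous (fun s : @S3 R => be (set_val s)).
Proof.
move=> s; apply: (@continuous_comp _ _ _ set_val be).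
  exact: set_val_continuous.
exact: continuous_be.
Qed.

Lemma continuous_chart (f g : @S3 R -> quat R) s : continuous f -> continuous g ->
  g s != 0 -> {for s, continuous (fun t =>
    ((sqnorm (g t))^-1 *: f t, (Num.sqrt (sqnorm (g t)))^-1 *: g t) : H2)}.
Proof.
move=> cf cg g0.
have cn : continuous (fun t => sqnorm (g t)).
  by apply: continuous_coord => //; exact: continuous_sqnormq.
have n0 : 0 < sqnorm (g s) by rewrite sqnormq_gt0.
have c1 : (sqnorm (g t))^-1 @[t --> s] --> (sqnorm (g s))^-1.
  exact: (cvgV (lt0r_neq0 n0) (cn s)).
have c2 : Num.sqrt (sqnorm (g t)) @[t --> s] --> Num.sqrt (sqnorm (g s)).
  exact: (continuous_comp (cn s) (@sqrt_continuous R _)).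
have s0 : Num.sqrt (sqnorm (g s)) != 0 by rewrite gt_eqF// sqrtr_gt0.
exact: (cvg_pair (cvgZ c1 (cf s)) (cvgZ (cvgV s0 c2) (cg s))).
Qed.

Lemma near_neq0 (f : @S3 R -> quat R) s : continuous f -> f s != 0 ->
  \forall t \near s, f t != 0.
Proof.
move=> cf f0; have cn : continuous (fun t => sqnorm (f t)).
  by apply: continuous_coord => //; exact: continuous_sqnormq.
have n0 : 0 < sqnorm (f s) by rewrite sqnormq_gt0.
have h := cvgr_gt _ (cn s) _ n0.
near=> t; rewrite -sqnormq_gt0; near: t; exact: h.
Unshelve. all: by end_near.
Qed.

Lemma continuous_milnor_chart k l b (c : @S3 R -> H2) s :
  {for s, continuous c} -> (\forall t \near s, HxS3 (c t)) ->
  {for s, continuous (fun t => milnor_pi k l (chart_map b (to_HxS3 (c t))))}.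
Proof.
move=> cc nc.
have c1 : {for s, continuous (fun t => to_HxS3 (c t))}.
  apply: continuous_to_subset_at; apply: (continuous_near cc).
  by apply: filterS nc => t /set_val_to_HxS3.
apply: (@continuous_comp _ _ _ (fun t => chart_map b (to_HxS3 (c t)))
  (milnor_pi k l)); last exact: pi_continuous.
apply: (@continuous_comp _ _ _ (fun t => to_HxS3 (c t)) (chart_map b)) => //.
Qed.

Lemma continuous_cross : continuous (@cross R).
Proof.
apply: continuous_mulq; first exact: continuous_be_S3.
by apply: continuous_conjq; exact: continuous_al_S3.
Qed.

Lemma continuous_milnor_model k l : k + l = 1 ->
  continuous (@milnor_model R k l).
Proof.
move=> kl s; have [a0|a0] := eqVneq (al (set_val s)) 0.
  have nb := near_neq0 continuous_be_S3 (al_be_neq0 a0).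
  apply: (@continuous_near _ _ (fun t => milnor_pi k l (chart_map true (to_HxS3 (chart2 t))))).
    apply: continuous_milnor_chart.
      apply: continuous_chart; [exact: continuous_cross|exact: continuous_be_S3|].
      exact: al_be_neq0.
    by apply: filterS nb => t /chart2_in.
  by apply: filterS nb => t /(milnor_model2 kl) ->.
have na := near_neq0 continuous_al_S3 a0.
apply: (@continuous_near _ _ (fun t => milnor_pi k l (chart_map false (to_HxS3 (chart1 t))))).
  apply: continuous_milnor_chart.
    by apply: continuous_chart => //; [exact: continuous_cross|exact: continuous_al_S3].
  by apply: filterS na => t /chart1_in.
by apply: filterS na => t /(milnor_model1 k l) ->.
Qed.

Let scale1 (x : H2) : R := (Num.sqrt (1 + sqnorm x.1))^-1.

(** As |a| ^+ 2 + |b| ^+ 2 = 1 and |u| = |b| / |a|, the norm of a is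
    1 / sqrt (1 + |u| ^+ 2), and the sphere is recovered from its chart. *)
Lemma chart1_inv s : al (set_val s) != 0 ->
  al (set_val s) = scale1 (chart1 s) *: (chart1 s).2 /\
  be (set_val s) = scale1 (chart1 s) *: ((chart1 s).1 * (chart1 s).2).
Proof.
move=> a0; have ab := sqnorm_al_be (set_val s); rewrite S3P in ab.
have cE : cross s * al (set_val s) = sqnorm (al (set_val s)) *: be (set_val s).
  by rewrite /cross -mulrA conjq_mul -scalerAr mulr1.
have nc := sqnorm_cross s; rewrite /scale1 /chart1 /=.
have A0 : 0 < sqnorm (al (set_val s)) by rewrite sqnormq_gt0.
rewrite sqnormqZ nc; move: A0 ab cE.
set A := sqnorm (al _); set B := sqnorm (be _) => A0 ab cE.
have -> : 1 + A^-1 ^+ 2 * (B * A) = A^-1.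
  have -> : B = 1 - A by lra.
  by field; rewrite gt_eqF.
have sA : Num.sqrt A != 0 by rewrite gt_eqF// sqrtr_gt0.
rewrite sqrtrV ?ltW// invrK; split; first by rewrite scalerA divff// scale1r.
rewrite -scalerAl -scalerAr cE !scalerA.
have one (r : R) (u : quat R) : r = 1 -> u = r *: u by move=> ->; rewrite scale1r.
by apply: one; field; rewrite sA gt_eqF.
Qed.

Lemma chart2_inv s : be (set_val s) != 0 ->
  be (set_val s) = scale1 (chart2 s) *: (chart2 s).2 /\
  al (set_val s) = scale1 (chart2 s) *: (conjq (chart2 s).1 * (chart2 s).2).
Proof.
move=> b0; have ab := sqnorm_al_be (set_val s); rewrite S3P in ab.
have cE : conjq (cross s) * be (set_val s) =
    sqnorm (be (set_val s)) *: al (set_val s).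
  by rewrite /cross conjqM conjqK -mulrA conjq_mul -scalerAr mulr1.
have nc := sqnorm_cross s; rewrite /scale1 /chart2 /=.
have B0 : 0 < sqnorm (be (set_val s)) by rewrite sqnormq_gt0.
rewrite sqnormqZ nc conjqZ; move: B0 ab cE.
set A := sqnorm (al _); set B := sqnorm (be _) => B0 ab cE.
have -> : 1 + B^-1 ^+ 2 * (B * A) = B^-1.
  have -> : A = 1 - B by lra.
  by field; rewrite gt_eqF.
have sB : Num.sqrt B != 0 by rewrite gt_eqF// sqrtr_gt0.
rewrite sqrtrV ?ltW// invrK; split; first by rewrite scalerA divff// scale1r.
rewrite -scalerAl -scalerAr cE !scalerA.
have one (r : R) (u : quat R) : r = 1 -> u = r *: u by move=> ->; rewrite scale1r.
by apply: one; field; rewrite sB gt_eqF.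
Qed.

Lemma normal_form_chart1 k l s : al (set_val s) != 0 ->
  normal_form k l (chart_map false (to_HxS3 (chart1 s))) = (false, chart1 s).
Proof. by move=> a0; rewrite /normal_form /= set_val_to_HxS3//; exact: chart1_in. Qed.

Lemma normal_form_chart2 k l s : al (set_val s) = 0 ->
  normal_form k l (chart_map true (to_HxS3 (chart2 s))) = (true, chart2 s).
Proof.
move=> a0; have n0 : sqnorm (al (set_val s)) = 0.
  by apply/eqP; rewrite sqnormq_eq0; apply/eqP.
have c0 : sqnorm (cross s) = 0 by rewrite sqnorm_cross n0 mulr0.
have u0 : ((chart2 s).1 != 0) = false.
  by apply/negbTE; rewrite negbK -sqnormq_eq0 sqnormqZ c0 mulr0.
rewrite /normal_form [projT1 _]/= [projT2 _]/= set_val_to_HxS3 ?u0//.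
exact: chart2_in (al_be_neq0 a0).
Qed.

Lemma milnor_model_inj k l : injective (@milnor_model R k l).
Proof.
move=> s t; rewrite /milnor_model.
case: ifPn => [a0|/negPn/eqP a0]; case: ifPn => [b0|/negPn/eqP b0];
  move=> /normal_form_pi.
- rewrite (normal_form_chart1 k l a0) (normal_form_chart1 k l b0).
  move=> /(congr1 snd); rewrite /snd => E.
  have [h1 h2] := chart1_inv a0; have [h1' h2'] := chart1_inv b0.
  apply: set_val_inj; apply: al_be_inj; first by rewrite h1 h1' E.
  by rewrite h2 h2' E.
- rewrite (normal_form_chart1 k l a0) (normal_form_chart2 k l b0).
  by move=> /(congr1 fst).
- rewrite (normal_form_chart2 k l a0) (normal_form_chart1 k l b0).
  by move=> /(congr1 fst).
- rewrite (normal_form_chart2 k l a0) (normal_form_chart2 k l b0).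
  move=> /(congr1 snd); rewrite /snd => E.
  have [h1 h2] := chart2_inv (al_be_neq0 a0).
  have [h1' h2'] := chart2_inv (al_be_neq0 b0).
  apply: set_val_inj; apply: al_be_inj; first by rewrite h2 h2' E.
  by rewrite h1 h1' E.
Qed.

Lemma HxS3_act_fixed (q : @S3 R) (x : @HxS3 R) : HxS3_act q x = x <->
  conj_by (set_val q) (set_val x).1 = (set_val x).1 /\
  conj_by (set_val q) (set_val x).2 = (set_val x).2.
Proof.
split=> [/(congr1 set_val)|[h1 h2]].
  by rewrite set_val_pt /conjH; case: (set_val x) => u v [].
apply: set_val_inj; rewrite set_val_pt /conjH -/(conj_by _ _) h1.
by rewrite -/(conj_by _ _) h2; case: (set_val x).
Qed.

(** The same formulas that recover a point of the sphere from its chart produce a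
    point from any complex pair (u, v). *)
Lemma milnor_model_onto k l b (x : @HxS3 R) : k + l = 1 ->
  cplx (set_val x).1 -> cplx (set_val x).2 ->
  exists s, milnor_model k l s = milnor_pi k l (chart_map b x).
Proof.
move=> kl; have := ptP x; rewrite /HxS3 /=.
case E: (set_val x) => [u v] /= v1 cu cv.
have n0 : 0 < 1 + sqnorm u by rewrite ltr_wpDr// sqnormq_ge0.
pose c := (Num.sqrt (1 + sqnorm u))^-1.
have c0 : 0 < c by rewrite invr_gt0 sqrtr_gt0.
have cc : c ^+ 2 * (1 + sqnorm u) = 1.
  by rewrite exprVn sqr_sqrtr ?ltW// mulVf// gt_eqF.
have nv : sqnorm (c *: v) = c ^+ 2 by rewrite sqnormqZ v1 mulr1.
have v0 : c *: v != 0.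
  by rewrite -sqnormq_eq0 nv expf_neq0// gt_eqF.
have sc : Num.sqrt (c ^+ 2) = c by rewrite sqrtr_sqr ger0_norm// ltW.
have cV : c^-1 * c = 1 by rewrite mulVf// gt_eqF.
have vv : v * conjq v = 1 by exact: mulq_conj.
have cVV : (c ^+ 2)^-1 * (c * c) = 1 by rewrite -expr2 mulVf// expf_neq0// gt_eqF.
case: b.
  have [|||s [sa sb]] := @pair_S3 R (c *: (conjq u * v)) (c *: v).
  - by apply: cplxZ; apply: cplxM => //; exact: cplx_conjq.
  - exact: cplxZ.
  - by rewrite !sqnormqZ sqnormqM sqnorm_conjq v1 -[RHS]cc; ring.
  exists s; rewrite (milnor_model2 kl) ?sb//.
  suff -> : to_HxS3 (chart2 s) = x by [].
  apply: set_val_inj; rewrite set_val_to_HxS3; last by apply: chart2_in; rewrite sb.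
  rewrite E /chart2 /cross sa sb nv sc scalerA cV scale1r conjqZ conjqM conjqK.
  by rewrite -scalerAl -scalerAr mulrA vv mul1r !scalerA -mulrA cVV scale1r.
have [|||s [sa sb]] := @pair_S3 R (c *: v) (c *: (u * v)).
- exact: cplxZ.
- by apply: cplxZ; exact: cplxM.
- by rewrite !sqnormqZ sqnormqM v1 -[RHS]cc; ring.
exists s; rewrite milnor_model1 ?sa//.
suff -> : to_HxS3 (chart1 s) = x by [].
apply: set_val_inj; rewrite set_val_to_HxS3; last by apply: chart1_in; rewrite sa.
rewrite E /chart1 /cross sa sb nv sc scalerA cV scale1r conjqZ.
by rewrite -scalerAl -scalerAr -mulrA vv mulr1 !scalerA -mulrA cVV scale1r.
Qed.

(** Equivalent points of the same chart are equal, so a class is fixed by i only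
    if its representatives are, that is, if they are complex. *)
Lemma milnor_model_fixed k l c : k + l = 1 ->
  (milnor_act qi c = c <-> exists s, @milnor_model R k l s = c).
Proof.
move=> kl; split=> [|[s <-]].
  rewrite -(milnor_reprK c); case: (milnor_repr c) => b x.
  rewrite milnor_actE => /milnor_pi_inj /HxS3_act_fixed [h1 h2].
  by apply: milnor_model_onto => //; apply/conj_by_qiP.
have H (x : H2) : HxS3 x -> cplx x.1 -> cplx x.2 ->
    HxS3_act qi (to_HxS3 x) = to_HxS3 x.
  move=> hx h1 h2; apply/HxS3_act_fixed; rewrite set_val_to_HxS3//.
  by split; apply/conj_by_qiP.
rewrite /milnor_model; case: ifPn => [a0|/negPn/eqP a0];
  rewrite milnor_actE /two_HxS3_act /= H//; try (apply: cplxZ).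
- exact: chart1_in.
- exact: cplx_cross.
- exact: cplx_al.
- by apply: chart2_in; exact: al_be_neq0.
- exact: cplx_cross.
- exact: cplx_be.
Qed.

Lemma milnor_model_flip k l s :
  milnor_act qj (milnor_model k l s) = milnor_model k l (flip s).
Proof.
have nE (u : quat R) : sqnorm (conj_by (set_val qj) u) = sqnorm u.
  by rewrite /conj_by sqnorm_conj// S3P.
have cE : cross (flip s) = conj_by (set_val qj) (cross s).
  by rewrite /cross conj_byM ?S3P// conj_by_conjq al_flip be_flip.
have zE (u : quat R) : (conj_by (set_val qj) u != 0) = (u != 0).
  by rewrite -!sqnormq_gt0 nE.
have H (x y : H2) : HxS3 x -> HxS3 y -> conjH (set_val qj) x = y ->
    HxS3_act qj (to_HxS3 x) = to_HxS3 y.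
  move=> hx hy xy; apply: set_val_inj; rewrite [LHS]set_val_pt.
  by rewrite !set_val_to_HxS3.
rewrite /milnor_model al_flip zE; case: ifPn => [a0|/negPn/eqP a0].
  rewrite milnor_actE /two_HxS3_act /= (H _ (chart1 (flip s)))//.
  - exact: chart1_in.
  - by apply: chart1_in; rewrite al_flip zE.
  - by rewrite /chart1 cE al_flip nE /conjH /= -/(conj_by _ _) -/(conj_by _ _) !conj_byZ.
have b0 := al_be_neq0 a0.
rewrite milnor_actE /two_HxS3_act /= (H _ (chart2 (flip s)))//.
- exact: chart2_in.
- by apply: chart2_in; rewrite be_flip zE.
- by rewrite /chart2 cE be_flip nE /conjH /= -/(conj_by _ _) -/(conj_by _ _) !conj_byZ.
Qed.
End MilnorModelProperties.

(** * Points of the Gromoll-Meyer manifolds fixed by i *)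

Section GromollMeyerModel.
Context {R : realType}.
Local Notation H2 := (quat R * quat R)%type.
Implicit Types (s : @S3 R) (m : int).

(** The functions c and u are the Chebyshev polynomials T_n and U_(n-1). *)
Lemma chebyshev_nat (n : nat) : exists c u : R -> R,
  [/\ continuous c, continuous u, forall t, cos (n%:R * t) = c (cos t) &
      forall t, sin (n%:R * t) = u (cos t) * sin t].
Proof.
elim: n => [|n [c [u [cc cu cE uE]]]].
  exists (fun=> 1), (fun=> 0); split; try exact: cst_continuous.
    by move=> t; rewrite mul0r cos0.
  by move=> t; rewrite mul0r sin0 mul0r.
have idm (f : R -> R) : continuous f -> continuous (fun x : R => x * f x).
  by move=> cf x; apply: cvgM; [exact: cvg_id|exact: cf].
exists (fun x => x * c x - (1 - x ^+ 2) * u x), (fun x => x * u x + c x); split.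
- move=> x; apply: cvgB; first exact: (idm _ cc).
  apply: cvgM; last exact: cu.
  by apply: cvgB; [exact: cvg_cst|exact: exprn_continuous].
- by move=> x; apply: cvgD; [exact: (idm _ cu)|exact: cc].
- move=> t; rewrite -natr1 mulrDl mul1r cosD cE uE -sin2cos2; ring.
- by move=> t; rewrite -natr1 mulrDl mul1r sinD cE uE; ring.
Qed.

Lemma chebyshev m : exists c u : R -> R,
  [/\ continuous c, continuous u, forall t, cos (m%:~R * t) = c (cos t) &
      forall t, sin (m%:~R * t) = u (cos t) * sin t].
Proof.
case: m => n; first exact: chebyshev_nat.
have [c [u [cc cu cE uE]]] := chebyshev_nat n.+1.
exists c, (fun x => - u x); split => //.
- by move=> x; apply: cvgN; exact: cu.
- by move=> t; rewrite NegzE mulrNz mulNr cosN cE.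
- by move=> t; rewrite NegzE mulrNz !mulNr sinN uE.
Qed.

(** The parameters t, p and w cannot be chosen continuously in x; these formulas
    avoid them and show that rho is continuous. *)
Lemma rho_chebyshev m : exists c u : R -> R, [/\ continuous c, continuous u &
  forall x : H2, S7 x -> rho m x =
    ((c (q0 x.1) - u (q0 x.1) * q0 x.1) *: 1 + u (q0 x.1) *: x.1,
     u (q0 x.1) *: x.2)].
Proof.
have [c [u [cc cu cE uE]]] := chebyshev m; exists c, u; split => // x.
move=> /rho_paramP[t [p [w [pw ->]]]]; rewrite rhoE// (rho_param_cos t w pw.1).
rewrite /rho_param cE uE /= !scalerA; congr (_, _).
by apply: quatP; rewrite oneqE !qE; ring.
Qed.

Lemma rho_S7 m (x : H2) : S7 x -> S7 (rho m x).
Proof.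
move=> /rho_paramP[t [p [w [pw ->]]]]; rewrite rhoE//.
move: (m%:~R * t) => a; case: pw => p0 pw; rewrite /S7 /rho_param /=.
have -> : sqnorm (cos a *: 1 + sin a *: p) =
    cos a ^+ 2 + sin a ^+ 2 * sqnorm p.
  by rewrite !sqnormq oneqE !qE p0; ring.
by rewrite sqnormqZ -addrA -mulrDr pw mulr1 cos2Dsin2.
Qed.

Definition cplx2 (x : H2) : Prop := cplx x.1 /\ cplx x.2.

Lemma cplx2P (x : H2) : cplx2 x <-> conjH (set_val qi) x = x.
Proof.
rewrite /cplx2 -!conj_by_qiP /conjH -/(conj_by _ _) -/(conj_by _ _).
case: x => u v /=; split=> [[h1 h2]|h]; first by rewrite h1 h2.
by split; [exact: (congr1 fst h)|exact: (congr1 snd h)].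
Qed.

(** The map rho commutes with the conjugation by i, whose fixed points are the
    complex pairs. *)
Lemma rho_cplx2 m (x : H2) : S7 x -> cplx2 x -> cplx2 (rho m x).
Proof. by move=> hx /cplx2P cx; apply/cplx2P; rewrite -rho_conjH// cx. Qed.

(** For complex x the complex solutions v of hdot x v = 0 form a line, spanned by
    this vector. *)
Definition perp (x : H2) : H2 := (- conjq x.2, conjq x.1).

Lemma cplx2_perp x : cplx2 x -> cplx2 (perp x).
Proof.
by move=> [h1 h2]; split; rewrite /=; [apply: cplxN|]; exact: cplx_conjq.
Qed.

Lemma sqnormqN (u : quat R) : sqnorm (- u) = sqnorm u.
Proof. by rewrite !sqnormq !qE; ring. Qed.

Lemma S7_perp x : S7 x -> S7 (perp x).
Proof. by rewrite /S7 /perp /= sqnormqN !sqnorm_conjq addrC. Qed.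

Lemma hdot_perp x : cplx2 x -> hdot x (perp x) = 0.
Proof.
move=> [h1 h2]; rewrite /hdot /perp /= mulrN.
by rewrite (cplx_comm (cplx_conjq h1) (cplx_conjq h2)) addNr.
Qed.

Definition cpoint s : H2 := (al (set_val s), be (set_val s)).

Lemma cpoint_S7 s : S7 (cpoint s).
Proof. by rewrite /S7 /= sqnorm_al_be S3P. Qed.

Lemma cpoint_cplx2 s : cplx2 (cpoint s).
Proof. by split; [exact: cplx_al|exact: cplx_be]. Qed.

Lemma section_in m s : gm_total m (cpoint s, perp (rho m (cpoint s))).
Proof.
have hS := cpoint_S7 s; have hC := cpoint_cplx2 s.
split; rewrite ?/fst ?/snd //; first by apply: S7_perp; exact: rho_S7.
by apply: hdot_perp; exact: rho_cplx2.
Qed.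

Definition gm_section m s : gm_total m := pt (section_in m s).

(** The star-orbits of the pairs (u, perp (rho u)) with u complex; they form the
    set of the points fixed by i. *)
Definition gm_model m s : Sigma7 R m := Sigma7_pi (gm_section m s).

Lemma continuous_gm_model m : continuous (@gm_model m).
Proof.
have [c [u [cc cu rE]]] := rho_chebyshev m.
have ca := @continuous_al_S3 R; have cb := @continuous_be_S3 R.
have c0 : continuous (fun s : @S3 R => q0 (al (set_val s))).
  exact: (continuous_coord (@continuous_q0 R) ca).
have comp0 (f : R -> R) : continuous f ->
    continuous (fun s : @S3 R => f (q0 (al (set_val s)))).
  by move=> cf s; apply: (@continuous_comp _ _ _ (fun s : @S3 R => q0 (al (set_val s))) f);
    [exact: c0|exact: cf].
pose a0 s := q0 (al (set_val s)).
pose k1 s := c (a0 s) - u (a0 s) * a0 s.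
have ck1 : continuous k1.
  by move=> s; exact: (cvgB (comp0 _ cc s) (cvgM (comp0 _ cu s) (c0 s))).
pose r1 s : quat R := k1 s *: 1 + u (a0 s) *: al (set_val s).
pose r2 s : quat R := u (q0 (al (set_val s))) *: be (set_val s).
have c11 : continuous (fun s => k1 s *: (1 : quat R)).
  by move=> s; exact: (cvgZ (ck1 s) (cvg_cst _)).
have c12 : continuous (fun s : @S3 R => u (a0 s) *: al (set_val s)).
  by move=> s; exact: (cvgZ (comp0 _ cu s) (ca s)).
have cr1 : continuous r1 by move=> s; exact: (cvgD (c11 s) (c12 s)).
have cr2 : continuous r2 by move=> s; exact: (cvgZ (comp0 _ cu s) (cb s)).
have cj1 := continuous_conjq cr1; have cj2 := continuous_conjq cr2.
have cs : continuous (@gm_section m).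
  apply: continuous_to_subset.
  have -> : (fun s => set_val (gm_section m s)) =
      (fun s => ((al (set_val s), be (set_val s)), (- conjq (r2 s), conjq (r1 s)))).
    by apply/funext => s; rewrite set_val_pt /perp (rE _ (cpoint_S7 s)).
  move=> s; exact: (cvg_pair (cvg_pair (ca s) (cb s)) (cvg_pair (cvgN (cj2 s)) (cj1 s))).
move=> s; apply: (@continuous_comp _ _ _ (@gm_section m) (@Sigma7_pi R m)).
  exact: cs.
exact: pi_continuous.
Qed.

Lemma cplx_div (q v : quat R) : v != 0 -> cplx v -> cplx (q * v) -> cplx q.
Proof.
move=> v0 cv cqv.
have -> : q = (sqnorm v)^-1 *: (q * v * conjq v).
  rewrite -mulrA mul_conjq -scalerAr mulr1 scalerA mulVf ?scale1r//.
  by rewrite sqnormq_eq0.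
by apply: cplxZ; apply: cplxM => //; exact: cplx_conjq.
Qed.

Lemma S7_neq0 (x : H2) : S7 x -> x.1 != 0 \/ x.2 != 0.
Proof.
rewrite /S7 /= => h; have [x0|] := eqVneq x.1 0; last by left.
right; apply/eqP => y0; move: h.
have -> : sqnorm x.1 = 0 by apply/eqP; rewrite sqnormq_eq0; apply/eqP.
have -> : sqnorm x.2 = 0 by apply/eqP; rewrite sqnormq_eq0; apply/eqP.
by rewrite addr0 => /eqP; rewrite eq_sym oner_eq0.
Qed.

(** If q moves one complex pair with nonzero v to another, then q is complex and
    hence acts trivially on u. *)
Lemma gm_model_inj m : injective (@gm_model m).
Proof.
move=> s t /Sigma7_piP[q] /(congr1 set_val); rewrite !set_val_pt.
rewrite /star_fun => E.
have hx : S7 (perp (rho m (cpoint s))).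
  by apply: S7_perp; apply: rho_S7; exact: cpoint_S7.
have cx : cplx2 (perp (rho m (cpoint s))).
  by apply: cplx2_perp; apply: rho_cplx2; [exact: cpoint_S7|exact: cpoint_cplx2].
have cy : cplx2 (perp (rho m (cpoint t))).
  by apply: cplx2_perp; apply: rho_cplx2; [exact: cpoint_S7|exact: cpoint_cplx2].
have E1 : al (set_val t) = set_val q * al (set_val s) * conjq (set_val q).
  exact: (congr1 (fun z : H2 * H2 => z.1.1) E).
have E2 : be (set_val t) = set_val q * be (set_val s) * conjq (set_val q).
  exact: (congr1 (fun z : H2 * H2 => z.1.2) E).
have E3 : (perp (rho m (cpoint t))).1 = set_val q * (perp (rho m (cpoint s))).1.
  exact: (congr1 (fun z : H2 * H2 => z.2.1) E).
have E4 : (perp (rho m (cpoint t))).2 = set_val q * (perp (rho m (cpoint s))).2.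
  exact: (congr1 (fun z : H2 * H2 => z.2.2) E).
clear E.
have cq : cplx (set_val q).
  have [n1|n2] := S7_neq0 hx.
    by apply: (cplx_div n1 cx.1); rewrite -E3; exact: cy.1.
  by apply: (cplx_div n2 cx.2); rewrite -E4; exact: cy.2.
have fixq (u : quat R) : cplx u -> set_val q * u * conjq (set_val q) = u.
  by move=> cu; rewrite (cplx_comm cq cu) -mulrA mulq_conj ?mulr1// S3P.
rewrite fixq in E1; last exact: cplx_al.
rewrite fixq in E2; last exact: cplx_be.
by apply: set_val_inj; exact: esym (al_be_inj E1 E2).
Qed.

Lemma gm_model_flip m s : Sigma7_act qj (gm_model m s) = gm_model m (flip s).
Proof.
rewrite Sigma7_actE; apply/esym/esym/Sigma7_piP; exists qj.
apply: set_val_inj; rewrite !set_val_pt /star_fun /bullet_fun.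
have E : cpoint (flip s) = conjH (set_val qj) (cpoint s).
  by rewrite /cpoint al_flip be_flip.
rewrite E rho_conjH; last exact: cpoint_S7.
move: (rho m (cpoint s)) => r; rewrite /perp /conjH /=.
rewrite -!/(conj_by _ _) -!conj_by_conjq /conj_by !mulrA.
by rewrite !mulrN !mulNr.
Qed.

End GromollMeyerModel.

Section GromollMeyerFixed.
Context {R : realType}.
Local Notation H2 := (quat R * quat R)%type.
Implicit Types (s : @S3 R) (m : int).

Lemma cplxD (u v : quat R) : cplx u -> cplx v -> cplx (u + v).
Proof. by move=> [a1 a2] [b1 b2]; split; rewrite ?q2D ?q3D ?a1 ?b1 ?a2 ?b2 addr0. Qed.

(** The factor is the determinant of the pair (y, v); the equations are Cramer's
    rule for the unitary basis y, perp y. *)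
Lemma cplx2_orthogonal (y v : H2) : S7 y -> S7 v -> cplx2 y -> cplx2 v ->
  hdot y v = 0 -> exists l : quat R, [/\ cplx l, sqnorm l = 1,
    l * (perp y).1 = v.1 & l * (perp y).2 = v.2].
Proof.
case: y v => [y1 y2] [v1 v2]; rewrite /S7 /hdot /perp /=.
move=> hy hv [/= cy1 cy2] [/= cv1 cv2] h.
have h1 : conjq y1 * v1 = - (conjq y2 * v2) by apply/eqP; rewrite -addr_eq0 h.
have h2 : conjq y2 * v2 = - (conjq y1 * v1) by rewrite h1 opprK.
pose l := y1 * v2 - y2 * v1.
have T1 : y2 * v1 * conjq y2 = sqnorm y2 *: v1.
  by rewrite (cplx_comm cy2 cv1) -mulrA mul_conjq -scalerAr mulr1.
have T2 : y1 * v2 * conjq y2 = - (sqnorm y1 *: v1).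
  rewrite -mulrA (cplx_comm cv2 (cplx_conjq cy2)) h2 mulrN mulrA mul_conjq.
  by rewrite -scalerAl mul1r.
have T3 : y2 * v1 * conjq y1 = - (sqnorm y2 *: v2).
  rewrite -mulrA (cplx_comm cv1 (cplx_conjq cy1)) h1 mulrN mulrA mul_conjq.
  by rewrite -scalerAl mul1r.
have T4 : y1 * v2 * conjq y1 = sqnorm y1 *: v2.
  by rewrite (cplx_comm cy1 cv2) -mulrA mul_conjq -scalerAr mulr1.
have E1 : l * - conjq y2 = v1.
  by rewrite mulrN mulrBl T1 T2 opprB opprK -scalerDl addrC hy scale1r.
have E2 : l * conjq y1 = v2.
  by rewrite mulrBl T3 T4 opprK -scalerDl hy scale1r.
exists l; split => //.
- by apply: cplxD; [|apply: cplxN]; exact: cplxM.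
- have : sqnorm l * (sqnorm y1 + sqnorm y2) = 1.
    rewrite -[RHS]hv -E1 -E2 !sqnormqM sqnormqN !sqnorm_conjq.
    by rewrite mulrDr addrC.
  by rewrite hy mulr1.
Qed.

(** The vector v is a unit complex multiple l of perp (rho u), and l, acting by
    star, fixes the complex pair u. *)
Lemma gm_model_onto m (x : gm_total m) :
  cplx2 (set_val x).1 -> cplx2 (set_val x).2 -> exists s, gm_model m s = Sigma7_pi x.
Proof.
have [] := ptP x; case E: (set_val x) => [u v]; rewrite [_.1]/= [_.2]/= => hu hv h cu cv.
have [l [cl nl l1 l2]] := cplx2_orthogonal (rho_S7 m hu) hv (rho_cplx2 m hu cu) cv h.
have [s [sa sb]] := pair_S3 cu.1 cu.2 hu.
have sE : cpoint s = u by rewrite /cpoint sa sb; case: (u).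
exists s; apply/Sigma7_piP.
have hl : @S3 R l by [].
exists (pt hl); apply: set_val_inj; rewrite E.
rewrite [set_val (star _ _)]set_val_pt [set_val (gm_section m s)]set_val_pt.
rewrite [set_val (pt hl)]set_val_pt sE /star_fun.
have fixl (z : quat R) : cplx z -> l * z * conjq l = z.
  by move=> cz; rewrite (cplx_comm cl cz) -mulrA mulq_conj ?mulr1.
have -> : conjH l (u, perp (rho m u)).1 = u.
  rewrite /conjH [_.1]/= (fixl _ cu.1) (fixl _ cu.2).
  by case: (u).
have -> : l * (u, perp (rho m u)).2.1 = v.1 by exact: l1.
have -> : l * (u, perp (rho m u)).2.2 = v.2 by exact: l2.
by case: (v).
Qed.

(** A fixed point is represented by a pair (u, v) with q u = u q and q v = v i
    for a unit quaternion q. A unit r for which one entry of r v is real and not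
    0 conjugates q to i, and acting by r makes u and v commute with i. *)
Lemma gm_model_fixed m c : Sigma7_act qi c = c <-> exists s, gm_model m s = c.
Proof.
split=> [|[s <-]]; last first.
  rewrite Sigma7_actE; apply/Sigma7_piP; exists qi; apply: set_val_inj.
  have c1 := cpoint_cplx2 s.
  have c2 : cplx2 (perp (rho m (cpoint s))).
    by apply: cplx2_perp; apply: rho_cplx2 => //; exact: cpoint_S7.
  rewrite [set_val (star _ _)]set_val_pt [set_val (gm_bullet _ _)]set_val_pt.
  rewrite [set_val (gm_section m s)]set_val_pt /star_fun /bullet_fun.
  move: c1 c2 => /cplx2P c1 /cplx2P c2.
  have e1 : conjH (set_val qi) (cpoint s, perp (rho m (cpoint s))).1 = cpoint s.
    exact: c1.
  rewrite e1 -{1}c2 /conjH /=.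
  by rewrite !mulrA.
rewrite -(Sigma7_reprK c); move: (Sigma7_repr c) => x {c}.
rewrite Sigma7_actE => /Sigma7_piP[q /(congr1 set_val)].
rewrite [set_val (star _ _)]set_val_pt [set_val (gm_bullet _ _)]set_val_pt => E.
have [hu hv _] := ptP x; move: E hu hv; case xE: (set_val x) => [[u1 u2] [v1 v2]].
rewrite /star_fun /bullet_fun => E hu hv.
have E1 : u1 = set_val q * u1 * conjq (set_val q).
  exact: (congr1 (fun z : H2 * H2 => z.1.1) E).
have E2 : u2 = set_val q * u2 * conjq (set_val q).
  exact: (congr1 (fun z : H2 * H2 => z.1.2) E).
have E3 : v1 = set_val q * (v1 * conjq (set_val qi)).
  exact: (congr1 (fun z : H2 * H2 => z.2.1) E).
have E4 : v2 = set_val q * (v2 * conjq (set_val qi)).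
  exact: (congr1 (fun z : H2 * H2 => z.2.2) E).
clear E.
have [w [w0 wE]] : exists w : quat R, w != 0 /\
    w = set_val q * (w * conjq (set_val qi)).
  by have [n1|n2] := S7_neq0 hv; [exists v1|exists v2].
pose r := conjq ((Num.sqrt (sqnorm w))^-1 *: w).
have nr : sqnorm r = 1 by rewrite sqnorm_conjq unit_direction.
have rq : r * set_val q = set_val qi * r.
  have wi : set_val q * w = w * set_val qi.
    by rewrite {2}wE -!mulrA conj_mulq ?S3P// mulr1.
  have nq := S3P q; have ni := S3P (@qi R).
  have rw : set_val q * conjq r = conjq r * set_val qi.
    by rewrite conjqK -scalerAr wi scalerAl.
  rewrite -[LHS]mulr1 -(conj_mulq nr) mulrA -(mulrA r) rw.
  by rewrite !mulrA mulq_conj// mul1r.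
have rqc : conjq (set_val q) * conjq r = conjq r * conjq (set_val qi).
  by rewrite -!conjqM rq.
pose r' : @S3 R := pt (nr : S3 r).
have -> : Sigma7_pi x = Sigma7_pi (star r' x) by apply/Sigma7_piP; exists r'.
have fixu (z : quat R) : z = set_val q * z * conjq (set_val q) ->
    cplx (r * z * conjq r).
  move=> zE; apply/conj_by_qiP; rewrite /conj_by {2}zE.
  by rewrite !mulrA rq -!mulrA rqc.
have fixv (z : quat R) : z = set_val q * (z * conjq (set_val qi)) -> cplx (r * z).
  by move=> zE; apply/conj_by_qiP; rewrite /conj_by {2}zE !mulrA rq.
apply: gm_model_onto; rewrite [set_val (star _ _)]set_val_pt xE /star_fun
  [set_val r']set_val_pt.
  by split; [exact: fixu E1|exact: fixu E2].
by split; [exact: fixv E3|exact: fixv E4].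
Qed.

End GromollMeyerFixed.

(** * Brieskorn spheres against the other two families *)

Theorem theorem6 (R : realType) (n : nat) (hn : (1 <= n)%N) :
  (forall m : int,
     ~ SO3_diffeomorphic
         (brieskorn_charts R (6 * n - 1)%N 3) (@brieskorn_act R (6 * n - 1)%N 3)
         (Sigma7_charts R m) (@Sigma7_act R m)) /\
  (forall k l : int, k + l = 1 ->
     ~ SO3_diffeomorphic
         (brieskorn_charts R (6 * n - 1)%N 3) (@brieskorn_act R (6 * n - 1)%N 3)
         (milnor_charts R k l) (@milnor_act R k l)).
Proof.
have q_odd : odd (6 * n - 1) by rewrite oddB ?oddM//; lia.
have q_gt2 : (2 < 6 * n - 1)%N by lia.
split=> [m|k l kl].
  apply: (@not_diffeomorphic_of_model R 3 (6 * n - 1) isT q_odd isT q_gt2 _ _ _ _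
    (gm_model m)).
  - exact: continuous_gm_model.
  - exact: gm_model_inj.
  - exact: gm_model_fixed.
  - exact: gm_model_flip.
apply: (@not_diffeomorphic_of_model R 3 (6 * n - 1) isT q_odd isT q_gt2 _ _ _ _
  (milnor_model k l)).
- exact: continuous_milnor_model.
- exact: milnor_model_inj.
- by move=> c; exact: milnor_model_fixed.
- exact: milnor_model_flip.
Qed.
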